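(* Let $n$ be a positive integer and $2\le p<n$. Let $K:\mathbb{R}^n\to\mathbb{R}$ be an arbitrary concave function, let $y_i\in\mathbb{R}^n$ and $a_i\ge 0$ for $i=1,2,\dots$, and define \[W(x):=\sum_{i=1}^\infty \frac{a_i}{|x-y_i|^{\frac{n-p}{p-1}}}+K(x),\qquad x\in\mathbb{R}^n,\] with values in $(-\infty,\infty]$. If the series converges at some point of $\mathbb{R}^n$, then $W$ is $p$-superharmonic in $\mathbb{R}^n$.
   Context: In the series, a term with $a_i>0$ is interpreted as $+\infty$ at $x=y_i$, and terms with $a_i=0$ are identically $0$; since all terms are nonnegative the series has a value in $[0,\infty]$ at every point. A continuous function $h\in W^{1,p}_{loc}(D)$ on a domain $D\subset\mathbb{R}^n$ is called $p$-harmonic in $D$ if $\int |\nabla h|^{p-2}\nabla h\cdot\nabla\phi\,dx=0$ for every $\phi\in C_0^\infty(D)$. For a domain $\Omega\subset\mathbb{R}^n$, a function $u:\Omega\to(-\infty,\infty]$ is $p$-superharmonic in $\Omega$ if (i) $u\not\equiv\infty$; (ii) $u$ is lower semicontinuous in $\Omega$; (iii) whenever $D$ is an open set with compact closure $\overline D\subset\Omega$ and $h\in C(\overline D)$ is $p$-harmonic in $D$ with $h\le u$ on $\partial D$, then $h\le u$ in $D$. *)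

(* Defs.v *)
From HB Require Import structures.
From mathcomp Require Import all_boot all_order all_algebra.
From mathcomp Require Import all_classical all_reals all_analysis.
Set Implicit Arguments. Unset Strict Implicit. Unset Printing Implicit Defensive.
Import Order.TTheory GRing.Theory Num.Theory.
Import numFieldNormedType.Exports.
Local Open Scope classical_set_scope.
Local Open Scope ring_scope.

Section PSuper.
Variables (R : realType) (n : nat).
Notation V := 'rV[R]_n.

(* Euclidean norm on R^n (the canonical norm of 'rV is the sup norm). *)
Definition enorm (x : V) : R := Num.sqrt (\sum_(j < n) x 0 j ^+ 2).

Definition setc (x : V) (k : nat) (t : R) : V :=
  \row_j (if (j : nat) == k then t else x 0 j).

Fixpoint iint (m : nat) (f : V -> \bar R) (x : V) : \bar R :=
  match m with
  | 0 => f x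
  | m'.+1 => (\int[@lebesgue_measure R]_t iint m' f (setc x m' t))%E
  end.

(* Lebesgue integral on R^n (n-fold product of 1-d Lebesgue measure,
   computed by Tonelli) of a nonnegative function *)
Definition nnintegral (f : V -> \bar R) : \bar R := iint n f 0.

Definition sintegral (f : V -> R) : \bar R :=
  (nnintegral (fun x => (Num.max (f x) 0)%:E)
   - nnintegral (fun x => (Num.max (- f x) 0)%:E))%E.

Definition borel_fun (f : V -> R) : Prop :=
  forall B : set R, open B -> <<s open >> (f @^-1` B).

Definition Lploc (p : R) (D : set V) (f : V -> R) : Prop :=
  forall Kc : set V, compact Kc -> Kc `<=` D ->
    (nnintegral (fun x => (\1_Kc x * powR `|f x| p)%:E) < +oo)%E.

Definition pd (j : 'I_n) (f : V -> R) : V -> R :=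
  fun x => derive f x (delta_mx 0 j).

Definition iter_pd (js : seq 'I_n) (f : V -> R) : V -> R := foldr pd f js.

Definition smooth (f : V -> R) : Prop :=
  forall js : seq 'I_n, continuous (iter_pd js f) /\
    forall (j : 'I_n) (x : V), derivable (iter_pd js f) x (delta_mx 0 j).

Definition supp (f : V -> R) : set V := [set x | f x != 0].

Definition test_fun (D : set V) (phi : V -> R) : Prop :=
  smooth phi /\ compact (closure (supp phi)) /\ closure (supp phi) `<=` D.

Definition gnorm (G : 'I_n -> V -> R) (x : V) : R :=
  Num.sqrt (\sum_(j < n) G j x ^+ 2).

Definition p_harmonic (p : R) (D : set V) (h : V -> R) : Prop :=
  {within D, continuous h} /\ Lploc p D h /\
  exists G : 'I_n -> V -> R,
    (forall j, borel_fun (G j) /\ Lploc p D (G j)) /\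
    (forall phi, test_fun D phi -> forall j,
        sintegral (fun x => h x * pd j phi x)
        = (- sintegral (fun x => (G j x * phi x)%R))%E) /\
    (forall phi, test_fun D phi ->
        sintegral (fun x => powR (gnorm G x) (p - 2) *
                            \sum_(j < n) G j x * pd j phi x) = 0%E).

Definition p_superharmonic (p : R) (Omega : set V) (u : V -> \bar R) : Prop :=
  (forall x, Omega x -> u x != -oo%E) /\
  (exists x, Omega x /\ u x != +oo%E) /\
  (forall x, Omega x -> forall a : R, (a%:E < u x)%E ->
      \forall y \near x, (a%:E < u y)%E) /\
  (forall (D : set V) (h : V -> R),
      open D -> compact (closure D) -> closure D `<=` Omega ->
      {within closure D, continuous h} -> p_harmonic p D h ->
      (forall x, closure D x -> ~ D x -> ((h x)%:E <= u x)%E) ->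
      forall x, D x -> ((h x)%:E <= u x)%E).

Definition concave (K : V -> R) : Prop :=
  forall (x y : V) (t : R), 0 <= t <= 1 ->
    t * K x + (1 - t) * K y <= K (t *: x + (1 - t) *: y).

Definition kterm (e a : R) (y x : V) : \bar R :=
  if a == 0 then 0%E
  else if x == y then +oo%E
  else (a / powR (enorm (x - y)) e)%:E.

Definition Wseries (p : R) (a : nat -> R) (y : nat -> V) (x : V) : \bar R :=
  (\sum_(0 <= i <oo) kterm ((n%:R - p) / (p - 1)) (a i) (y i) x)%E.

End PSuper.

(* Main.v *)
(* Each smoothed fundamental solution (|x - y|^2 + t)^(-e/2), e = (n-p)/(p-1),
   and each affine function satisfies the linear "dominative" inequality
   tr D^2 v + (p-2) <D^2 v q, q> <= 0 for |q| <= 1. Hence so does any finite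
   combination v = sum_i a_i (|x - y_i|^2 + t)^(-e/2) + l with a_i >= 0, and v is
   a smooth weak supersolution of the p-Laplace equation (integrate the
   divergence of (|grad v|^2 + s)^((p-2)/2) grad v by parts, then let s -> 0).

   Comparison of a p-harmonic h with such a v: if g = (h - v)^+ is somewhere
   larger than c > 0, then test both equations with F(g_k - c), where g_k is a
   mollification of g and F(t) = exp(-1/t) for t > 0. Mollified test functions
   are needed because only smooth ones are admissible; the error is controlled by
   the integral of rho_k(x - z) |grad g(x) - grad g(z)|^p. Monotonicity of the flux gives
   grad h = grad v a.e. on {g > c}, and then the integral of F(g - c) vanishes
   (integrate x_0 d_0 F(g_k - c)), a contradiction.

   The truncated and smoothed series increase to W - K. Given h <= W on the
   boundary of D and a point x of D, let l be a supporting affine function of K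
   at x. By Dini's argument h < v_k + l + c on the boundary for some k, so
   h <= v_k + l + c in D, and at x this reads h(x) <= W(x) + c. *)

Require Import Defs.
From HB Require Import structures.
From mathcomp Require Import all_boot all_order all_algebra.
From mathcomp Require Import all_classical all_reals all_analysis.
From mathcomp Require Import measurable_realfun ring lra.
Import Order.TTheory GRing.Theory Num.Theory.
Import numFieldNormedType.Exports.
Local Open Scope classical_set_scope.
Local Open Scope ring_scope.
Set Implicit Arguments. Unset Strict Implicit. Unset Printing Implicit Defensive.

(** * Lebesgue measure on R^n *)

(** The weak gradient [G] of h is known only through smooth test functions, so a chain rule for (h -
    v)^+ is not at hand. Mollifying before composing avoids it: F(g_k - c) is smooth and lives where
    g >= c/2, and at a fine scale the mollifier centred at such a point sees only points where g = h
    - v. There the gradient of g_k is the mollified G - grad v.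

    The price is a pairing of this mollified gradient with a flux difference that is only dominated
    by the (p-1)-th power of an L^p function. Its convergence is reduced to L^1 mollification: the
    dominating function is cut at a level, and a crude Young inequality handles the part above it.

    The exponent e is decisive in a single identity, e (p - 1) = n - p, which makes the upper bound
    for a smoothed kernel in the dominative inequality exactly zero. An arbitrary concave K has no
    second derivatives to feed into that inequality; an affine majorant touching K at the one point
    under study does, and it stays above K on the boundary of D. *)

Notation borel R n := (g_sigma_algebraType (@open 'rV[R]_n)).

Section BorelRow.
Context {R : realType} {n : nat}.
Local Notation V := 'rV[R]_n.
Local Notation MV := (borel R n).

Lemma ball_rowP (x y : V) e : 0 < e ->
  ball x e y <-> forall j, `|x 0 j - y 0 j| < e.
Proof.
move=> e0; split.
  by move=> [_ H] j; apply: H.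
by move=> H; split => // i j; rewrite ord1; exact: H.
Qed.

Lemma rat_approx (x r : R) : 0 < r -> exists q : rat, `|ratr q - x| < r.
Proof.
move=> r0; have [q] := @rat_in_itvoo R (x - r) (x + r) ltac:(lra).
by rewrite in_itv /= => qr; exists q; rewrite ltr_distl; lra.
Qed.

Lemma rat_ball_sub (U : set V) (x : V) : open U -> U x ->
  exists (q : 'rV[rat]_n) (k : nat),
    ball (map_mx ratr q : V) k.+1%:R^-1 x /\
    ball (map_mx ratr q : V) k.+1%:R^-1 `<=` U.
Proof.
move=> oU Ux; have /nbhs_ballP[e /= e0 eU] := open_nbhs_nbhs (conj oU Ux).
have e2 : 0 < e / 2 by lra.
pose k := Num.truncn (e / 2)^-1.
have k0 : 0 < k.+1%:R^-1 :> R by rewrite invr_gt0.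
have ke : k.+1%:R^-1 < e / 2.
  rewrite -[ltRHS]invrK ltf_pV2 ?posrE ?invr_gt0//.
  by rewrite /k truncnS_gt.
have [q Hq] := choice (fun j => rat_approx (x 0 j) k0).
exists (\row_j q j), k; split.
  by apply/ball_rowP => // j; rewrite !mxE; exact: Hq.
move=> y /(ball_rowP _ _ k0) yq; apply: eU; apply/ball_rowP => // j.
have := yq j; have := Hq j; rewrite !mxE.
rewrite -[x 0 j - y 0 j](subrKA (ratr (q j))) => h1 h2.
apply: le_lt_trans (ler_normD _ _) _; rewrite [X in X + _]distrC.
by apply: lt_trans (ltrD h1 h2) _; rewrite [ltRHS]splitr; exact: ltrD.
Qed.

(** Rational cubes form a countable base, so the preimage of an open set is a countable union of
    preimages of cubes, and each of these is a finite intersection of conditions on single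
    coordinates. *)
Lemma measurable_fun_row d (T : measurableType d) (f : T -> V) :
  (forall j, measurable_fun setT (fun x => f x 0 j)) ->
  measurable_fun setT (f : T -> MV).
Proof.
move=> mf; apply: (@measurability _ _ T MV setT f (@open V)) => [|_ [U oU <-]]; first by []; rewrite setTI.
pose B (i : 'rV[rat]_n * nat) : set V := ball (map_mx ratr i.1 : V) i.2.+1%:R^-1.
(* The union runs over all codes in [nat]; invalid codes and cubes not contained in [U] contribute
   the empty set. *)
pose F (i : nat) : set T :=
  if unpickle i is Some qk then
    if pselect (B qk `<=` U) then f @^-1` B qk else set0 else set0.
have -> : f @^-1` U = \bigcup_i F i.
  apply/seteqP; split => x /=.
    move=> /(rat_ball_sub oU)[q [k [qx qU]]].
    exists (pickle (q, k)) => //; rewrite /F pickleK.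
    by case: pselect.
  move=> [i _]; rewrite /F; case: unpickle => // qk.
  by case: pselect => [BU|?] /= => [Bx|[]]; exact: (BU (f x)).
apply: bigcupT_measurable => i; rewrite /F.
case: unpickle => // qk; case: pselect => [?|?] /=; last exact: measurable0.
have -> : f @^-1` B qk = \bigcap_(j in [set: 'I_n])
    [set x | `|ratr (qk.1 0 j) - f x 0 j| < qk.2.+1%:R^-1].
  apply/seteqP; split => x /=.
    by move=> /(ball_rowP _ _ _) H j _; have := H _ j; rewrite mxE; apply; rewrite invr_gt0.
  by move=> H; apply/ball_rowP => [|j]; [rewrite invr_gt0|rewrite mxE; exact: H].
apply: fin_bigcap_measurable => [|j _]; first exact: finite_finset.
have m1 : measurable_fun setT (fun x => `|ratr (qk.1 0 j) - f x 0 j|).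
  by apply: measurableT_comp => //; apply: measurable_funB.
rewrite -[X in measurable X]setTI.
exact: (measurable_fun_ltr m1 (measurable_cst _) measurableT (Y := [set true])).
Qed.

Lemma continuous_borel (f : V -> R) : continuous f -> measurable_fun setT (f : MV -> R).
Proof.
move=> cf; apply: (@measurability _ _ MV R setT f _ (RGenOpens.measurableE R)).
move=> _ [_ [a [b ->]] <-]; rewrite setTI.
apply: sub_sigma_algebra; apply: open_comp => // x _; exact: cf.
Qed.

Lemma measurable_coord j : measurable_fun setT (fun x : MV => (x : V) 0 j).
Proof. by apply: continuous_borel; exact: coord_continuous. Qed.

Lemma measurable_fun_coord d (T : measurableType d) (f : T -> MV) j :
  measurable_fun setT f -> measurable_fun setT (fun x => (f x : V) 0 j).
Proof. by move=> mf; apply: (measurableT_comp (measurable_coord j)). Qed.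

End BorelRow.

Section IteratedIntegral.
Context {R : realType} {n : nat}.
Local Notation V := 'rV[R]_n.
Local Notation MV := (borel R n).
Local Notation leb := (@lebesgue_measure R).
Implicit Types (f g : V -> \bar R) (x : V).

Lemma measurable_setc m : measurable_fun setT (fun z : MV * R => (setc z.1 m z.2 : MV)).
Proof.
apply: (@measurable_fun_row R n _ (MV * R)%type (fun z => setc z.1 m z.2)) => j; rewrite /setc.
under eq_fun do rewrite mxE.
case: (_ == m); first exact: measurable_snd.
by apply: measurable_fun_coord; exact: measurable_fst.
Qed.

Lemma iint_ge0 m f x : (forall y, 0 <= f y)%E -> (0 <= iint m f x)%E.
Proof. by move=> f0; elim: m x => //= m IH x; apply: integral_ge0. Qed.

(** Each level integrates a section of the jointly measurable map (x, t) |->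
    [iint m f (setc x m t)], so the measurability half of Tonelli's theorem applies inductively. *)
Lemma measurable_iint m f : (forall y, 0 <= f y)%E ->
  measurable_fun setT (f : MV -> _) -> measurable_fun setT (iint m f : MV -> _).
Proof.
move=> f0 mf; elim: m => //= m IH.
pose h (z : MV * R) := iint m f (setc z.1 m z.2).
have := @measurable_fun_fubini_tonelli_F _ _ MV _ R leb h; apply => [|z].
  exact: (measurableT_comp IH (measurable_setc m)).
exact: iint_ge0.
Qed.

Lemma measurable_iint_setc m f x : (forall y, 0 <= f y)%E ->
  measurable_fun setT (f : MV -> _) ->
  measurable_fun setT (fun t : R => iint m f (setc x m t)).
Proof.
move=> f0 mf.
have mh := measurableT_comp (measurable_iint m f0 mf) (measurable_setc m).
have := measurableT_comp mh (@pair1_measurable _ _ MV _ x). exact.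
Qed.

Lemma le_iint m f g x : (forall y, 0 <= f y)%E ->
  measurable_fun setT (f : MV -> _) -> measurable_fun setT (g : MV -> _) ->
  (forall y, f y <= g y)%E -> (iint m f x <= iint m g x)%E.
Proof.
move=> f0 mf mg fg; have g0 y : (0 <= g y)%E by exact: le_trans (fg y).
elim: m x => //= m IH x; apply: ge0_le_integral => //=.
- by move=> *; exact: iint_ge0.
- exact: measurable_iint_setc.
- exact: measurable_iint_setc.
Qed.

Lemma iintD m f g x : (forall y, 0 <= f y)%E -> (forall y, 0 <= g y)%E ->
  measurable_fun setT (f : MV -> _) -> measurable_fun setT (g : MV -> _) ->
  (iint m (fun y => f y + g y) x = iint m f x + iint m g x)%E.
Proof.
move=> f0 g0 mf mg; elim: m x => //= m IH x.
under eq_integral do rewrite IH.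
rewrite ge0_integralD//=; try (by move=> *; exact: iint_ge0);
  exact: measurable_iint_setc.
Qed.

Lemma iintZ m f (k : R) x : 0 <= k -> (forall y, 0 <= f y)%E ->
  measurable_fun setT (f : MV -> _) ->
  (iint m (fun y => k%:E * f y) x = k%:E * iint m f x)%E.
Proof.
move=> k0 f0 mf; elim: m x => //= m IH x.
under eq_integral do rewrite IH.
rewrite ge0_integralZl_EFin//=; last exact: measurable_iint_setc.
by move=> *; exact: iint_ge0.
Qed.

Lemma iint0 m x : iint m (fun=> 0%E) x = 0%E.
Proof. by elim: m x => //= m IH x; under eq_integral do rewrite IH; rewrite integral0. Qed.

Lemma iint_sum m (I : Type) (s : seq I) (F : I -> V -> \bar R) x :
  (forall i y, 0 <= F i y)%E ->
  (forall i, measurable_fun setT (F i : MV -> _)) ->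
  (iint m (fun y => \sum_(i <- s) F i y) x = \sum_(i <- s) iint m (F i) x)%E.
Proof.
move=> F0 mF; elim: s => [|i s IH].
  under [X in iint _ X]eq_fun do rewrite big_nil.
  by rewrite big_nil iint0.
under [X in iint _ X]eq_fun do rewrite big_cons.
rewrite big_cons iintD ?IH//.
- by move=> y; exact: sume_ge0.
- exact: emeasurable_sum.
Qed.

(** Monotone convergence, one coordinate at a time: the inner integrals are again nondecreasing in
    the index. *)
Lemma iint_lim m (F : nat -> V -> \bar R) x :
  (forall k y, 0 <= F k y)%E ->
  (forall k, measurable_fun setT (F k : MV -> _)) ->
  (forall y, nondecreasing_seq (F ^~ y)) ->
  iint m (fun y => limn (F ^~ y)) x = limn (fun k => iint m (F k) x).
Proof.
move=> F0 mF ndF; elim: m x => //= m IH x.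
under eq_integral do rewrite IH.
rewrite monotone_convergence//.
- by move=> k; exact: measurable_iint_setc.
- by move=> *; exact: iint_ge0.
- by move=> t _ a b ab; apply: le_iint => // y; exact: ndF.
Qed.

(* Turns [nnintegral] into integration against a measure, see [nnintegralE]. *)
Definition volume (S : set MV) : \bar R := nnintegral (fun y : V => (\1_S y)%:E).

Lemma indic_ge0 (S : set V) y : (0 <= (\1_S y : R)%:E)%E.
Proof. by rewrite lee_fin. Qed.

Let measurable_indicE (S : set MV) : measurable S ->
  measurable_fun setT (fun y : MV => (\1_S y : R)%:E).
Proof. by move=> mS; apply/measurable_EFinP; exact: measurable_indic. Qed.

Let volume0 : volume set0 = 0%E.
Proof.
by rewrite /volume /nnintegral; under [X in iint _ X]eq_fun do rewrite indic0; rewrite iint0.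
Qed.

Let volume_ge0 S : (0 <= volume S)%E.
Proof. by apply: iint_ge0 => y; exact: indic_ge0. Qed.

Let volume_sigma_additive : semi_sigma_additive volume.
Proof.
move=> F mF tF mUF.
have -> : volume (\bigcup_k F k) =
    limn (fun k => \sum_(0 <= i < k) volume (F i))%E.
  rewrite /volume /nnintegral.
  under [X in limn X]eq_fun => k.
    rewrite -iint_sum; [over| |].
      by move=> i y; exact: indic_ge0.
    by move=> i; exact: measurable_indicE.
  rewrite -iint_lim.
  - congr (iint _ _ _); apply/funext => y.
    exact: indic_bigcup.
  - by move=> k y; apply: sume_ge0 => i _; exact: indic_ge0.
  - by move=> k; apply: emeasurable_sum => i; exact: measurable_indicE.
  - by move=> y; apply: ereal_nondecreasing_series => i _ _; exact: indic_ge0.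
apply: is_cvg_ereal_nneg_natsum => i _; exact: volume_ge0.
Qed.

HB.instance Definition _ := isMeasure.Build _ MV R volume
  volume0 volume_ge0 volume_sigma_additive.

(** The first [m] coordinates of the base point are overwritten by [setc]. For [m = n] the base
    point is irrelevant. *)
Lemma iint_eq m f x x' : (forall j : 'I_n, (m <= j)%N -> x 0 j = x' 0 j) ->
  iint m f x = iint m f x'.
Proof.
elim: m x x' => [|m IH] x x' xx'.
  by congr f; apply/rowP => j; exact: xx'.
apply: eq_integral => t _; apply: IH => j mj.
rewrite !mxE; case: eqP => // /eqP jm; apply: xx'.
by rewrite ltn_neqAle eq_sym jm.
Qed.

(** After [m] integrations the indicator constrains only the coordinates still to be integrated;
    each integration removes one constraint and yields one factor [r]. *)
Lemma iint_box m (B : set R) (r : R) x : (m <= n)%N -> measurable B ->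
  leb B = r%:E ->
  iint m (fun y : V => (\1_[set y | forall j, B ((y : V) 0 j)] y)%:E) x =
  (r ^+ m * \1_[set y : V | forall j : 'I_n, (m <= j)%N -> B (y 0 j)] x)%:E.
Proof.
move=> mn mB lB; elim: m mn x => [|m IH] mn x /=.
  by rewrite expr0 mul1r; congr (\1__ _)%:E; apply/seteqP; split => y /= H j //; exact: H.
have r0 : 0 <= r by rewrite -lee_fin -lB.
under eq_integral do rewrite IH 1?ltnW//.
have -> : (fun t : R => (r ^+ m * \1_[set y : V | forall j : 'I_n, (m <= j)%N ->
      B (y 0 j)] (setc x m t))%:E) =
    (fun t : R => ((r ^+ m *
      \1_[set y : V | forall j : 'I_n, (m < j)%N -> B (y 0 j)] x)%:E *
      (\1_B t)%:E)%E).
  apply/funext => t; rewrite -EFinM -mulrA; congr (_ * _)%:E.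
  rewrite /indic -natrM mulnb; congr ((nat_of_bool _)%:R).
  apply/idP/andP; rewrite !inE/=.
    move=> H; split; first move=> j mj.
      have := H j (ltnW mj); rewrite mxE gtn_eqF//.
    by have := H (Ordinal mn) (leqnn _); rewrite mxE eqxx.
  move=> [H Bt] j; rewrite leq_eqVlt mxE => /predU1P[->|mj]; first by rewrite eqxx.
  by rewrite gtn_eqF//; exact: H.
rewrite ge0_integralZl_EFin//.
- by rewrite integral_indic// setIT [X in (_ * X)%E]lB -EFinM exprSr mulrAC.
- by apply/measurable_EFinP; exact: measurable_indic.
- by rewrite mulr_ge0// exprn_ge0.
Qed.

Lemma volume_ball0 (r : R) : 0 < r -> volume (ball (0 : V) r) = ((r *+ 2) ^+ n)%:E.
Proof.
move=> r0; rewrite /volume /nnintegral.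
have -> : ball (0 : V) r = [set y : V | forall j, ball (0 : R) r (y 0 j)].
  by apply/seteqP; split => y /=; rewrite ball_rowP// => H j; have := H j; rewrite mxE.
rewrite (@iint_box _ _ (r *+ 2)) //.
- rewrite indicE mem_set ?mulr1// => j /=.
  by move=> nj; have := ltn_ord j; rewrite ltnNge nj.
- exact: measurable_ball.
- by rewrite lebesgue_measure_ball// ltW.
Qed.

Lemma measurable_open (U : set V) : open U -> measurable (U : set MV).
Proof. by move=> oU; exact: sub_sigma_algebra. Qed.

Lemma measurable_closed (U : set V) : closed U -> measurable (U : set MV).
Proof.
move=> cU; rewrite -[U]setCK; apply: measurableC; apply: measurable_open.
exact: closed_openC.
Qed.

Let volume_sigma_finite : sigma_finite setT volume.
Proof.
exists (fun k => ball (0 : V) k.+1%:R).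
  apply/seteqP; split => // x _ /=; exists (Num.truncn `|x|) => //.
  by rewrite /= -ball_normE/= sub0r normrN truncnS_gt.
move=> k; split; first by apply: measurable_open; exact: ball_open.
by rewrite volume_ball0// ltry.
Qed.

HB.instance Definition _ := @Measure_isSigmaFinite.Build _ MV R volume volume_sigma_finite.

(** The pushforward of Lebesgue measure under a translation has the right value on half-open
    intervals, hence is Lebesgue measure by uniqueness. *)
Lemma integral_shift (g : R -> \bar R) c : (forall t, 0 <= g t)%E ->
  measurable_fun setT g -> (\int[leb]_t g (t + c)%R = \int[leb]_t g t)%E.
Proof.
move=> g0 mg.
pose T := (fun t : R => t + c) : measurableTypeR R -> measurableTypeR R.
have mT : measurable_fun setT T.
  by apply: (@measurable_funD _ _ R setT id (cst c)).
rewrite (_ : (fun t => g (t + c)) = g \o T)// -[X in integral _ X](preimage_setT T).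
rewrite -(@ge0_integral_pushforward _ _ _ _ _ T mT leb setT g)//.
apply: eq_measure_integral => /= S mS _.
apply/esym/lebesgue_measure_unique => //= _ [[a b]] _ <-.
rewrite /pushforward.
have -> : T @^-1` [set` `]a, b]] = `](a - c), (b - c)]%classic.
  by apply/seteqP; split => t /=; rewrite /T !in_itv/= ltrBlDr lerBrDr.
rewrite !lebesgue_measure_itv/= !lte_fin ltrD2r; case: ifP => // _.
by rewrite -!EFinB; congr _%:E; ring.
Qed.

Lemma iint_shift m f x z : (m <= n)%N -> (forall y, 0 <= f y)%E ->
  measurable_fun setT (f : MV -> _) ->
  iint m (fun y => f (y + z)) x = iint m f (x + z).
Proof.
move=> mn f0 mf; elim: m mn x => //= m IH mn x.
under eq_integral do rewrite IH 1?ltnW//.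
rewrite -(@integral_shift (fun t => iint m f (setc (x + z) m t)) (z 0 (Ordinal mn))).
- apply: eq_integral => t _; congr iint; apply/rowP => j.
  rewrite !mxE; case: eqP => // jm; congr (_ + z _ _); exact/val_inj.
- by move=> t; exact: iint_ge0.
- exact: measurable_iint_setc.
Qed.

Lemma nnintegral_shift f z : (forall y, 0 <= f y)%E ->
  measurable_fun setT (f : MV -> _) ->
  nnintegral (fun y => f (y + z)) = nnintegral f.
Proof.
move=> f0 mf; rewrite /nnintegral iint_shift//.
by apply: iint_eq => j nj; have := ltn_ord j; rewrite ltnNge nj.
Qed.

Import HBNNSimple.

(** Both sides agree on indicators by the definition of [volume], then on simple functions by
    linearity, then on monotone limits of these. *)
Lemma nnintegralE f : (forall y, 0 <= f y)%E -> measurable_fun setT (f : MV -> _) ->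
  nnintegral f = (\int[volume]_y f y)%E.
Proof.
move=> f0 mf; pose g := nnsfun_approx measurableT mf.
have fE : f = (fun y => limn (fun k => (g k y)%:E)).
  by apply/funext => y; apply/esym/cvg_lim => //; exact: cvg_nnsfun_approx.
have ndg y : nondecreasing_seq (fun k => (g k y)%:E).
  by move=> a b ab; rewrite lee_fin; exact/lefP/nd_nnsfun_approx.
have mg k : measurable_fun setT (fun y : MV => (g k y)%:E) by exact/measurable_EFinP.
have g0 k y : (0 <= (g k y)%:E)%E by rewrite lee_fin.
rewrite [in LHS]fE [in RHS]fE /nnintegral iint_lim// monotone_convergence//.
congr (limn _); apply/funext => k.
rewrite integralT_nnsfun sintegralE.
under [X in iint _ X]eq_fun => y.
  rewrite fimfunE -fsumEFin// fsbig_finite//=; over.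
rewrite iint_sum.
- rewrite fsbig_finite//=; apply: eq_big_seq => r; rewrite in_fset_set// inE => -[z _ <-].
  under [X in iint _ X]eq_fun do rewrite EFinM.
  rewrite iintZ//; exact: measurable_indicE.
- by move=> i y; rewrite EFinM nnfun_muleindic_ge0.
- by move=> i; apply/measurable_EFinP/measurable_funM.
Qed.

Lemma integral_translation f z : (forall y, 0 <= f y)%E ->
  measurable_fun setT (f : MV -> _) ->
  (\int[volume]_y f (y + z)%R = \int[volume]_y f y)%E.
Proof.
move=> f0 mf; rewrite -!nnintegralE//; first exact: nnintegral_shift.
apply: (measurableT_comp mf); apply: measurable_fun_row => j.
under eq_fun do rewrite mxE.
by apply: measurable_funD => //; exact: measurable_coord.
Qed.

End IteratedIntegral.

(** * Integrals of real-valued functions against a measure *)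

Section RealIntegral.
Context d (T : measurableType d) {R : realType} (mu : {measure set T -> \bar R}).
Implicit Types f g h : T -> R.

Definition real_integrable f := mu.-integrable setT (EFin \o f).
Definition real_integral f := (\int[mu]_x f x)%R.
Local Notation integ := real_integrable.
Local Notation rint := real_integral.

Lemma integ_meas f : integ f -> measurable_fun setT f.
Proof. by move=> /measurable_int/measurable_EFinP. Qed.

Lemma integ_le f g : measurable_fun setT f -> integ g ->
  (forall x, `|f x| <= g x) -> integ f.
Proof.
move=> mf ig fg; apply: (le_integrable _ _ _ ig) => //; first exact/measurable_EFinP.
by move=> x _; rewrite /= lee_fin (le_trans (fg x))// ler_norm.
Qed.

Lemma integ_norm f : integ f -> integ (fun x => `|f x|).
Proof. exact: integrable_norm. Qed.

Lemma integ0 : integ (fun=> 0).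
Proof. exact: integrable0. Qed.

Lemma integD f g : integ f -> integ g -> integ (fun x => f x + g x).
Proof. by move=> fi gi; have := integrableD measurableT fi gi. Qed.

Lemma integZ k f : integ f -> integ (fun x => k * f x).
Proof. by move=> fi; have := integrableZl measurableT k fi. Qed.

Lemma integN f : integ f -> integ (fun x => - f x).
Proof. by move=> fi; have := integrableN fi. Qed.

Lemma integB f g : integ f -> integ g -> integ (fun x => f x - g x).
Proof. by move=> fi gi; apply: integD => //; exact: integN. Qed.

Lemma integ_sum (I : Type) (s : seq I) (F : I -> T -> R) :
  (forall i, integ (F i)) -> integ (fun x => \sum_(i <- s) F i x).
Proof.
move=> Fi; elim: s => [|i s IH].
  by under [X in integ X]eq_fun do rewrite big_nil; exact: integ0.
by under [X in integ X]eq_fun do rewrite big_cons; exact: integD.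
Qed.

Lemma integM_bdd f g (C : R) : integ f -> measurable_fun setT g ->
  (forall x, `|g x| <= C) -> integ (fun x => g x * f x).
Proof.
move=> fi mg gC; apply: (@integ_le _ (fun x => C * `|f x|)).
- by apply: measurable_funM => //; exact: integ_meas.
- exact/integZ/integ_norm.
- by move=> x; rewrite normrM ler_wpM2r.
Qed.

Lemma eq_rint f g : f =1 g -> rint f = rint g.
Proof. by move=> fg; congr rint; exact/funext. Qed.

Lemma rintE f : integ f -> (\int[mu]_x (f x)%:E)%E = (rint f)%:E.
Proof. by move=> fi; rewrite fineK//; exact: integrable_fin_num. Qed.

Lemma rint0 : rint (fun=> 0) = 0.
Proof. by rewrite /rint /Rintegral integral0. Qed.

Lemma rintD f g : integ f -> integ g -> rint (fun x => f x + g x) = rint f + rint g.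
Proof. by move=> fi gi; rewrite /rint RintegralD. Qed.

Lemma rintB f g : integ f -> integ g -> rint (fun x => f x - g x) = rint f - rint g.
Proof. by move=> fi gi; rewrite /rint RintegralB. Qed.

Lemma rintZ k f : integ f -> rint (fun x => k * f x) = k * rint f.
Proof. by move=> fi; rewrite /rint RintegralZl. Qed.

Lemma rintN f : integ f -> rint (fun x => - f x) = - rint f.
Proof.
move=> fi; rewrite -mulN1r -rintZ//; apply: eq_rint => x; by rewrite mulN1r.
Qed.

Lemma rint_sum (I : Type) (s : seq I) (F : I -> T -> R) :
  (forall i, integ (F i)) ->
  rint (fun x => \sum_(i <- s) F i x) = \sum_(i <- s) rint (F i).
Proof.
move=> Fi; elim: s => [|i s IH].
  rewrite big_nil -[RHS]rint0; congr rint; apply/funext => x; exact: big_nil.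
rewrite big_cons -IH -rintD//; last exact: integ_sum.
by congr rint; apply/funext => x; rewrite big_cons.
Qed.

Lemma rint_ge0 f : (forall x, 0 <= f x) -> 0 <= rint f.
Proof. by move=> f0; apply: Rintegral_ge0 => x _. Qed.

Lemma le_rint f g : integ f -> integ g -> (forall x, f x <= g x) -> rint f <= rint g.
Proof. by move=> fi gi fg; apply: le_Rintegral => // x _. Qed.

Lemma le_norm_rint f : integ f -> `|rint f| <= rint (fun x => `|f x|).
Proof. by move=> fi; apply: le_normr_Rintegral. Qed.

Lemma integ_fin f : measurable_fun setT f -> (forall x, 0 <= f x) ->
  (\int[mu]_x (f x)%:E < +oo)%E -> integ f.
Proof.
move=> mf f0 fi; apply/integrableP; split; first exact/measurable_EFinP.
by under eq_integral => x _ do rewrite /= ger0_norm//.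
Qed.

Lemma rint_dct (F : nat -> T -> R) f g :
  (forall k, measurable_fun setT (F k)) -> integ g ->
  (forall x, F k x @[k --> \oo] --> f x) -> (forall k x, `|F k x| <= g x) ->
  rint (F k) @[k --> \oo] --> rint f.
Proof.
move=> mF gi Ff Fg.
have mf : measurable_fun setT f.
  by apply: (measurable_fun_cvg mF) => x _; exact: Ff.
have Ff' x : (F k x)%:E @[k --> \oo] --> (f x)%:E.
  by apply: cvg_EFin; [exact: nearW|exact: Ff].
have [fi _ cv] := @dominated_convergence _ T R mu setT measurableT
  (fun k x => (F k x)%:E) (EFin \o f) (EFin \o g)
  (fun k => iffRL (measurable_EFinP _ _) (mF k)) (iffRL (measurable_EFinP _ _) mf)
  (aeW _ (fun x _ => Ff' x)) gi
  (aeW _ (fun x k _ => Fg k x)).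
apply: fine_cvg; rewrite -/(rint f) -rintE//; exact: cv.
Qed.

End RealIntegral.

(** * Integration on R^n: translations, cubes, positivity *)

Section Volume.
Context {R : realType} {n : nat}.
Local Notation V := 'rV[R]_n.
Local Notation MV := (borel R n).
Local Notation vol := (@volume R n).
Local Notation integ := (real_integrable vol).
Local Notation rint := (real_integral vol).
Implicit Types (f g : V -> R) (x : V).
Local Notation meas f := (measurable_fun setT (f : MV -> R)).

(** Stands in for compact support, with an explicit radius in the sup norm. *)
Definition vanish_off (r : R) f := forall x, r < `|x| -> f x = 0.

Lemma measurable_shift (z : V) : measurable_fun setT (fun x : MV => (x : V) + z : MV).
Proof.
apply: (@measurable_fun_row R n _ MV (fun x => (x : V) + z)) => j.
under eq_fun do rewrite mxE.
by apply: measurable_funD => //; exact: measurable_coord.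
Qed.

Lemma integ_indic (S : set V) : measurable (S : set MV) -> (vol S < +oo)%E ->
  integ (\1_S).
Proof.
move=> mS fS; apply: integ_fin; first exact: measurable_indic.
  by move=> x; rewrite indicE.
by rewrite integral_indic// setIT.
Qed.

Lemma integ_bdd f (C r : R) : meas f -> (forall x, `|f x| <= C) -> vanish_off r f ->
  integ f.
Proof.
(* [r] may be negative, and [f] is only known to vanish strictly beyond it; the ball needs a
   positive radius larger than [r]. *)
move=> mf fC fr; pose r' := `|r| + 1.
have r'0 : 0 < r' by rewrite ltr_wpDl.
have bm : measurable (ball (0 : V) r' : set MV).
  by apply: measurable_open; exact: ball_open.
apply: (@integ_le _ MV R vol f (fun x => C * \1_(ball (0 : V) r') x)) => //.
  by apply/integZ/integ_indic => //; rewrite volume_ball0// ltry.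
move=> x; rewrite indicE.
case: (boolP (x \in _)) => [_|]; first by rewrite mulr1.
rewrite notin_setE -ball_normE /= sub0r normrN => /negP; rewrite -leNgt => xr.
rewrite fr ?normr0 ?mulr0//.
by rewrite (lt_le_trans _ xr)// /r' (le_lt_trans (ler_norm r))// ltrDl.
Qed.

Lemma rint_shift f (z : V) : meas f -> rint (fun x => f (x + z)) = rint f.
Proof.
move=> mf; have mE : measurable_fun setT (EFin \o f : MV -> _) by exact/measurable_EFinP.
have tr (h : V -> \bar R) : (forall y, 0 <= h y)%E -> measurable_fun setT (h : MV -> _) ->
    (\int[vol]_y h (y + z)%R = \int[vol]_y h y)%E by exact: integral_translation.
rewrite /rint /Rintegral integralE [in RHS]integralE; congr (fine (_ - _)%E).
  under [LHS]eq_integral do rewrite funeposE.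
  under [RHS]eq_integral do rewrite funeposE.
  apply: (tr (fun y => maxe (f y)%:E 0%E)).
    by move=> y; rewrite le_max lexx orbT.
  exact: measurable_maxe.
under [LHS]eq_integral do rewrite funenegE.
under [RHS]eq_integral do rewrite funenegE.
apply: (tr (fun y => maxe (- (f y)%:E)%E 0%E)).
  by move=> y; rewrite le_max lexx orbT.
by apply: measurable_maxe => //; apply: measurableT_comp.
Qed.

Lemma integ_shift f (z : V) : integ f -> integ (fun x => f (x + z)).
Proof.
move=> fi; have mf := integ_meas fi; have mfz := measurableT_comp mf (measurable_shift z).
apply/integrableP; split; first exact/measurable_EFinP.
have /integrableP[_] := fi; rewrite -(@integral_translation R n (fun x => `|(f x)%:E|%E) z)//.
by apply: measurableT_comp => //; exact/measurable_EFinP.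
Qed.

Lemma volume_ball (x : V) (r : R) : 0 < r -> vol (ball x r) = ((r *+ 2) ^+ n)%:E.
Proof.
move=> r0; rewrite -volume_ball0//.
have mb y : measurable (ball (y : V) r : set MV).
  by apply: measurable_open; exact: ball_open.
have E y : vol (ball y r) = (\int[vol]_z (\1_(ball y r) z)%:E)%E.
  by rewrite integral_indic// setIT.
rewrite !E -[LHS](@integral_translation R n (fun y => (\1_(ball x r) y)%:E) x)//.
- apply: eq_integral => y _; congr (_ %:E); rewrite !indicE; congr ((nat_of_bool _)%:R).
  by apply/idP/idP; rewrite !inE -!ball_normE/= [y + x]addrC opprD addrA subrr.
- by apply/measurable_EFinP; exact: measurable_indic.
Qed.

Lemma rint_indic (S : set V) : measurable (S : set MV) -> rint (\1_S) = fine (vol S).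
Proof. by move=> mS; rewrite /rint /Rintegral integral_indic// setIT. Qed.

Lemma rint_gt0 f (x : V) : continuous f -> (forall y, 0 <= f y) -> integ f -> 0 < f x ->
  0 < rint f.
Proof.
move=> cf f0 fi fx.
have fx2 : 0 < f x / 2 by rewrite divr_gt0.
have /cvgrPdist_lt/(_ _ fx2)/nbhs_ballP[r /= r0 br] := cf x.
have mb : measurable (ball x r : set MV).
  by apply: measurable_open; exact: ball_open.
have ib : integ (\1_(ball x r)) by apply: integ_indic => //; rewrite volume_ball// ltry.
apply: (@lt_le_trans _ _ (rint (fun y => f x / 2 * \1_(ball x r) y))).
  rewrite rintZ// mulr_gt0// rint_indic// volume_ball//= exprn_gt0//.
  by rewrite pmulrn_lgt0.
apply: le_rint => //; first exact: integZ.
move=> y; rewrite indicE; case: (boolP (y \in _)) => [|_]; last by rewrite mulr0.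
rewrite inE => /br /=; rewrite mulr1 ltr_distl => /andP[_ ?]; lra.
Qed.

(** Bridge from the iterated integrals in the definition of p-harmonicity to integration against
    [volume]. *)
Lemma sintegral_rint f : integ f -> Defs.sintegral f = (rint f)%:E.
Proof.
move=> fi; have mf := integ_meas fi.
rewrite /Defs.sintegral !nnintegralE.
- rewrite -rintE// [RHS]integralE; congr (_ - _)%E; apply: eq_integral => x _.
  + by rewrite funeposE -EFin_max.
  + by rewrite funenegE -EFin_max.
- by move=> y; rewrite lee_fin le_max lexx orbT.
- by apply/measurable_EFinP/measurable_maxr => //; exact: measurableT_comp.
- by move=> y; rewrite lee_fin le_max lexx orbT.
- by apply/measurable_EFinP/measurable_maxr.
Qed.

End Volume.

(** * Convolutions and smooth functions *)

Section DirectionalDerivative.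
Context {R : realType} {V : normedModType R}.
Implicit Types (f : V -> R) (x v : V).

Lemma is_derive1P f x v d :
  is_derive x v f d <-> is_derive (0 : R) (1 : R) (fun h : R => f (h *: v + x)) d.
Proof.
have E : (fun h : R => h^-1 *: ((f \o shift x) (h *: v) - f x)) =
   (fun h : R => h^-1 *: (((fun h : R => f (h *: v + x)) \o shift 0) (h *: 1)
      - f ((0 : R) *: v + x))).
  by apply/funext => h /=; rewrite addr0 scale0r add0r [h *: 1]mulr1.
split=> -[].
  by rewrite /derivable /derive E => ex v0; apply: DeriveDef.
by move=> ex v0; apply: DeriveDef; rewrite /derivable /derive E.
Qed.

Lemma is_derive_chain (F : R -> R) f x v (dF d : R) :
  is_derive x v f d -> is_derive (f x) 1 F dF ->
  is_derive x v (F \o f) (dF * d).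
Proof.
move=> /is_derive1P fd Fd; apply/is_derive1P.
pose r (h : R) := f (h *: v + x).
have r0 : r 0 = f x by rewrite /r scale0r add0r.
have rd : is_derive (0 : R) 1 r d by [].
have Fr : is_derive (r 0) 1 F dF by rewrite r0.
exact: (@is_derive1_comp _ F r 0 dF d Fr rd).
Qed.

Lemma is_derive_at f x v t : derivable f (t *: v + x) v ->
  is_derive t 1 (fun h : R => f (h *: v + x)) ('D_v f (t *: v + x)).
Proof.
move=> df; have := derivableP df => /is_derive1P [].
pose g (h : R) := f (h *: v + (t *: v + x)).
have E : (fun h : R => h^-1 *: ((g \o shift 0) (h *: 1) - g 0)) =
   (fun h : R => h^-1 *: (((fun h : R => f (h *: v + x)) \o shift t) (h *: 1) - f (t *: v + x))).
  by apply/funext => h /=; rewrite /g/= addr0 scale0r add0r scalerDl addrA.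
by rewrite /derivable /derive E => ex v0; apply: DeriveDef.
Qed.

(** Dominated convergence is a statement about sequences; this turns it into continuity of integrals
    with a parameter. *)
Lemma continuous_seqP f x :
  (forall u : nat -> V, u k @[k --> \oo] --> x -> f (u k) @[k --> \oo] --> f x) ->
  {for x, continuous f}.
Proof.
move=> H; apply/cvgrPdist_lt => e e0; apply: contrapT => nH.
have Hk (k : nat) : exists y, `|x - y| < k.+1%:R^-1 /\ e <= `|f x - f y|.
  apply: contrapT => nex; apply: nH; apply/nbhs_ballP; exists k.+1%:R^-1 => /=.
    by rewrite invr_gt0.
  move=> y; rewrite -ball_normE/= => xy; rewrite ltNge; apply/negP => ey.
  by apply: nex; exists y.
have [u uP] := choice Hk.
have /H/cvgrPdist_lt/(_ _ e0)[N _ /(_ N (leqnn _))] : u k @[k --> \oo] --> x.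
  apply/cvgrPdist_lt => e' e'0; near=> k.
  apply: lt_trans (proj1 (uP k)) _.
  near: k; exact: near_infty_natSinv_lt (PosNum e'0).
by rewrite /= ltNge (proj2 (uP N)).
Unshelve. all: end_near. Qed.
End DirectionalDerivative.

Section Convolution.
Context {R : realType} {n : nat}.
Local Notation V := 'rV[R]_n.
Local Notation MV := (borel R n).
Local Notation vol := (@volume R n).
Local Notation integ := (real_integrable vol).
Local Notation rint := (real_integral vol).
Local Notation meas f := (measurable_fun setT (f : MV -> R)).
Local Notation "''e_' j" := (delta_mx 0 j : V) (at level 8, j at level 2, format "''e_' j").

Definition convol (rho g : V -> R) (x : V) := rint (fun z => rho (x - z) * g z).

Lemma meas_comp_sub (rho : V -> R) x : continuous rho -> meas (fun z => rho (x - z)).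
Proof.
move=> cr; apply: continuous_borel => z.
apply: (@continuous_comp _ _ _ (fun z : V => x - z) rho); last exact: cr.
by apply: continuousB => [|y]; [exact: cst_continuous|exact: cvg_id].
Qed.

Lemma integ_convol (rho g : V -> R) (C : R) x : continuous rho -> (forall z, `|rho z| <= C) ->
  integ g -> integ (fun z => rho (x - z) * g z).
Proof. by move=> cr rC gi; apply: (@integM_bdd _ _ _ _ _ _ C) => //; exact: meas_comp_sub. Qed.

Lemma convol_continuous (rho g : V -> R) (C : R) : continuous rho ->
  (forall z, `|rho z| <= C) -> integ g -> continuous (convol rho g).
Proof.
move=> cr rC gi x; apply: continuous_seqP => u ux.
apply: (@rint_dct _ MV R vol (fun k z => rho (u k - z) * g z)
  (fun z => rho (x - z) * g z) (fun z => C * `|g z|)).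
- by move=> k; apply: integ_meas; exact: integ_convol rC gi.
- exact/integZ/integ_norm.
- move=> z; apply: cvgMl.
  apply: (@cvg_comp _ _ _ (fun k => u k - z) rho); last exact: cr.
  by apply: cvgB => //; exact: cvg_cst.
- by move=> k z; rewrite normrM ler_wpM2r.
Qed.

Lemma is_derive_rint (f f' : V -> V -> R) (G : V -> R) (j : 'I_n) (x : V) :
  (forall x, integ (f x)) -> (forall x z, is_derive x 'e_j (f ^~ z) (f' x z)) ->
  integ G -> (forall (t : R) z, -1 < t < 1 -> `|f' (t *: 'e_j + x) z| <= G z) ->
  is_derive x 'e_j (fun x => rint (f x)) (rint (f' x)).
Proof.
move=> fi fd Gi f'G; apply/is_derive1P.
pose h (t : R) (z : MV) := f (t *: 'e_j + x) z.
have hd (t : R) (z : MV) : is_derive t (1 : R) (h ^~ z) (f' (t *: 'e_j + x) z).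
  have [ex <-] := fd (t *: 'e_j + x) z; exact: is_derive_at.
have d1h (t : R) (z : MV) : partial1of2 h t z = f' (t *: 'e_j + x) z.
  by rewrite partial1of2E; case: (hd t z).
have I0 : `]-1, 1[%classic (0 : R) by rewrite /= in_itv/= ltrN10 ltr01.
have hi (t : R) : `]-1, 1[%classic t -> vol.-integrable setT (EFin \o h t).
  by move=> _; exact: fi.
have hder (t : R) (z : MV) : `]-1, 1[%classic t -> [set: MV] z -> derivable (h ^~ z) t 1.
  by move=> _ _; case: (hd t z).
have hub (t : R) (z : MV) : `]-1, 1[%classic t -> [set: MV] z -> `|partial1of2 h t z| <= `|G z|.
  move=> /=; rewrite in_itv/= => t1 _; rewrite d1h (le_trans (f'G _ _ t1))//.
  exact: ler_norm.
have G0 (z : MV) : 0 <= `|G z| by [].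
have Gi' := integ_norm Gi.
apply: DeriveDef.
  exact: (@derivable_under_integral _ _ _ vol h setT measurableT 0 (-1) 1 I0 hi hder _ G0 Gi' hub).
rewrite -derive1E.
rewrite (@differentiation_under_integral _ _ _ vol h setT measurableT 0 (-1) 1 I0 hi hder _ G0 Gi' hub).
by apply: eq_rint => z; rewrite d1h scale0r add0r.
Qed.
End Convolution.

Section DivergenceZero.
Context {R : realType} {n : nat}.
Local Notation V := 'rV[R]_n.
Local Notation MV := (borel R n).
Local Notation vol := (@volume R n).
Local Notation integ := (real_integrable vol).
Local Notation rint := (real_integral vol).
Local Notation "''e_' j" := (delta_mx 0 j : V) (at level 8, j at level 2, format "''e_' j").

Lemma coord_le_norm (x : V) j : `|x 0 j| <= `|x|.
Proof. by rewrite [`|x|]mx_normrE; exact: (le_bigmax _ (fun ij => `|x ij.1 ij.2|) (0, j)). Qed.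

Lemma row_norm_le (x : V) (c : R) : 0 <= c -> (forall j, `|x 0 j| <= c) -> `|x| <= c.
Proof.
move=> c0 H; rewrite [`|x|]mx_normrE; apply/bigmax_leP; split => // -[i j] _ /=.
by rewrite ord1.
Qed.

Lemma norm_e_le (j : 'I_n) : `|'e_j| <= 1.
Proof.
apply: row_norm_le => // k; rewrite mxE eqxx /=.
by case: eqP => _; rewrite ?normr1 ?normr0.
Qed.

Lemma is_derive_mulr (f : V -> R) (x v : V) (d c : R) : is_derive x v f d ->
  is_derive x v (fun x => f x * c) (d * c).
Proof.
move=> fd; have := is_deriveM fd (is_derive_cst c x v).
by rewrite scaler0 add0r [c *: d]mulrC.
Qed.

Lemma is_derive_trans (f : V -> R) (x v z : V) d : is_derive (x + z) v f d ->
  is_derive x v (fun x => f (x + z)) d.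
Proof.
move=> /is_derive1P fd; apply/is_derive1P.
by under eq_fun do rewrite -addrA.
Qed.

Lemma is_derive_convol (rho rho' g : V -> R) (C C' : R) j : continuous rho ->
  (forall z, `|rho z| <= C) -> (forall x, is_derive x 'e_j rho (rho' x)) ->
  (forall z, `|rho' z| <= C') -> integ g ->
  forall x, is_derive x 'e_j (convol rho g) (convol rho' g x).
Proof.
move=> cr rC rd r'C gi x.
apply: (@is_derive_rint _ _ (fun x z => rho (x - z) * g z) (fun x z => rho' (x - z) * g z)
  (fun z => C' * `|g z|)).
- by move=> y; exact: integ_convol rC gi.
- by move=> y z; apply: is_derive_mulr; exact: is_derive_trans.
- exact/integZ/integ_norm.
- by move=> t z _; rewrite normrM ler_wpM2r.
Qed.

Lemma cont_vanish_bdd (f : V -> R) r : continuous f -> vanish_off r f ->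
  exists C : R, 0 <= C /\ forall x, `|f x| <= C.
Proof.
move=> cf fr.
have cK : compact [set x : V | `|x| <= `|r|].
  apply: bounded_closed_compact.
    by exists `|r|; split => // M rM x /= xr; rewrite (le_trans xr)// ltW.
  apply: (@closed_comp _ _ (fun x : V => `|x|) [set y | y <= `|r|]) => [x _|].
    exact: norm_continuous.
  exact: closed_le.
have cnf : continuous (fun x => `|f x|).
  by move=> x; apply: continuous_comp; [exact: cf|exact: norm_continuous].
have K0 : [set x : V | `|x| <= `|r|] !=set0 by exists 0; rewrite /= normr0.
have [c /= _ cmax] := EVT_max_rV K0 cK (continuous_subspaceT cnf).
exists `|f c|; split => // x; have [xr|xr] := leP `|x| `|r|.
  by apply: cmax; rewrite inE.
by rewrite fr ?normr0// (le_lt_trans (ler_norm r)).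
Qed.

Lemma vanish_is_derive (f f' : V -> R) (r : R) (v : V) : vanish_off r f ->
  (forall x, is_derive x v f (f' x)) -> vanish_off r f'.
Proof.
move=> fr fd x rx; have [_ <-] := fd x.
have o : \forall y \near x, f y = cst 0 y.
  have : \forall y \near x, r < `|y|.
    by have /cvgr_gt := @norm_continuous _ V x; exact.
  by apply: filterS => y; exact: fr.
by rewrite (near_eq_derive _ o) derive_cst.
Qed.

(** The integral of z |-> f(z + x) does not depend on x, by translation invariance. Differentiating
    it under the integral sign at x = 0 gives the integral of [f']. All later integrations by parts
    are this lemma applied to a product. *)
Lemma rint_pd0 (f f' : V -> R) (r : R) j : continuous f -> continuous f' ->
  vanish_off r f -> (forall x, is_derive x 'e_j f (f' x)) -> rint f' = 0.
Proof.
move=> cf cf' fr fd.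
have f'r := vanish_is_derive fr fd.
have [C [C0 fC]] := cont_vanish_bdd cf fr.
have [C' [C'0 f'C]] := cont_vanish_bdd cf' f'r.
have mf := continuous_borel cf.
(* The parameter moves along e_j by less than 1, so the supports of all these translates stay inside
   this ball. *)
pose r' := `|r| + 2.
have r'0 : 0 < r' by rewrite ltr_wpDl.
have ball_m : measurable (ball (0 : V) r' : set MV).
  by apply: measurable_open; exact: ball_open.
have : is_derive (0 : V) 'e_j (fun x => rint (fun z => f (z + x))) (rint (fun z => f' (z + 0))).
  apply: (@is_derive_rint _ _ (fun x z => f (z + x)) (fun x z => f' (z + x))
    (fun z => C' * \1_(ball (0 : V) r') z)).
  - by move=> x; apply: integ_shift; exact: integ_bdd fr.
  - move=> x z; have fzd : is_derive (x + z) 'e_j f (f' (z + x)) by rewrite addrC.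
    by under eq_fun do rewrite addrC; exact: is_derive_trans.
  - by apply/integZ/integ_indic => //; rewrite volume_ball0// ltry.
  - move=> t z t1; rewrite indicE addr0.
    case: (boolP (z \in _)) => [_|]; first by rewrite mulr1.
    rewrite notin_setE -ball_normE /= sub0r normrN => /negP; rewrite -leNgt => xr.
    rewrite f'r ?normr0 ?mulr0//.
    have te : `|t *: 'e_j : V| <= 1.
      apply: row_norm_le => // k; rewrite mxE normrM -[leRHS]mulr1 ler_pM//.
        by rewrite ler_norml; move: t1 => /andP[]; lra.
      exact: le_trans (coord_le_norm _ _) (norm_e_le _).
    have := lerB_dist (z : V) (- (t *: 'e_j)); rewrite opprK normrN.
    have := ler_norm r; move: xr te; rewrite /r'; lra.
have -> : (fun x => rint (fun z => f (z + x))) = cst (rint f).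
  by apply/funext => x; exact: rint_shift.
move=> [_]; rewrite derive_cst => /esym.
by under eq_fun do rewrite addr0.
Qed.

End DivergenceZero.

(** * The functions q(1/t) exp(-1/t), extended by zero *)

Section FlatExponential.
Context {R : realType}.
Implicit Types (q : {poly R}) (s t : R).

(* The factor [q] makes the family closed under differentiation. *)
Definition flat q t : R := if 0 < t then q.[t^-1] * expR (- t^-1) else 0.

Lemma pow_expN_bdd k s : 0 < s -> s ^+ k * expR (- s) <= k`!%:R.
Proof.
move=> s0; rewrite expRN ler_pdivrMr ?expR_gt0//.
case: k => [|k]; first by rewrite expr0 mul1r ltW// expR_gt1.
rewrite mulrC -ler_pdivrMr ?ltr0n ?fact_gt0//.
by apply: le_trans (expR_ge1Dxn k (ltW s0)); rewrite lerDr.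
Qed.

Lemma poly_expN_bdd q : exists C : R, forall s, 0 < s -> `|q.[s] * expR (- s)| <= C.
Proof.
exists (\sum_(i < size q) `|q`_i| * i`!%:R) => s s0.
rewrite horner_coef mulr_suml; apply: le_trans (ler_norm_sum _ _ _) _.
apply: ler_sum => i _; rewrite -mulrA normrM ler_wpM2l//.
rewrite ger0_norm ?mulr_ge0 ?exprn_ge0 ?expR_ge0 ?(ltW s0)//.
exact: pow_expN_bdd.
Qed.

(** Boundedness of s^2 q(s) exp(-s) at s = 1/t. A quadratic bound is what differentiability at the
    origin, with derivative 0, requires. *)
Lemma flat_quadratic q : exists C : R, forall t, `|flat q t| <= C * t ^+ 2.
Proof.
have [C HC] := poly_expN_bdd (q * 'X^2).
exists C => t; rewrite /flat; case: ifPn => t0.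
  have := HC t^-1; rewrite invr_gt0 => /(_ t0).
  rewrite hornerM hornerXn mulrAC normrM (@ger0_norm _ (t^-1 ^+ 2)) ?exprn_ge0 ?invr_ge0 ?(ltW t0)//.
  by rewrite exprVn -ler_pdivlMr ?invr_gt0 ?exprn_gt0// invrK.
rewrite normr0 mulr_ge0 ?sqr_ge0//.
by have := HC 1 ltr01; apply: le_trans.
Qed.

(** For t > 0 the derivative of q(1/t) exp(-1/t) is t^(-2) (q - q')(1/t) exp(-1/t), which is again
    of the form [flat]; at 0 the difference quotient is at most C|t|. *)
Lemma is_derive_flat q t : is_derive t (1 : R) (flat q) (flat ('X^2 * (q - q^`())) t).
Proof.
have [t0|t0|<-] := ltgtP 0 t.
- have N : \forall y \near t, q.[y^-1] * expR (- y^-1) = flat q y.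
    have : \forall y \near t, 0 < y by apply: lt_nbhsr.
    by apply: filterS => y y0; rewrite /flat y0.
  apply: (@near_eq_is_derive R R R _ (flat q) t 1 _ N).
  rewrite /flat t0.
  have dV : is_derive t (1 : R) (fun y : R => y^-1) (- (t^-1 ^+ 2)).
    apply: is_derive_eq; first exact: (is_deriveV (lt0r_neq0 t0)).
    by rewrite /= scaler1 exprVn.
  have d1 : is_derive t (1 : R) (fun y => q.[y^-1]) (q^`().[t^-1] * - (t^-1 ^+ 2)).
    exact: (@is_derive1_comp _ (horner q) (fun y => y^-1)).
  have d2 : is_derive t (1 : R) (fun y : R => expR (- y^-1)) (expR (- t^-1) * (t^-1 ^+ 2)).
    apply: (@is_derive1_comp _ expR (fun y : R => - y^-1)).
    by rewrite -[X in is_derive _ _ _ X]opprK; exact: is_deriveN.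
  have d3 := is_deriveM d1 d2; apply: (is_derive_eq d3).
  rewrite /GRing.scale/= hornerM hornerXn hornerD hornerN; ring.
- have N : \forall y \near t, cst 0 y = flat q y.
    have : \forall y \near t, y < 0 by apply: lt_nbhsl.
    by apply: filterS => y y0; rewrite /flat ltNge (ltW y0).
  apply: (@near_eq_is_derive R R R _ (flat q) t 1 _ N).
  by rewrite /flat ltNge (ltW t0) /=; exact: is_derive_cst.
have f0 q' : flat q' 0 = 0 by rewrite /flat ltxx.
rewrite f0.
have [C HC] := flat_quadratic q.
have C0 : 0 <= C by have := HC 1; rewrite expr1n mulr1; apply: le_trans.
have C1 : 0 < C + 1 by rewrite ltr_wpDl.
have L : (fun h : R => h^-1 *: ((flat q \o shift 0) (h *: 1) - flat q 0)) @ 0^' --> (0 : R).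
  apply/cvgr0Pnorm_le => e e0; near=> h.
  rewrite /= f0 subr0 addr0 [h *: 1]mulr1 normrM normfV.
  have h0 : h != 0 by near: h; exact: nbhs_dnbhs_neq.
  rewrite mulrC ler_pdivrMr ?normr_gt0// (le_trans (HC h))//.
  rewrite -real_normK ?num_real// expr2 mulrA ler_wpM2r//.
  rewrite (@le_trans _ _ ((C + 1) * `|h|)) ?ler_wpM2r ?lerDl//.
  rewrite mulrC -ler_pdivlMr//.
  by near: h; apply: dnbhs0_le; rewrite divr_gt0.
have ex : derivable (flat q) (0 : R) (1 : R) by exact: (cvgP _ L).
by apply: (DeriveDef ex); exact/cvg_lim.
Unshelve. all: end_near. Qed.

Lemma continuous_flat q : continuous (flat q).
Proof.
move=> t; apply: differentiable_continuous; apply/derivable1_diffP.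
by case: (is_derive_flat q t).
Qed.

Lemma flat1_gt0 t : 0 < t -> 0 < flat 1 t.
Proof. by move=> t0; rewrite /flat t0 hornerC mul1r expR_gt0. Qed.

Lemma flatX2_gt0 t : 0 < t -> 0 < flat 'X^2 t.
Proof.
by move=> t0; rewrite /flat t0 hornerXn mulr_gt0 ?expR_gt0// exprn_gt0// invr_gt0.
Qed.

Lemma flat_le0 q t : t <= 0 -> flat q t = 0.
Proof. by move=> t0; rewrite /flat ltNge t0. Qed.

Lemma is_derive_flat1 t : is_derive t (1 : R) (flat 1) (flat 'X^2 t).
Proof. by have := is_derive_flat 1 t; rewrite derivC subr0 mulr1. Qed.

End FlatExponential.

(** * A class of smooth functions, and mollifiers in it *)

Section SmoothClass.
Context {R : realType} {n : nat}.
Local Notation V := 'rV[R]_n.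
Local Notation vol := (@volume R n).
Local Notation integ := (real_integrable vol).
Local Notation rint := (real_integral vol).
Local Notation "''e_' j" := (delta_mx 0 j : V) (at level 8, j at level 2, format "''e_' j").

(* Visibly closed under partial derivatives, hence made of smooth functions. *)
Inductive nice : (V -> R) -> Prop :=
| nice_cst (c : R) : nice (fun=> c)
| nice_coord j : nice (fun x => x 0 j)
| nice_flat q f : nice f -> nice (fun x => flat q (f x))
| nice_add f g : nice f -> nice g -> nice (fun x => f x + g x)
| nice_mul f g : nice f -> nice g -> nice (fun x => f x * g x)
| nice_convol f r g : nice f -> vanish_off r f -> integ g -> nice (convol f g).

Lemma is_derive_add (f g : V -> R) (x v : V) (a b : R) : is_derive x v f a ->
  is_derive x v g b -> is_derive x v (fun x => f x + g x) (a + b).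
Proof. by move=> fa gb; exact: is_deriveD. Qed.

Lemma is_derive_mul (f g : V -> R) (x v : V) (a b : R) : is_derive x v f a ->
  is_derive x v g b -> is_derive x v (fun x => f x * g x) (a * g x + f x * b).
Proof.
move=> fa gb; have d := is_deriveM fa gb; apply: (is_derive_eq d).
by rewrite /GRing.scale /= addrC [g x * a]mulrC.
Qed.

Lemma is_derive_coord (x : V) i j : is_derive x 'e_j (fun x : V => x 0 i) ((i == j)%:R).
Proof.
apply/is_derive1P.
have -> : (fun h : R => (h *: 'e_j + x) 0 i) = (fun h : R => h * (i == j)%:R + x 0 i).
  by apply/funext => h; rewrite !mxE eqxx.
have d1 : is_derive (0 : R) (1 : R) (fun h : R => h * (i == j)%:R) ((i == j)%:R).
  have := is_deriveM (is_derive_id (0 : R) (1 : R)) (is_derive_cst ((i == j)%:R : R) (0 : R) (1 : R)).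
  by move=> d; apply: (is_derive_eq d); rewrite /GRing.scale /= mulr0 add0r mulr1.
have d2 := is_deriveD d1 (is_derive_cst (x 0 i) (0 : R) (1 : R)).
by apply: (is_derive_eq d2); rewrite addr0.
Qed.

(** Continuity has to be part of the induction: in the convolution case the bounds on [f] and [f']
    needed to differentiate under the integral come from continuity and compact support. *)
Lemma nice_step (f : V -> R) : nice f -> continuous f /\
  forall j, exists f', [/\ nice f', continuous f' & forall x, is_derive x 'e_j f (f' x)].
Proof.
have cD (u w : V -> R) : continuous u -> continuous w -> continuous (fun x => u x + w x).
  by move=> cu cw x; exact: (continuousD (cu x) (cw x)).
have cM (u w : V -> R) : continuous u -> continuous w -> continuous (fun x => u x * w x).
  by move=> cu cw x; exact: (continuousM (cu x) (cw x)).
elim=> {f}.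
- move=> c; split; first exact: cst_continuous.
  move=> j; exists (fun=> 0); split; [exact: nice_cst|exact: cst_continuous|].
  by move=> x; exact: is_derive_cst.
- move=> i; split; first exact: coord_continuous.
  move=> j; exists (fun=> (i == j)%:R); split; [exact: nice_cst|exact: cst_continuous|].
  by move=> x; exact: is_derive_coord.
- move=> q f nf [cf df].
  have cq q' : continuous (fun x => flat q' (f x)).
    by move=> x; apply: continuous_comp; [exact: cf|exact: continuous_flat].
  split=> // j; have [f' [nf' cf' fd]] := df j.
  exists (fun x => flat ('X^2 * (q - q^`())) (f x) * f' x); split.
  + by apply: nice_mul => //; exact: nice_flat.
  + exact: cM.
  + by move=> x; apply: is_derive_chain => //; exact: is_derive_flat.
- move=> f g nf [cf df] ng [cg dg]; split; first exact: cD.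
  move=> j; have [f' [nf' cf' fd]] := df j; have [g' [ng' cg' gd]] := dg j.
  exists (fun x => f' x + g' x); split; [exact: nice_add|exact: cD|].
  by move=> x; exact: is_derive_add.
- move=> f g nf [cf df] ng [cg dg]; split; first exact: cM.
  move=> j; have [f' [nf' cf' fd]] := df j; have [g' [ng' cg' gd]] := dg j.
  exists (fun x => f' x * g x + f x * g' x); split.
  + by apply: nice_add; exact: nice_mul.
  + by apply: cD; exact: cM.
  + by move=> x; exact: is_derive_mul.
- move=> f r g nf [cf df] fr gi.
  have [C [_ fC]] := cont_vanish_bdd cf fr.
  split; first exact: convol_continuous fC gi.
  move=> j; have [f' [nf' cf' fd]] := df j.
  have f'r := vanish_is_derive fr fd.
  have [C' [_ f'C]] := cont_vanish_bdd cf' f'r.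
  exists (convol f' g); split; first exact: nice_convol f'r gi.
    exact: convol_continuous f'C gi.
  exact: is_derive_convol fC fd f'C gi.
Qed.

Lemma nice_smooth (f : V -> R) : nice f -> Defs.smooth f.
Proof.
move=> nf js.
have {nf} nf : nice (iter_pd js f).
  elim: js => //= j js /nice_step [_ /(_ j)[f' [nf' _ fd]]].
  have -> // : pd j (iter_pd js f) = f'.
  by apply/funext => x; rewrite /pd; case: (fd x).
have [cf df] := nice_step nf; split => // j x.
by have [f' [_ _ /(_ x)[]]] := df j.
Qed.

(** The Euclidean square keeps the argument of [flat] polynomial, hence the bump [nice]; the
    Euclidean ball of radius [d] lies in the sup-norm ball of the same radius. *)
Definition bump (d : R) (z : V) : R := flat 1 (d ^+ 2 - \sum_(j < n) z 0 j ^+ 2).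

Definition mollifier (d : R) (z : V) : R := (rint (bump d))^-1 * bump d z.

Lemma nice_sum (I : Type) (s : seq I) (F : I -> V -> R) : (forall i, nice (F i)) ->
  nice (fun x => \sum_(i <- s) F i x).
Proof.
move=> nF; elim: s => [|i s IH].
  by under eq_fun do rewrite big_nil; exact: nice_cst.
by under eq_fun do rewrite big_cons; exact: nice_add.
Qed.

Lemma nice_bump d : nice (bump d).
Proof.
apply: nice_flat; apply: nice_add; first exact: nice_cst.
have -> : (fun x : V => - (\sum_(j < n) x 0 j ^+ 2)) =
    (fun x : V => -1 * (\sum_(j < n) x 0 j * x 0 j)).
  by apply/funext => x; rewrite mulN1r.
apply: nice_mul; first exact: nice_cst.
by apply: nice_sum => j; apply: nice_mul; exact: nice_coord.
Qed.

Lemma bump_ge0 d z : 0 <= bump d z.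
Proof.
rewrite /bump; have [t0|t0] := leP (d ^+ 2 - \sum_(j < n) z 0 j ^+ 2) 0.
  by rewrite flat_le0.
by rewrite ltW// flat1_gt0.
Qed.

Lemma bump_vanish d : 0 < d -> vanish_off d (bump d).
Proof.
move=> d0 z dz; rewrite /bump flat_le0// subr_le0.
have [j dj] : exists j, d < `|z 0 j|.
  apply: contrapT => H; move: dz; rewrite ltNge row_norm_le// ?ltW// => j.
  by rewrite leNgt; apply/negP => jd; apply: H; exists j.
rewrite (bigD1 j)//= -[z 0 j ^+ 2]real_normK ?num_real//.
apply: ler_wpDr; first by apply: sumr_ge0 => i _; exact: sqr_ge0.
by apply: lerXn2r; rewrite ?nnegrE ?normr_ge0 ?(ltW d0) ?(ltW dj).
Qed.

Lemma bump_even d z : bump d (- z) = bump d z.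
Proof. by rewrite /bump; under eq_bigr do rewrite mxE sqrrN. Qed.

Lemma integ_bump d : 0 < d -> integ (bump d).
Proof.
move=> d0; have [cb _] := nice_step (nice_bump d).
have [C [_ bC]] := cont_vanish_bdd cb (bump_vanish d0).
by apply: (integ_bdd _ bC (bump_vanish d0)); exact: continuous_borel.
Qed.

Lemma rint_bump_gt0 d : 0 < d -> 0 < rint (bump d).
Proof.
move=> d0; have [cb _] := nice_step (nice_bump d).
apply: (@rint_gt0 _ _ _ 0) => //; first exact: bump_ge0.
  exact: integ_bump.
rewrite /bump flat1_gt0//; under eq_bigr do rewrite mxE expr0n.
by rewrite big1// subr0 exprn_gt0.
Qed.

Lemma nice_mollifier d : nice (mollifier d).
Proof. by apply: nice_mul; [exact: nice_cst|exact: nice_bump]. Qed.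

Lemma mollifier_continuous d : continuous (mollifier d).
Proof. by have [] := nice_step (nice_mollifier d). Qed.

Lemma mollifier_ge0 d z : 0 < d -> 0 <= mollifier d z.
Proof. by move=> d0; rewrite mulr_ge0 ?bump_ge0// invr_ge0 ltW ?rint_bump_gt0. Qed.

Lemma mollifier_vanish d : 0 < d -> vanish_off d (mollifier d).
Proof. by move=> d0 z dz; rewrite /mollifier bump_vanish// mulr0. Qed.

Lemma mollifierC d x z : mollifier d (x - z) = mollifier d (z - x).
Proof. by rewrite /mollifier -bump_even opprB. Qed.

Lemma integ_mollifier d x : 0 < d -> integ (fun z => mollifier d (z - x)).
Proof. by move=> d0; apply: integ_shift; apply: integZ; exact: integ_bump. Qed.

Lemma rint_mollifier d x : 0 < d -> rint (fun z => mollifier d (z - x)) = 1.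
Proof.
move=> d0; rewrite (@rint_shift _ _ (mollifier d) (- x)); last first.
  by apply: continuous_borel; exact: mollifier_continuous.
by rewrite /mollifier rintZ ?mulVf ?gt_eqF ?rint_bump_gt0//; exact: integ_bump.
Qed.
End SmoothClass.

(** * Mollification of integrable functions *)

Section Small.
Context {R : realType}.
(** Convergence to zero of nonnegative extended reals; the double integrals below are not known to
    be finite beforehand. *)
Definition small (u : nat -> \bar R) :=
  forall e : R, 0 < e -> \forall k \near \oo, (u k <= e%:E)%E.

Lemma small_le (u v : nat -> \bar R) : (forall k, u k <= v k)%E -> small v -> small u.
Proof. by move=> uv sv e /sv; apply: filterS => k; apply: le_trans. Qed.

Lemma small_add (u v : nat -> \bar R) : small u -> small v -> small (fun k => u k + v k)%E.
Proof.
move=> su sv e e0; have e2 : 0 < e / 2 by rewrite divr_gt0.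
near=> k; rewrite (splitr e) EFinD; apply: leeD.
  by near: k; exact: su.
by near: k; exact: sv.
Unshelve. all: end_near. Qed.

Lemma small_scale (c : R) (u : nat -> \bar R) : (forall k, 0 <= u k)%E ->
  0 <= c -> small u -> small (fun k => c%:E * u k)%E.
Proof.
move=> u0 c0 su e e0.
have ec : 0 < e / (c + 1) by rewrite divr_gt0// ltr_wpDl.
near=> k; apply: (@le_trans _ _ (c%:E * (e / (c + 1))%:E)%E).
  by rewrite lee_pmul//; near: k; exact: su.
rewrite -EFinM lee_fin mulrA ler_pdivrMr ?ltr_wpDl// mulrC ler_wpM2l ?ltW// ltrDl//.
Unshelve. all: end_near. Qed.

Lemma small_cvg (u : nat -> R) : u k @[k --> \oo] --> 0 -> small (fun k => (u k)%:E).
Proof.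
move=> /cvgr0Pnorm_le u0 e e0; near=> k.
by rewrite lee_fin (le_trans (ler_norm _))//; near: k; exact: u0.
Unshelve. all: end_near. Qed.

Lemma small_approx (u : nat -> \bar R) : (forall e : R, 0 < e -> exists v,
  small v /\ forall k, (u k <= v k + e%:E)%E) -> small u.
Proof.
move=> H e e0; have e2 : 0 < e / 2 by rewrite divr_gt0.
have [v [sv uv]] := H _ e2; near=> k; apply: le_trans (uv k) _.
by rewrite [in leRHS](splitr e) EFinD leeD2r//; near: k; exact: sv.
Unshelve. all: end_near. Qed.
End Small.

Section Mollification.
Context {R : realType} {n : nat}.
Local Notation V := 'rV[R]_n.
Local Notation MV := (borel R n).
Local Notation vol := (@volume R n).
Local Notation integ := (real_integrable vol).
Local Notation meas f := (measurable_fun setT (f : MV -> R)).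
Local Notation meas2 f := (measurable_fun setT (f : MV * MV -> R)).

(** Integrates [w] over pairs at distance at most [d]. The kernel has mass 1 in either variable, so
    a [w] depending on one variable only has its plain integral as value ([molint_fst],
    [molint_snd]). *)
Definition molint (d : R) (w : MV * MV -> R) : \bar R :=
  (\int[vol]_x \int[vol]_z (mollifier d ((x : V) - z) * w (x, z))%:E)%E.

Lemma measurable_mollifier2 d : meas2 (fun p => mollifier d ((p.1 : V) - p.2)).
Proof.
have mm : meas (mollifier d) by apply: continuous_borel; exact: mollifier_continuous.
apply: (measurableT_comp mm).
apply: (@measurable_fun_row R n _ (MV * MV)%type (fun p => (p.1 : V) - p.2)) => j.
under eq_fun do rewrite !mxE.
apply: measurable_funB; apply: measurable_fun_coord.
  exact: measurable_fst.
exact: measurable_snd.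
Qed.

Section FixedRadius.
Variable d : R.
Hypothesis d0 : 0 < d.

Let mK (w : MV * MV -> R) : meas2 w ->
  measurable_fun setT (fun p : MV * MV => (mollifier d ((p.1 : V) - p.2) * w p)%:E).
Proof.
move=> mw; apply/measurable_EFinP/measurable_funM => //.
exact: measurable_mollifier2.
Qed.

Let K0 (w : MV * MV -> R) : (forall p, 0 <= w p) ->
  (forall p : MV * MV, 0 <= (mollifier d ((p.1 : V) - p.2) * w p)%:E)%E.
Proof. by move=> w0 p; rewrite lee_fin mulr_ge0// mollifier_ge0. Qed.

Let inner (w : MV * MV -> R) (x : MV) : \bar R :=
  (\int[vol]_z (mollifier d ((x : V) - z) * w (x, z))%:E)%E.

Let minner (w : MV * MV -> R) : meas2 w -> (forall p, 0 <= w p) ->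
  measurable_fun setT (inner w).
Proof.
move=> mw w0.
have := @measurable_fun_fubini_tonelli_F _ _ MV MV R vol
  (fun p => (mollifier d ((p.1 : V) - p.2) * w p)%:E) (mK mw) (K0 w0).
exact.
Qed.

Let mKx (w : MV * MV -> R) (x : MV) : meas2 w ->
  measurable_fun setT (fun z : MV => (mollifier d ((x : V) - z) * w (x, z))%:E).
Proof. by move=> mw; exact: (measurableT_comp (mK mw) (@pair1_measurable _ _ MV _ x)). Qed.

Let inner_ge0 (w : MV * MV -> R) x : (forall p, 0 <= w p) -> (0 <= inner w x)%E.
Proof. by move=> w0; apply: integral_ge0 => z _; exact: (K0 w0 (x, z)). Qed.

Lemma molint_ge0 (w : MV * MV -> R) : (forall p, 0 <= w p) -> (0 <= molint d w)%E.
Proof. by move=> w0; apply: integral_ge0 => x _; exact: inner_ge0. Qed.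

Lemma le_molint (w w' : MV * MV -> R) : meas2 w -> meas2 w' -> (forall p, 0 <= w p) ->
  (forall p, w p <= w' p) -> (molint d w <= molint d w')%E.
Proof.
move=> mw mw' w0 ww'; have w'0 p : 0 <= w' p by exact: le_trans (ww' p).
apply: ge0_le_integral => //.
- by move=> x _; exact: inner_ge0.
- exact: (minner mw w0).
- exact: (minner mw' w'0).
move=> x _; apply: ge0_le_integral => //.
- by move=> z _; exact: (K0 w0 (x, z)).
- exact: mKx.
- exact: mKx.
- by move=> z _; rewrite lee_fin ler_wpM2l// mollifier_ge0.
Qed.

Lemma molintD (w w' : MV * MV -> R) : meas2 w -> meas2 w' -> (forall p, 0 <= w p) ->
  (forall p, 0 <= w' p) ->
  molint d (fun p => w p + w' p) = (molint d w + molint d w')%E.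
Proof.
move=> mw mw' w0 w'0; rewrite /molint -ge0_integralD//.
- apply: eq_integral => x _; rewrite -ge0_integralD//.
  + by apply: eq_integral => z _; rewrite mulrDr EFinD.
  + by move=> z _; exact: (K0 w0 (x, z)).
  + exact: mKx.
  + by move=> z _; exact: (K0 w'0 (x, z)).
  + exact: mKx.
- by move=> x _; exact: inner_ge0.
- exact: (minner mw w0).
- by move=> x _; exact: inner_ge0.
- exact: (minner mw' w'0).
Qed.

Lemma molintZ (c : R) (w : MV * MV -> R) : 0 <= c -> meas2 w -> (forall p, 0 <= w p) ->
  molint d (fun p => c * w p) = (c%:E * molint d w)%E.
Proof.
move=> c0 mw w0; rewrite /molint -ge0_integralZl_EFin//.
- apply: eq_integral => x _; rewrite -ge0_integralZl_EFin//.
  + by apply: eq_integral => z _; rewrite mulrCA EFinM.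
  + by move=> z _; exact: (K0 w0 (x, z)).
  + exact: mKx.
- by move=> x _; exact: inner_ge0.
- exact: (minner mw w0).
Qed.

Lemma molint_fst (u : V -> R) : meas u -> (forall x, 0 <= u x) ->
  molint d (fun p => u p.1) = (\int[vol]_x (u x)%:E)%E.
Proof.
move=> mu u0; apply: eq_integral => x _ /=.
have im : integ (fun z => mollifier d (x - z)).
  by under [X in real_integrable _ X]eq_fun do rewrite mollifierC; exact: integ_mollifier.
transitivity (\int[vol]_z (u x * mollifier d (x - z))%:E)%E.
  by apply: eq_integral => z _; rewrite mulrC.
rewrite rintE; last exact: integZ.
rewrite rintZ//; congr (_%:E).
rewrite -[RHS]mulr1; congr (_ * _); rewrite -(rint_mollifier x d0).
by apply: eq_rint => z; rewrite mollifierC.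
Qed.

(** Tonelli together with the evenness of the mollifier. *)
Lemma molint_swap (w : MV * MV -> R) : meas2 w -> (forall p, 0 <= w p) ->
  molint d (fun p => w (p.2, p.1)) = molint d w.
Proof.
move=> mw w0.
have := @fubini_tonelli _ _ MV MV R vol vol
  (fun p => (mollifier d ((p.1 : V) - p.2) * w p)%:E) (mK mw) (K0 w0).
rewrite /= -/(molint d w) => ->.
apply: eq_integral => x _; apply: eq_integral => z _ /=.
by rewrite mollifierC.
Qed.

Lemma molint_snd (u : V -> R) : meas u -> (forall x, 0 <= u x) ->
  molint d (fun p => u p.2) = (\int[vol]_x (u x)%:E)%E.
Proof.
move=> mu u0; rewrite -(molint_fst mu u0); apply: (@molint_swap (fun p => u p.1)) => //.
by apply: (measurableT_comp mu); exact: measurable_fst.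
Qed.

End FixedRadius.

End Mollification.

Section MollifyL1.
Context {R : realType} {n : nat}.
Local Notation V := 'rV[R]_n.
Local Notation MV := (borel R n).
Local Notation vol := (@volume R n).
Local Notation integ := (real_integrable vol).
Local Notation rint := (real_integral vol).
Local Notation meas f := (measurable_fun setT (f : MV -> R)).
Local Notation meas2 f := (measurable_fun setT (f : MV * MV -> R)).

Lemma eq_ele (x y : \bar R) : x = y -> (x <= y)%E. Proof. by move=> ->. Qed.

Definition radk (k : nat) : R := k.+1%:R^-1.

Lemma radk_gt0 k : 0 < radk k. Proof. by rewrite invr_gt0. Qed.

Lemma radk_lt (e : R) : 0 < e -> \forall k \near \oo, radk k < e.
Proof. by move=> e0; exact: (near_infty_natSinv_lt (PosNum e0)). Qed.

Definition diff2 (g : V -> R) : MV * MV -> R := fun p => `|g p.2 - g p.1|.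

(** Slightly stronger than L^1 convergence of the mollified functions, whose L^1 error is at most
    this double integral. The absolute value stays inside, so the property can later be weighted. *)
Definition mollifies (g : V -> R) := small (fun k => molint (radk k) (diff2 g)).

Lemma meas_fst (g : V -> R) : meas g -> meas2 (fun p => g p.1).
Proof. by move=> mg; apply: (measurableT_comp mg); exact: measurable_fst. Qed.

Lemma meas_snd (g : V -> R) : meas g -> meas2 (fun p => g p.2).
Proof. by move=> mg; apply: (measurableT_comp mg); exact: measurable_snd. Qed.

Lemma meas_diff2 g : meas g -> meas2 (diff2 g).
Proof.
move=> mg; apply: measurableT_comp => //.
by apply: measurable_funB; [exact: meas_snd|exact: meas_fst].
Qed.

(** With u = |g - h|, the difference |g(z) - g(x)| exceeds |h(z) - h(x)| by at most u(x) + u(z), and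
    each of these two terms contributes the integral of u. *)
Lemma mollifies_approx (g : V -> R) : integ g ->
  (forall e : R, 0 < e -> exists h, [/\ integ h, mollifies h &
     rint (fun x => `|g x - h x|) <= e]) -> mollifies g.
Proof.
move=> gi H; apply: small_approx => e e0.
have e2 : 0 < e / 2 by rewrite divr_gt0.
have [h [hi sh ghe]] := H _ e2; exists (fun k => molint (radk k) (diff2 h)).
split=> // k; have d0 := radk_gt0 k.
have [mg mh] := (integ_meas gi, integ_meas hi).
pose u x := `|g x - h x|.
have ui : integ u by apply: integ_norm; exact: integB.
have mu := integ_meas ui.
have u0 x : 0 <= u x by exact: normr_ge0.
have m1 := meas_fst mu; have m2 := meas_snd mu; have mdh := meas_diff2 mh.
apply: (@le_trans _ _ (molint (radk k) (fun p => diff2 h p + (u p.1 + u p.2)))).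
  apply: le_molint => //.
  - exact: meas_diff2.
  - by apply: measurable_funD => //; exact: measurable_funD.
  - by move=> p; exact: normr_ge0.
  - move=> [x z]; rewrite /diff2 /u /=.
    have -> : g z - g x = (h z - h x) + (- (g x - h x) + (g z - h z)) by ring.
    apply: le_trans (ler_normD _ _) _; rewrite lerD2l.
    by apply: le_trans (ler_normD _ _) _; rewrite normrN.
have mu12 : meas2 (fun p => u p.1 + u p.2) by exact: measurable_funD.
rewrite (molintD d0 mdh mu12 (fun p => normr_ge0 _) (fun p => addr_ge0 (u0 _) (u0 _))).
rewrite (molintD d0 m1 m2 (fun p => u0 _) (fun p => u0 _)).
rewrite (molint_fst d0)// (molint_snd d0)// leeD2l// rintE// -EFinD lee_fin.
by rewrite (splitr e) lerD.
Qed.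

Lemma mollifies_lin (c : R) (g h : V -> R) : integ g -> integ h -> mollifies g ->
  mollifies h -> mollifies (fun x => g x + c * h x).
Proof.
move=> /integ_meas mg /integ_meas mh sg sh.
have [mdg mdh] := (meas_diff2 mg, meas_diff2 mh).
have d0 := radk_gt0.
apply: (@small_le _ _ (fun k => molint (radk k) (diff2 g) +
    `|c|%:E * molint (radk k) (diff2 h))%E) => [k|].
  have mch : meas2 (fun p => `|c| * diff2 h p) by exact: measurable_funM.
  have h0 p : 0 <= diff2 h p by exact: normr_ge0.
  have ch0 p : 0 <= `|c| * diff2 h p by exact: mulr_ge0.
  have g0 p : 0 <= diff2 g p by exact: normr_ge0.
  rewrite -(molintZ (d0 k) (normr_ge0 c) mdh h0).
  apply: le_trans _ (eq_ele (molintD (d0 k) mdg mch g0 ch0)).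
  apply: le_molint => //.
  + by apply: meas_diff2; apply: measurable_funD => //; exact: measurable_funM.
  + exact: measurable_funD.
  + by move=> p; exact: normr_ge0.
  + move=> [x z]; rewrite /diff2 /= -normrM mulrBr.
    have -> : g z + c * h z - (g x + c * h x) = (g z - g x) + (c * h z - c * h x) by ring.
    exact: ler_normD.
apply: (small_add sg); apply: (small_scale _ (normr_ge0 c) sh) => k.
exact: (molint_ge0 (d0 k) (fun p => normr_ge0 _)).
Qed.

(** |1_O(z) - 1_O(x)| is w(x, z) + w(z, x) with [w] charging the pairs that leave O. For fixed x in
    O the mass leaving O is zero once the radius is smaller than a ball around x inside O, and it
    never exceeds 1_O(x); dominated convergence concludes. *)
Lemma mollifies_open (O : set V) : open O -> (vol O < +oo)%E -> mollifies (\1_O).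
Proof.
move=> oO fO; have mO := measurable_open oO.
have iO : integ (\1_O) by exact: integ_indic.
pose w (p : MV * MV) : R := \1_O p.1 * \1_(~` O) p.2.
have mw : meas2 w.
  apply: measurable_funM; first by apply: meas_fst; exact: measurable_indic.
  by apply: meas_snd; apply: measurable_indic; exact: measurableC.
have w0 p : 0 <= w p by rewrite /w !indicE mulr_ge0.
have wle1 p : w p <= 1.
  by rewrite /w !indicE -natrM mulnb lern1 leq_b1.
have d0 := radk_gt0.
pose I k (x : MV) := (\int[vol]_z (mollifier (radk k) ((x : V) - z) * w (x, z))%:E)%E.
have Ifin k x : I k x = (rint (fun z => mollifier (radk k) (x - z) * w (x, z)))%:E.
  rewrite /I rintE//; under [X in real_integrable _ X]eq_fun do rewrite mulrC.
  apply: (@integM_bdd _ _ _ _ _ _ 1).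
  - by under [X in real_integrable _ X]eq_fun do rewrite mollifierC; exact: integ_mollifier.
  - exact: (measurableT_comp mw (@pair1_measurable _ _ MV _ x)).
  - by move=> z; rewrite ger0_norm.
pose c k x := fine (I k x).
have mc k : meas (c k).
  apply: measurableT_comp; first exact: fine_measurable.
  have := @measurable_fun_fubini_tonelli_F _ _ MV MV R vol
    (fun p => (mollifier (radk k) ((p.1 : V) - p.2) * w p)%:E); apply.
    apply/measurable_EFinP/measurable_funM => //; exact: measurable_mollifier2.
  by move=> p; rewrite lee_fin mulr_ge0// mollifier_ge0.
have c01 k x : 0 <= c k x <= \1_O x.
  rewrite /c Ifin /= rint_ge0/= => [|z]; last by rewrite mulr_ge0// mollifier_ge0.
  rewrite /w /= indicE; case: (x \in O) => /=; last first.
    by under eq_rint do rewrite mul0r mulr0; rewrite rint0.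
  under eq_rint do rewrite mul1r mollifierC.
  rewrite -(rint_mollifier x (d0 k)); apply: le_rint.
  - under [X in real_integrable _ X]eq_fun do rewrite mulrC.
    apply: (@integM_bdd _ _ _ _ _ _ 1); first exact: integ_mollifier.
      by apply: measurable_indic; exact: measurableC.
    by move=> z; rewrite indicE ger0_norm// lern1 leq_b1.
  - exact: integ_mollifier.
  - by move=> z; rewrite ler_piMr ?mollifier_ge0// indicE lern1 leq_b1.
have c_cvg x : c k x @[k --> \oo] --> (0 : R).
  have [xO|xO] := pselect (O x); last first.
    rewrite (_ : c ^~ x = cst 0); first exact: cvg_cst.
    apply/funext => k; apply/eqP; rewrite eq_le; have := c01 k x.
    by rewrite indicE memNset// => /andP[-> ->].
  have /nbhs_ballP[r /= r0 rO] := open_nbhs_nbhs (conj oO xO).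
  apply: cvg_near_cst; near=> k; rewrite /c Ifin /=.
  have kr : radk k < r by near: k; exact: radk_lt.
  rewrite -[RHS](@rint0 _ MV R vol); apply: eq_rint => z.
  have [zO|zO] := pselect (O z).
    by rewrite /w /= [\1_(~` O) z]indicE memNset ?mulr0//; apply; exact: zO.
  rewrite mollifier_vanish ?mul0r//.
  apply: lt_le_trans kr _; rewrite leNgt; apply/negP => xz.
  by apply: zO; apply: rO; rewrite -ball_normE.
have c_le k x : `|c k x| <= \1_O x.
  by have /andP[? ?] := c01 k x; rewrite ger0_norm.
have sc : small (fun k => (rint (c k))%:E).
  apply: small_cvg; rewrite -[X in _ --> X](@rint0 _ MV R vol).
  exact: (rint_dct mc iO c_cvg c_le).
have molw k : molint (radk k) w = (rint (c k))%:E.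
  rewrite -rintE; last exact: (integ_le (mc k) iO (c_le k)).
  by apply: eq_integral => x _; rewrite /c Ifin -Ifin.
have mws : meas2 (fun p => w (p.2, p.1)).
  apply: (measurableT_comp mw).
  by apply: measurable_fun_pair; [exact: measurable_snd|exact: measurable_fst].
apply: (@small_le _ _ (fun k => molint (radk k) w + molint (radk k) w)%E) => [k|]; last first.
  by under eq_fun do rewrite molw; exact: small_add.
rewrite -[in X in (_ + X)%E](molint_swap (d0 k) mw w0).
apply: le_trans _ (eq_ele (molintD (d0 k) mw mws w0 (fun p => w0 _))).
apply: le_molint => //.
- by apply: meas_diff2; exact: measurable_indic.
- exact: measurable_funD.
- by move=> p; exact: normr_ge0.
- move=> [x z]; rewrite /diff2 /w /= !indicE !in_setC.
  by case: (x \in O); case: (z \in O); rewrite /= ?subrr ?normr0 ?mulr0 ?mul0r ?mulr1 ?addr0 ?add0r ?subr0 ?sub0r ?normrN ?normr1.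
Unshelve. all: end_near. Qed.

(** Open sets are stable under intersection and generate the Borel sets, so it suffices that the
    good sets form a lambda-system. Cutting with a fixed ball keeps all indicators integrable. *)
Lemma mollifies_set (S : set V) (r : R) : 0 < r -> measurable (S : set MV) ->
  mollifies (\1_(S `&` ball 0 r)).
Proof.
move=> r0 mS.
have [B [oB fvB ->]] : exists B : set V,
    [/\ open B, (vol B < +oo)%E & ball (0 : V) r = B].
  by exists (ball (0 : V) r); rewrite volume_ball// ltry; split => //; exact: ball_open.
have mB := measurable_open oB.
have fB (X : set MV) : measurable X -> (vol (X `&` B) < +oo)%E.
  move=> mX; apply: le_lt_trans fvB.
  by apply: le_measure; rewrite ?inE//; exact: measurableI.
have iB (X : set MV) : measurable X -> integ (\1_(X `&` B)).
  by move=> mX; apply: integ_indic; [exact: measurableI|exact: fB].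
pose H (X : set MV) := measurable X /\ mollifies (\1_(X `&` B)).
(* Increasing unions: the truncated indicators converge in L^1 by domination, and [mollifies_approx]
   applies. *)
have Hnd (F : nat -> set V) : nondecreasing_seq F -> (forall i, H (F i)) -> H (\bigcup_i F i).
  move=> ndF HF.
  have mF i : measurable (F i : set MV) by case: (HF i).
  pose U : set V := \bigcup_i F i.
  have mU : measurable (U : set MV) by exact: bigcup_measurable.
  split => //; apply: mollifies_approx; first exact: iB.
  pose u k (x : MV) := `|\1_(U `&` B) x - \1_(F k `&` B) x| : R.
  have mu k : meas (u k).
    by apply: measurableT_comp => //; apply: measurable_funB; apply: measurable_indic; exact: measurableI.
  have : rint (u k) @[k --> \oo] --> 0.
    rewrite -[X in _ --> X](@rint0 _ MV R vol).
    apply: (@rint_dct _ MV R vol u (fun=> 0) (\1_([set: MV] `&` B))) => //.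
    * exact: iB.
    * move=> x; apply: cvg_near_cst.
      have [[i _ Fix]|nF] := pselect (U x).
        near=> k; have Fkx : F k x.
          have ik : (i <= k)%N by near: k; exact: nbhs_infty_ge.
          by have /subsetPset/(_ x Fix) := ndF _ _ ik.
        rewrite /u !indicE !in_setI (mem_set Fkx) mem_set ?subrr ?normr0//.
        by exists k.
      apply: nearW => k; have nFk : ~ F k x by move=> Fkx; apply: nF; exists k.
      by rewrite /u !indicE !in_setI (memNset nF) (memNset nFk) subrr normr0.
    * move=> k x; rewrite normr_id /u !indicE !in_setI in_setT /=.
      have : x \in F k -> x \in U by rewrite !inE => ?; exists k.
      case: (x \in F k); case: (x \in U); case: (x \in B) => H' /=;
        first [by have := H' isT | by rewrite ?mulr1n ?mulr0n ?subrr ?subr0 ?normr0 ?normr1].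
  move=> /cvgr0Pnorm_le u0 e e0.
  have /filter_ex [k uk] := u0 e e0.
  exists (\1_(F k `&` B)); split; [exact: iB|by case: (HF k)|].
  by apply: le_trans uk; rewrite ger0_norm// rint_ge0// => x; exact: normr_ge0.
suff : <<s [set: V], open >> `<=` H by move=> /(_ S mS)[].
apply: lambda_system_subset.
- by move=> X Y; exact: openI.
- split.
  + by [].
  + split; first exact: measurableT.
    by apply: mollifies_open; [rewrite setTI|exact: fB].
  + move=> X Y YX [mX sX] [mY sY]; split; first exact: measurableD.
    have := @mollifies_lin (-1) _ _ (iB _ mX) (iB _ mY) sX sY.
    congr mollifies; apply/funext => x; rewrite setDE !indicE !in_setI in_setC.
    have : x \in Y -> x \in X by rewrite !inE; exact: YX.
    by case: (x \in Y); case: (x \in X); case: (x \in B) => H' /=;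
      first [by have := H' isT | rewrite ?mulr1n ?mulr0n; by ring].
  + exact: Hnd.
- move=> X oX; have mX := measurable_open oX; split => //.
  by apply: mollifies_open; [exact: openI|exact: fB].
- by [].
Unshelve. all: end_near. Qed.
End MollifyL1.

Section MollifyLp.
Context {R : realType} {n : nat}.
Local Notation V := 'rV[R]_n.
Local Notation MV := (borel R n).
Local Notation vol := (@volume R n).
Local Notation integ := (real_integrable vol).
Local Notation rint := (real_integral vol).

Lemma mollifies_sum (r : R) (s : seq R) (F : R -> set V) : 0 < r ->
  (forall c, measurable (F c : set MV)) ->
  let g x := \sum_(c <- s) c * \1_(F c `&` ball (0 : V) r) x in
  integ g /\ mollifies g.
Proof.
move=> r0 mF /=.
have mB : measurable (ball (0 : V) r : set MV) by apply: measurable_open; exact: ball_open.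
have iB (X : set V) : measurable (X : set MV) -> integ (\1_(X `&` ball (0 : V) r)).
  move=> mX; apply: integ_indic; first exact: measurableI.
  apply: (@le_lt_trans _ _ (vol (ball (0 : V) r))); last by rewrite volume_ball// ltry.
  by apply: le_measure; rewrite ?inE//; exact: measurableI.
elim: s => [|c s [ii ss]].
  rewrite (_ : (fun x => _) = (fun=> 0)); last by apply/funext => x; rewrite big_nil.
  split; first exact: integ0.
  have := @mollifies_set R n set0 r r0 measurable0.
  by congr mollifies; apply/funext => x; rewrite set0I indic0.
rewrite (_ : (fun x => _) = (fun x => \sum_(c <- s) c * \1_(F c `&` ball (0 : V) r) x +
   c * \1_(F c `&` ball (0 : V) r) x)); last by apply/funext => x; rewrite big_cons addrC.
split; first by apply: integD => //; apply: integZ; exact: iB.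
exact: (mollifies_lin c ii (iB _ (mF c)) ss (mollifies_set r0 (mF c))).
Qed.

Import HBNNSimple.

(** L^1 approximation by simple functions from below. *)
Lemma mollifies_ge0 (g : V -> R) (r : R) : integ g -> (forall x, 0 <= g x) ->
  vanish_off r g -> mollifies g.
Proof.
move=> gi g0 gr; have mg := integ_meas gi.
have mE : measurable_fun setT (EFin \o g : MV -> _) by exact/measurable_EFinP.
pose s := nnsfun_approx measurableT mE.
have s_cvg x : s k x @[k --> \oo] --> g x.
  have := @cvg_nnsfun_approx _ _ _ _ measurableT _ mE (fun x _ => g0 x) x I.
  by move=> /fine_cvgP[_].
have s_nd x : nondecreasing_seq (fun k => s k x).
  by move=> a b ab; exact/lefP/nd_nnsfun_approx.
have s_le k x : s k x <= g x.
  have := @nondecreasing_cvgn_le R (fun k => s k x) (s_nd x) (cvgP _ (s_cvg x)) k.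
  by rewrite (cvg_lim _ (s_cvg x)).
apply: mollifies_approx => // e e0.
have : rint (fun x => `|g x - s k x|) @[k --> \oo] --> (0 : R).
  rewrite -[X in _ --> X](@rint0 _ MV R vol).
  apply: (@rint_dct _ MV R vol (fun k x => `|g x - s k x|) (fun=> 0) g) => //.
  - by move=> k; apply: measurableT_comp => //; exact: measurable_funB.
  - move=> x; rewrite -(normr0 R) -(subrr (g x)).
    by apply: cvg_norm; apply: cvgB => //; exact: cvg_cst.
  - by move=> k x; rewrite normr_id ger0_norm ?subr_ge0// gerBl.
move=> /cvgr0Pnorm_le/(_ e e0)/filter_ex[k ke].
pose r' := `|r| + 1.
have r'0 : 0 < r' by rewrite ltr_wpDl.
have mF c : measurable ((s k : MV -> R) @^-1` [set c]) by exact: measurable_sfunP.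
have [hi hs] := @mollifies_sum r' (finmap.enum_fset (fset_set (range (s k))))
  (fun c => (s k : MV -> R) @^-1` [set c]) r'0 mF.
(* Since 0 <= s_k <= g, the simple function vanishes outside the ball too, so cutting its level sets
   with the ball does not change it. *)
have sE x : s k x = \sum_(c <- finmap.enum_fset (fset_set (range (s k))))
    c * \1_((s k : MV -> R) @^-1` [set c] `&` ball (0 : V) r') x.
  rewrite [LHS]fimfunE fsbig_finite//=; apply: eq_bigr => c _.
  rewrite !indicE in_setI.
  have [xB|xB] := pselect (ball (0 : V) r' x); first by rewrite (mem_set xB) andbT.
  rewrite (memNset xB) andbF mulr0.
  have [xc|xc] := pselect (((s k : MV -> R) @^-1` [set c]) x); last by rewrite memNset// mulr0.
  suff -> : c = 0 by rewrite mul0r.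
  rewrite -xc; apply/eqP; rewrite eq_le; apply/andP; split => //.
  rewrite (le_trans (s_le k x))// gr//.
  move: xB; rewrite -ball_normE /= sub0r normrN => /negP; rewrite -leNgt.
  by apply: lt_le_trans; rewrite /r' (le_lt_trans (ler_norm r))// ltrDl.
exists (s k); split.
- by have -> := funext sE.
- by have -> := funext sE.
- by apply: le_trans ke; rewrite ger0_norm// rint_ge0// => x; exact: normr_ge0.
Qed.

Lemma mollifies_fun (g : V -> R) (r : R) : integ g -> vanish_off r g -> mollifies g.
Proof.
move=> gi gr; have mg := integ_meas gi.
have pi : integ (fun x => Num.max (g x) 0).
  apply: (integ_le _ (integ_norm gi)); first exact: measurable_maxr.
  by move=> x; rewrite ger0_norm ?le_max ?lexx ?orbT// ge_max ler_norm normr_ge0.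
have ni : integ (fun x => Num.max (- g x) 0).
  apply: (integ_le _ (integ_norm gi)).
    by apply: measurable_maxr => //; exact: measurableT_comp.
  by move=> x; rewrite ger0_norm ?le_max ?lexx ?orbT// ge_max -normrN ler_norm normr_ge0.
have -> : g = (fun x => Num.max (g x) 0 + (-1) * Num.max (- g x) 0).
  apply/funext => x; rewrite /Num.max oppr_lt0.
  by have [g0|g0|->] := ltgtP (g x) 0; rewrite ?oppr0; ring.
apply: mollifies_lin => //.
- apply: (@mollifies_ge0 _ r) => //; first by move=> x; rewrite le_max lexx orbT.
  by move=> x rx; rewrite gr// maxxx.
- apply: (@mollifies_ge0 _ r) => //; first by move=> x; rewrite le_max lexx orbT.
  by move=> x rx; rewrite gr// oppr0 maxxx.
Qed.
End MollifyLp.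

(** * A crude Young inequality with a parameter *)

Section Young.
Context {R : realType}.
Variables (p : R).
Hypothesis p2 : 2 <= p.

Lemma powR_split (s : R) : 0 <= s -> s `^ p = s `^ (p - 1) * s.
Proof.
move=> s0; have p0 : 0 < p by apply: lt_le_trans p2.
by rewrite mulrC mulr_powRB1.
Qed.

(** If t <= kappa s, the first term alone suffices. Otherwise s < t / kappa, and p - 1 >= 1 together
    with kappa >= 1 bounds kappa^(-(p-1)) by kappa^(-1). *)
Lemma young_powR (s t kappa : R) : 0 <= s -> 0 <= t -> 1 <= kappa ->
  s `^ (p - 1) * t <= kappa * s `^ p + kappa^-1 * t `^ p.
Proof.
move=> s0 t0 k1; have k0 : 0 < kappa by lra.
have [ts|ts] := leP t (kappa * s).
  apply: (@le_trans _ _ (kappa * s `^ p)).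
    rewrite powR_split// mulrCA; apply: ler_wpM2l => //; exact: powR_ge0.
  by rewrite lerDl mulr_ge0 ?powR_ge0// invr_ge0 ltW.
apply: (@le_trans _ _ (kappa^-1 * t `^ p)); last first.
  by rewrite lerDr mulr_ge0 ?powR_ge0// ltW.
rewrite powR_split// mulrA; apply: ler_wpM2r => //.
have st : s <= kappa^-1 * t.
  by rewrite mulrC ler_pdivlMr// mulrC ltW.
have p1 : 0 <= p - 1 by move: p2; lra.
have ki0 : 0 <= kappa^-1 by rewrite invr_ge0 ltW.
apply: (@le_trans _ _ ((kappa^-1 * t) `^ (p - 1))).
  by apply: ge0_ler_powR => //; rewrite nnegrE ?mulr_ge0.
rewrite powRM//; apply: ler_wpM2r; first exact: powR_ge0.
rewrite -[leRHS]powRr1//.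
apply: ger_powR; last by move: p2; lra.
by rewrite invr_gt0 k0 invf_le1.
Qed.

Lemma powR_norm_sub (u v : R) : `|u - v| `^ p <= 2 `^ p * (`|u| `^ p + `|v| `^ p).
Proof.
have p0 : 0 <= p by apply: le_trans p2.
have H (s t : R) : `|s| <= `|t| -> `|s - t| `^ p <= 2 `^ p * (`|s| `^ p + `|t| `^ p).
  move=> st; apply: (@le_trans _ _ (2 `^ p * `|t| `^ p)).
    rewrite -powRM//; apply: ge0_ler_powR; rewrite ?nnegrE ?mulr_ge0//.
    apply: le_trans (ler_normB _ _) _; lra.
  by rewrite ler_wpM2l ?powR_ge0// lerDr powR_ge0.
have [uv|/ltW vu] := leP `|u| `|v|; first exact: H.
by rewrite distrC [X in _ * X]addrC; exact: H.
Qed.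
End Young.

(** * Pairing a flux with a mollified L^p function *)

Section Pairing.
Context {R : realType} {n : nat}.
Local Notation V := 'rV[R]_n.
Local Notation MV := (borel R n).
Local Notation vol := (@volume R n).
Local Notation integ := (real_integrable vol).
Local Notation rint := (real_integral vol).
Local Notation meas f := (measurable_fun setT (f : MV -> R)).
Local Notation meas2 f := (measurable_fun setT (f : MV * MV -> R)).

Definition wdiff2 (b g : V -> R) : MV * MV -> R := fun q => `|b q.1| * diff2 g q.

Lemma meas_wdiff2 b g : meas b -> meas g -> meas2 (wdiff2 b g).
Proof.
move=> mb mg; apply: measurable_funM; last exact: meas_diff2.
by apply: (@meas_fst _ _ (fun x => `|b x|)); exact: measurableT_comp.
Qed.

(** Where a <= M the weight is at most M^(p-1), and L^1 mollification of [g] is enough. Where a > M,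
    Young's inequality leaves kappa times the tail of a^p plus kappa^(-1) times a fixed multiple of
    the integral of |g|^p: kappa is fixed first, then M. *)
Lemma small_wdiff2 (p r : R) (a b g : V -> R) : 2 <= p ->
  meas a -> (forall x, 0 <= a x) -> integ (fun x => a x `^ p) ->
  integ g -> vanish_off r g -> integ (fun x => `|g x| `^ p) ->
  meas b -> (forall x, `|b x| <= a x `^ (p - 1)) ->
  small (fun k => molint (radk k) (wdiff2 b g)).
Proof.
move=> p2 ma a0 ai gi gr gpi mb ba; have mg := integ_meas gi.
apply: small_approx => e e0.
have e2 : 0 < e / 2 by rewrite divr_gt0.
pose Gam := rint (fun x => `|g x| `^ p).
have Gam0 : 0 <= Gam by apply: rint_ge0 => x; exact: powR_ge0.
have two0 : 0 <= 2 `^ p :> R by exact: powR_ge0.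
(* Makes the |g|^p contribution at most e/2. [Gam] counts twice, once for each variable of |g(z) -
   g(x)|; the summand 1 ensures kappa >= 1. *)
pose kappa := 1 + 2 `^ p * (Gam + Gam) / (e / 2).
have T0 : 0 <= 2 `^ p * (Gam + Gam) / (e / 2).
  by apply: divr_ge0; [apply: mulr_ge0 => //; exact: addr_ge0|exact: ltW].
have k1 : 1 <= kappa by rewrite lerDl.
have k0 : 0 < kappa by apply: lt_le_trans k1.
have kGam : kappa^-1 * (2 `^ p * (Gam + Gam)) <= e / 2.
  rewrite mulrC ler_pdivrMr// [leRHS]mulrC -ler_pdivrMr//.
  by rewrite /kappa lerDr.
pose tail (M : nat) x := if a x <= M%:R then 0 else a x `^ p.
have mtail M : meas (tail M).
  apply: measurable_fun_ifT => //; first by apply: measurable_fun_ler.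
  by have := integ_meas ai.
have tail0 M x : 0 <= tail M x by rewrite /tail; case: ifP => // _; exact: powR_ge0.
have tail_le M x : `|tail M x| <= a x `^ p.
  by rewrite ger0_norm// /tail; case: ifP => // _; exact: powR_ge0.
have taili M : integ (tail M) by exact: integ_le (mtail M) ai (tail_le M).
have : rint (tail M) @[M --> \oo] --> (0 : R).
  rewrite -[X in _ --> X](@rint0 _ MV R vol).
  apply: (rint_dct mtail ai _ tail_le) => x.
  apply: cvg_near_cst; near=> M; rewrite /tail ifT//.
  by near: M; exact: nbhs_infty_ger.
have ek : 0 < e / 2 / kappa by rewrite divr_gt0.
move=> /cvgr0Pnorm_le/(_ _ ek)/filter_ex[M HM].
have {}HM : kappa * rint (tail M) <= e / 2.
  by rewrite mulrC -ler_pdivlMr// (le_trans (ler_norm _)).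
pose c := M%:R `^ (p - 1) : R.
have c0 : 0 <= c by exact: powR_ge0.
exists (fun k => c%:E * molint (radk k) (diff2 g))%E; split.
  apply: small_scale => // [k|]; first exact: (molint_ge0 (@radk_gt0 R k) (fun q => normr_ge0 _)).
  exact: mollifies_fun gr.
move=> k; have d0 := @radk_gt0 R k.
pose gp x := kappa^-1 * (2 `^ p * `|g x| `^ p).
have mgp : meas gp by have := integ_meas (integZ (kappa^-1) (integZ (2 `^ p) gpi)).
have gp0 x : 0 <= gp x by rewrite mulr_ge0 ?invr_ge0 ?(ltW k0)// mulr_ge0// powR_ge0.
pose u x := kappa * tail M x + gp x.
have mt2 : meas (fun x => kappa * tail M x) by exact: measurable_funM.
have mu : meas u by exact: measurable_funD.
have u0 x : 0 <= u x by rewrite addr_ge0// mulr_ge0// ltW.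
have mcd : meas2 (fun q => c * diff2 g q) by apply: measurable_funM => //; exact: meas_diff2.
have cd0 q : 0 <= c * diff2 g q by rewrite mulr_ge0// normr_ge0.
have mu1 := meas_fst mu; have mg2 := meas_snd mgp.
have mug : meas2 (fun q => u q.1 + gp q.2) by exact: measurable_funD.
have ug0 (q : MV * MV) : 0 <= u q.1 + gp q.2 by exact: addr_ge0.
apply: (@le_trans _ _ (molint (radk k) (fun q => c * diff2 g q + (u q.1 + gp q.2)))).
  apply: le_molint => //; first exact: meas_wdiff2.
    exact: measurable_funD.
    by move=> q; rewrite mulr_ge0// normr_ge0.
  move=> [x z]; rewrite /wdiff2 /= /u /tail.
  have D0 : 0 <= diff2 g (x, z) by exact: normr_ge0.
  case: ifPn => aM.
    rewrite mulr0 add0r -[leLHS]addr0; apply: lerD; last exact: addr_ge0.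
    apply: ler_wpM2r => //; apply: le_trans (ba x) _.
    by apply: ge0_ler_powR; rewrite ?nnegrE//; lra.
  apply: (@le_trans _ _ (a x `^ (p - 1) * diff2 g (x, z))); first exact: ler_wpM2r.
  apply: le_trans (young_powR p2 (a0 x) D0 k1) _.
  rewrite -[leLHS]add0r; apply: lerD => //.
  rewrite -addrA lerD2l /gp -!mulrDr ler_wpM2l ?invr_ge0 ?(ltW k0)//.
  by rewrite [`|g x| `^ p + _]addrC; exact: powR_norm_sub.
rewrite (molintD d0 mcd mug cd0 ug0).
apply: leeD; first by rewrite (molintZ d0 c0 (meas_diff2 mg) (fun q => normr_ge0 _)).
rewrite (molintD d0 mu1 mg2 (fun q => u0 _) (fun q => gp0 _)).
rewrite (molint_fst d0 mu u0) (molint_snd d0 mgp gp0).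
have gpi' : integ gp by apply: integZ; exact: integZ.
have ui : integ u by apply: integD => //; exact: integZ.
rewrite !rintE// -EFinD lee_fin /u rintD//; last exact: integZ.
rewrite rintZ// -addrA.
have -> : rint gp = kappa^-1 * (2 `^ p * Gam) by rewrite /gp !rintZ//; exact: integZ.
by rewrite -!mulrDr (splitr e); apply: lerD.
Unshelve. all: end_near. Qed.

Lemma convol_bdd (rho g : V -> R) (C : R) : continuous rho -> (forall z, `|rho z| <= C) ->
  integ g -> forall x, `|convol rho g x| <= C * rint (fun z => `|g z|).
Proof.
move=> cr rC gi x; have ii := integ_convol x cr rC gi.
apply: le_trans (le_norm_rint ii) _.
rewrite -rintZ; last exact: integ_norm.
apply: le_rint; [exact: integ_norm|exact/integZ/integ_norm|].
by move=> z; rewrite normrM ler_wpM2r.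
Qed.

(** As the mollifier has mass 1, the left-hand difference is the integral of rho(x - z) (g(z) -
    g(x)) over z. *)
Lemma convol_sub_le (d C : R) (b g : V -> R) x : 0 < d ->
  (forall z : V, `|mollifier d z| <= C) -> integ g ->
  ((`|b x| * `|convol (mollifier d) g x - g x|)%:E <=
   \int[vol]_z (mollifier d (x - z) * wdiff2 b g (x, z))%:E)%E.
Proof.
move=> d0 mC gi; have cm := @mollifier_continuous R n d.
have ig := integ_convol x cm mC gi.
have im : integ (fun z => mollifier d (x - z)).
  by under [X in real_integrable _ X]eq_fun do rewrite mollifierC; exact: integ_mollifier.
have im1 : rint (fun z => mollifier d (x - z)) = 1.
  by rewrite -(rint_mollifier x d0); apply: eq_rint => z; rewrite mollifierC.
pose h z := mollifier d (x - z) * g z - g x * mollifier d (x - z).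
have ih : integ h by apply: integB => //; exact: integZ.
have hE : rint h = convol (mollifier d) g x - g x.
  rewrite rintB//; last exact: integZ.
  by rewrite rintZ// im1 mulr1.
have nh z : `|h z| = mollifier d (x - z) * `|g z - g x|.
  by rewrite /h [g x * _]mulrC -mulrBr normrM ger0_norm// mollifier_ge0.
have -> : (\int[vol]_z (mollifier d (x - z) * wdiff2 b g (x, z))%:E)%E =
   (rint (fun z => `|b x| * `|h z|))%:E.
  rewrite -rintE; last by apply: integZ; exact: integ_norm.
  by apply: eq_integral => z _; rewrite nh /wdiff2 /diff2 /= mulrCA.
rewrite lee_fin rintZ; last exact: integ_norm.
by rewrite -hE; apply: ler_wpM2l => //; exact: le_norm_rint.
Qed.

(** Replacing the mollified [g] by [g] costs at most C times the weighted double integral, which is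
    small; what remains converges by domination by C |b g|. *)
Lemma convol_pairing (b g : V -> R) (chi : nat -> V -> R) (chi0 : V -> R) (C : R) :
  meas b -> integ b -> integ g -> integ (fun x => b x * g x) ->
  small (fun k => molint (radk k) (wdiff2 b g)) ->
  (forall k, meas (chi k)) -> (forall k x, `|chi k x| <= C) ->
  (forall x, chi k x @[k --> \oo] --> chi0 x) ->
  rint (fun x => chi k x * (b x * convol (mollifier (radk k)) g x)) @[k --> \oo] -->
  rint (fun x => chi0 x * (b x * g x)).
Proof.
move=> mb ib ig ibg sm mchi chiC chi_cvg.
have mg := integ_meas ig.
have C0 : 0 <= C by apply: le_trans (chiC 0%N 0).
pose gk k := convol (mollifier (radk k)) g.
have mCk k : exists Ck : R, 0 <= Ck /\ forall z : V, `|mollifier (radk k) z| <= Ck.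
  by apply: (cont_vanish_bdd (@mollifier_continuous R n (radk k)));
    exact: mollifier_vanish (@radk_gt0 R k).
have cgk k : continuous (gk k).
  by have [Ck [_ HC]] := mCk k; exact: convol_continuous (@mollifier_continuous _ _ _) HC ig.
have ibgk k : integ (fun x => b x * gk k x).
  have [Ck [_ HC]] := mCk k.
  under [X in real_integrable _ X]eq_fun do rewrite mulrC.
  apply: (integM_bdd ib (continuous_borel (cgk k))).
  exact: convol_bdd (@mollifier_continuous _ _ _) HC ig.
have ic k (f : V -> R) : integ f -> integ (fun x => chi k x * f x).
  by move=> fi; exact: integM_bdd fi (mchi k) (chiC k).
have A : rint (fun x => chi k x * (b x * g x)) @[k --> \oo] -->
    rint (fun x => chi0 x * (b x * g x)).
  apply: (@rint_dct _ MV R vol (fun k x => chi k x * (b x * g x))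
    (fun x => chi0 x * (b x * g x)) (fun x => C * `|b x * g x|)).
  - by move=> k; apply: integ_meas; exact: ic.
  - exact/integZ/integ_norm.
  - by move=> x; apply: cvgMl.
  - by move=> k x; rewrite normrM ler_wpM2r.
have B : rint (fun x => chi k x * (b x * gk k x)) - rint (fun x => chi k x * (b x * g x))
    @[k --> \oo] --> (0 : R).
  apply/cvgr0Pnorm_le => e e0.
  have eC : 0 < e / (C + 1) by rewrite divr_gt0// ltr_wpDl.
  have := sm _ eC; apply: filterS => k Hk.
  have idf : integ (fun x => b x * (gk k x - g x)).
    by under [X in real_integrable _ X]eq_fun do rewrite mulrBr; exact: integB.
  rewrite -rintB; [|exact: ic|exact: ic].
  have -> : rint (fun x => chi k x * (b x * gk k x) - chi k x * (b x * g x)) =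
     rint (fun x => chi k x * (b x * (gk k x - g x))).
    by apply: eq_rint => x; ring.
  apply: le_trans (le_norm_rint (ic k _ idf)) _.
  apply: (@le_trans _ _ (rint (fun x => C * `|b x * (gk k x - g x)|))).
    apply: le_rint; [exact/integ_norm/ic|exact/integZ/integ_norm|].
    by move=> x; rewrite normrM ler_wpM2r.
  rewrite rintZ; last exact: integ_norm.
  have le1 : rint (fun x => `|b x * (gk k x - g x)|) <= e / (C + 1).
    rewrite -lee_fin -rintE; last exact: integ_norm.
    apply: le_trans Hk; rewrite /molint.
    have [Ck [_ HC]] := mCk k.
    apply: ge0_le_integral => //.
    - by apply/measurable_EFinP; exact: (integ_meas (integ_norm idf)).
    - have := @measurable_fun_fubini_tonelli_F _ _ MV MV R vol
        (fun q => (mollifier (radk k) ((q.1 : V) - q.2) * wdiff2 b g q)%:E); apply.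
        apply/measurable_EFinP/measurable_funM; first exact: measurable_mollifier2.
        exact: meas_wdiff2.
      move=> q; rewrite lee_fin mulr_ge0 ?mollifier_ge0 ?radk_gt0//.
      by rewrite mulr_ge0// normr_ge0.
    - move=> x _; rewrite normrM; exact: convol_sub_le (@radk_gt0 R k) HC ig.
  apply: le_trans (ler_wpM2l C0 le1) _.
  by rewrite mulrA ler_pdivrMr ?ltr_wpDl// mulrC ler_wpM2l ?ltW// ltrDl.
rewrite -[X in _ --> X]add0r.
rewrite (_ : (fun k => _) = (fun k => (rint (fun x => chi k x * (b x * gk k x)) -
  rint (fun x => chi k x * (b x * g x))) + rint (fun x => chi k x * (b x * g x)))).
  exact: cvgD B A.
by apply/funext => k; rewrite subrK.
Qed.
End Pairing.

Lemma flat_bdd (R : realType) (q : {poly R}) : exists C : R, 0 <= C /\ forall t, `|flat q t| <= C.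
Proof.
have [C HC] := poly_expN_bdd q.
have C0 : 0 <= C by apply: le_trans (HC 1 ltr01).
exists C; split => // t; rewrite /flat; case: ifPn => t0; last by rewrite normr0.
by apply: HC; rewrite invr_gt0.
Qed.

(** * Uniform continuity and uniform mollification *)

Section Uniform.
Context {R : realType} {n : nat}.
Local Notation V := 'rV[R]_n.
Local Notation MV := (borel R n).
Local Notation vol := (@volume R n).
Local Notation integ := (real_integrable vol).
Local Notation rint := (real_integral vol).
Local Notation meas f := (measurable_fun setT (f : MV -> R)).

Lemma compact_norm_le (r : R) : compact [set x : V | `|x| <= r].
Proof.
apply: bounded_closed_compact.
  by exists r; split => [|M rM x /= xr]; [exact: num_real|rewrite (le_trans xr)// ltW].
apply: (@closed_comp _ _ (fun x : V => `|x|) [set y | y <= r]) => [x _|].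
  exact: norm_continuous.
exact: closed_le.
Qed.

(** Compactness gives a uniform radius for x in the ball of radius |r| + 1. If x lies outside it, d
    < 1 keeps y outside the support as well. *)
Lemma vanish_unif_cont (f : V -> R) (r e : R) : continuous f -> vanish_off r f -> 0 < e ->
  exists d : R, 0 < d /\ forall x y, `|x - y| <= d -> `|f x - f y| < e.
Proof.
move=> cf fr e0.
have e2 : 0 < e / 2 by rewrite divr_gt0.
have /compact_near_coveringP cov := @compact_norm_le (`|r| + 1).
have : \forall d \near (0 : R)^'+, [set x : V | `|x| <= `|r| + 1] `<=`
    [set x | forall y, `|x - y| <= d -> `|f x - f y| < e].
  apply: cov => x _.
  have /cvgrPdist_lt/(_ _ e2)/nbhs_ballP[s /= s0 sf] := cf x.
  have s2 : 0 < s / 2 by rewrite divr_gt0.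
  exists (ball x (s / 2), [set d : R | d < s / 2]); first split.
  - exact: nbhsx_ballx.
  - exact: nbhs_right_lt.
  move=> [z d] [/= zx ds] y zy.
  have zs : ball x s z by apply: le_ball zx; lra.
  have ys : ball x s y.
    move: zx; rewrite -!ball_normE /= => zx.
    rewrite -[x - y](subrKA z); apply: le_lt_trans (ler_normD _ _) _; lra.
  have := sf _ zs; have := sf _ ys; rewrite /= => h1 h2.
  rewrite -[f z - f y](subrKA (f x)); apply: le_lt_trans (ler_normD _ _) _.
  rewrite [`|f z - f x|]distrC; lra.
move=> H.
have : \forall d \near (0 : R)^'+, 0 < d < 1.
  by near=> d; apply/andP; split; near: d; [exact: nbhs_right_gt|exact: nbhs_right_lt].
move=> H1; have [d [Hd /andP[d0 d1]]] := filter_ex (filterI H H1).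
exists d; split => // x y xy.
have [xr|xr] := leP `|x| (`|r| + 1); first exact: Hd.
have ry : `|r| < `|y|.
  have := lerB_dist x (x - y); rewrite subKr => h; have := le_trans (lerB_dist x (x - y)) (lexx _).
  rewrite subKr; lra.
rewrite !fr ?subrr ?normr0//.
  exact: le_lt_trans (ler_norm _) ry.
have := ler_norm r; lra.
Unshelve. all: end_near. Qed.

Lemma convol_close (d e : R) (g : V -> R) x : 0 < d -> integ g ->
  (forall z, `|x - z| <= d -> `|g x - g z| <= e) ->
  `|convol (mollifier d) g x - g x| <= e.
Proof.
move=> d0 gi gxz.
have [C [_ mC]] := cont_vanish_bdd (@mollifier_continuous R n d) (mollifier_vanish d0).
have cm := @mollifier_continuous R n d.
have ig := integ_convol x cm mC gi.
have im : integ (fun z => mollifier d (x - z)).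
  by under [X in real_integrable _ X]eq_fun do rewrite mollifierC; exact: integ_mollifier.
have im1 : rint (fun z => mollifier d (x - z)) = 1.
  by rewrite -(rint_mollifier x d0); apply: eq_rint => z; rewrite mollifierC.
pose h z := mollifier d (x - z) * g z - g x * mollifier d (x - z).
have ih : integ h by apply: integB => //; exact: integZ.
have hE : rint h = convol (mollifier d) g x - g x.
  rewrite rintB//; last exact: integZ.
  by rewrite rintZ// im1 mulr1.
rewrite -hE; apply: le_trans (le_norm_rint ih) _.
rewrite -[leRHS]mulr1 -im1 -rintZ//; apply: le_rint; [exact: integ_norm|exact: integZ|].
move=> z; rewrite /h [g x * _]mulrC -mulrBr normrM ger0_norm ?mollifier_ge0// mulrC.
have [xz|xz] := leP `|x - z| d.
  by apply: ler_wpM2r; [exact: mollifier_ge0|rewrite distrC gxz].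
by rewrite mollifier_vanish// !mulr0.
Qed.

Lemma integ_powR_sum (p : R) (s : seq 'I_n) (f : 'I_n -> V -> R) : 2 <= p ->
  (forall j, meas (f j)) -> (forall j, integ (fun x => `|f j x| `^ p)) ->
  integ (fun x => (\sum_(j <- s) `|f j x|) `^ p).
Proof.
move=> p2 mf fi; elim: s => [|j s IH].
  rewrite (_ : (fun x => _) = (fun=> 0)); first exact: integ0.
  by apply/funext => x; rewrite big_nil powR0// gt_eqF// (lt_le_trans _ p2).
rewrite (_ : (fun x => _) = (fun x => (`|f j x| + \sum_(j <- s) `|f j x|) `^ p)); last first.
  by apply/funext => x; rewrite big_cons.
apply: (integ_le _ (integZ (2 `^ p) (integD (fi j) IH))) => [|x].
  apply: (measurableT_comp (measurable_powR _)).
  apply: measurable_funD; first exact: measurableT_comp.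
  by apply: measurable_sum => i; exact: measurableT_comp.
have S0 : 0 <= \sum_(j <- s) `|f j x| by apply: sumr_ge0.
rewrite ger0_norm ?powR_ge0//.
have := powR_norm_sub p2 `|f j x| (- \sum_(j <- s) `|f j x|).
by rewrite opprK normr_id normrN (ger0_norm S0) (ger0_norm (addr_ge0 (normr_ge0 _) S0)).
Qed.

End Uniform.

(** * Strict monotonicity of the flux |a|^(p-2) a *)

Section Monotone.
Context {R : realType} {n : nat}.
Implicit Types a b : 'I_n -> R.

Definition vnorm a : R := Num.sqrt (\sum_j a j ^+ 2).

Lemma vnorm_ge0 a : 0 <= vnorm a. Proof. exact: sqrtr_ge0. Qed.

Lemma vnorm_sq a : vnorm a ^+ 2 = \sum_j a j ^+ 2.
Proof. by rewrite sqr_sqrtr// sumr_ge0// => j _; exact: sqr_ge0. Qed.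

(* With alpha = |a|^(p-2), beta = |b|^(p-2), the left-hand side equals
   (alpha + beta)/2 |a - b|^2 + (alpha - beta)(|a|^2 - |b|^2)/2. *)
Lemma pflux_monotone (p : R) a b : 2 <= p ->
  (vnorm a `^ (p - 2) + vnorm b `^ (p - 2)) / 2 * \sum_j (a j - b j) ^+ 2 <=
  \sum_j (vnorm a `^ (p - 2) * a j - vnorm b `^ (p - 2) * b j) * (a j - b j).
Proof.
move=> p2; set al := vnorm a `^ _; set be := vnorm b `^ _.
have -> : \sum_j (al * a j - be * b j) * (a j - b j) =
   (al + be) / 2 * (\sum_j (a j - b j) ^+ 2) +
   (al - be) / 2 * (vnorm a ^+ 2 - vnorm b ^+ 2).
  rewrite !vnorm_sq -sumrB !mulr_sumr -big_split /=; apply: eq_bigr => j _.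
  by field; rewrite ?pnatr_eq0.
rewrite lerDl.
have p20 : 0 <= p - 2 by lra.
have [ab|/ltW ba] := leP (vnorm a) (vnorm b).
  apply: mulr_le0; last by rewrite subr_le0 lerXn2r ?nnegrE ?vnorm_ge0.
  rewrite pmulr_lle0 ?invr_gt0// subr_le0.
  by apply: ge0_ler_powR; rewrite ?nnegrE ?vnorm_ge0.
apply: mulr_ge0; last by rewrite subr_ge0 lerXn2r ?nnegrE ?vnorm_ge0.
rewrite pmulr_lge0 ?invr_gt0// subr_ge0.
by apply: ge0_ler_powR; rewrite ?nnegrE ?vnorm_ge0.
Qed.

(** The lower bound forces either a = b or both factors |a|^(p-2), |b|^(p-2) to vanish, in which
    case both vectors are zero. For p = 2 the convention 0^0 = 1 rules the second case out. *)
Lemma pflux_inj (p : R) a b : 2 <= p ->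
  \sum_j (vnorm a `^ (p - 2) * a j - vnorm b `^ (p - 2) * b j) * (a j - b j) <= 0 ->
  forall j, a j = b j.
Proof.
move=> p2 /(le_trans (pflux_monotone a b p2)).
set al := vnorm a `^ _; set be := vnorm b `^ _; set S := \sum_j _.
have S0 : 0 <= S by apply: sumr_ge0 => j _; exact: sqr_ge0.
have al0 : 0 <= al by exact: powR_ge0.
have be0 : 0 <= be by exact: powR_ge0.
have zero c : vnorm c `^ (p - 2) = 0 -> forall j, c j = 0.
  move=> /eqP; rewrite powR_eq0 => /andP[/eqP c0 _] j.
  have : \sum_j c j ^+ 2 = 0 by rewrite -vnorm_sq c0 expr0n.
  move=> /eqP; rewrite psumr_eq0 => [|i _]; last exact: sqr_ge0.
  by move=> /allP/(_ j (mem_index_enum _)); rewrite sqrf_eq0 => /eqP.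
move=> H j.
have [S1|] := eqVneq S 0.
  move/eqP: S1; rewrite psumr_eq0 => [|i _]; last exact: sqr_ge0.
  move=> /allP/(_ j (mem_index_enum _)).
  by rewrite sqrf_eq0 subr_eq0 => /eqP.
rewrite neq_lt ltNge S0 /= => Sgt0.
have : (al + be) / 2 <= 0 by rewrite -(pmulr_lle0 _ Sgt0).
move=> ab; have a0 : al = 0 by lra.
have b0 : be = 0 by lra.
by rewrite (zero _ a0) (zero _ b0).
Qed.
End Monotone.

Lemma continuous_eps (R : realType) (V : normedModType R) (f : V -> R) :
  (forall x e, 0 < e -> \forall y \near x, `|f x - f y| < e) -> continuous f.
Proof. by move=> H x; apply/cvgrPdist_lt => e; exact: H. Qed.

(** * The excess of h over v, extended by zero *)

Section PositivePart.
Context {R : realType} {n : nat}.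
Local Notation V := 'rV[R]_n.
Variables (D : set V) (h v : V -> R).
Hypotheses (oD : open D) (cD : compact (closure D)).
Hypothesis ch : {within closure D, continuous h}.
Hypothesis cv : continuous v.
Hypothesis bd : forall x, closure D x -> ~ D x -> h x < v x.

Definition excess (x : V) : R := if `[< D x >] then Num.max (h x - v x) 0 else 0.

Lemma excess_gt0 x : 0 < excess x -> D x /\ excess x = h x - v x.
Proof.
rewrite /excess; case: asboolP => [Dx|_]; last by rewrite ltxx.
by rewrite lt_max ltxx orbF => hv; split => //; rewrite max_l// ltW.
Qed.

Lemma within_near x (e : R) : closure D x -> 0 < e ->
  \forall y \near x, closure D y -> `|h x - h y| < e.
Proof.
move=> Dx e0; have /subspace_continuousP/(_ x Dx)/cvgrPdist_lt/(_ _ e0) := ch.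
by [].
Qed.

(** The delicate points are those of the boundary of D. There h < v strictly, so h < v persists at
    nearby points of D and the excess vanishes around them. *)
Lemma continuous_excess : continuous excess.
Proof.
apply: continuous_eps => x e e0.
have cvx (s : R) : 0 < s -> \forall y \near x, `|v x - v y| < s.
  by move=> s0; have /cvgrPdist_lt/(_ _ s0) := @cv x.
have [Dcx|nDcx] := pselect (closure D x); last first.
  have : \forall y \near x, (~` closure D) y.
    by apply: open_nbhs_nbhs; split => //; apply: closed_openC; exact: closed_closure.
  have g0 y : ~ closure D y -> excess y = 0.
    move=> nDy; rewrite /excess; case: asboolP => // Dy; exfalso; apply: nDy.
    exact: subset_closure.
  by apply: filterS => y nDy; rewrite !g0// subrr normr0.
have [Dx|nDx] := pselect (D x).
  have e2 : 0 < e / 2 by rewrite divr_gt0.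
  have N1 := within_near Dcx e2; have N2 := cvx _ e2.
  have N3 : \forall y \near x, D y by apply: open_nbhs_nbhs; split.
  near=> y.
  have Dy : D y by near: y.
  have h1 : `|h x - h y| < e / 2.
    by move: (subset_closure Dy); near: y.
  have h2 : `|v x - v y| < e / 2 by near: y.
  rewrite /excess !asboolT//.
  have maxL (a b : R) : `|Num.max a 0 - Num.max b 0| <= `|a - b|.
    rewrite /Num.max; case: (ltP a 0) => a0; case: (ltP b 0) => b0;
      rewrite ?subrr ?normr0// ?sub0r ?subr0 ?normrN.
    - rewrite ger0_norm// ler0_norm; lra.
    - rewrite ger0_norm// ger0_norm; lra.
  apply: le_lt_trans (maxL _ _) _.
  have -> : h x - v x - (h y - v y) = (h x - h y) - (v x - v y) by ring.
  apply: le_lt_trans (ler_normB _ _) _; lra.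
(* Half the gap: h and v may each move by less than [s] without meeting. *)
pose s := (v x - h x) / 2.
have s0 : 0 < s by have := bd Dcx nDx; rewrite /s; lra.
have N1 := within_near Dcx s0; have N2 := cvx _ s0.
near=> y.
rewrite /excess asboolF// sub0r normrN; case: asboolP => [Dy|_]; last by rewrite normr0.
have h1 : `|h x - h y| < s.
  by move: (subset_closure Dy); near: y.
have h2 : `|v x - v y| < s by near: y.
rewrite max_r ?normr0//; move: h1 h2; rewrite !ltr_norml /s => /andP[? ?] /andP[? ?]; lra.
Unshelve. all: end_near. Qed.

Lemma excess_vanish : exists r : R, vanish_off r excess.
Proof.
have [M [_ HM]] := compact_bounded cD.
exists (M + 1) => x Mx; rewrite /excess; case: asboolP => // Dx.
have M1 : M < M + 1 by rewrite ltrDl.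
have := HM _ M1 x (subset_closure Dx) => /=.
by rewrite leNgt Mx.
Qed.
End PositivePart.

Lemma meas_borel_fun (R : realType) (n : nat) (f : 'rV[R]_n -> R) : borel_fun f ->
  measurable_fun setT (f : borel R n -> R).
Proof.
move=> bf; apply: (@measurability _ _ (borel R n) R setT f _ (RGenOpens.measurableE R)).
move=> _ [_ [a [b ->]] <-]; rewrite setTI.
by apply: bf.
Qed.

(** * Comparison with smooth supersolutions *)

Section Comparison.
Context {R : realType} {n : nat}.
Local Notation V := 'rV[R]_n.
Local Notation MV := (borel R n).
Local Notation vol := (@volume R n).
Local Notation integ := (real_integrable vol).
Local Notation rint := (real_integral vol).
Local Notation meas f := (measurable_fun setT (f : MV -> R)).
Local Notation "''e_' j" := (delta_mx 0 j : V) (at level 8, j at level 2, format "''e_' j").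

Definition flux (p : R) (a : 'I_n -> R) (j : 'I_n) : R := vnorm a `^ (p - 2) * a j.

(** Formulated with the gradient alone, and tested with C^1 functions that carry their gradient as
    data. *)
Definition weak_super (p : R) (dv : 'I_n -> V -> R) :=
  forall (phi : V -> R) (dphi : 'I_n -> V -> R) (r : R),
    continuous phi -> (forall j, continuous (dphi j)) -> vanish_off r phi ->
    (forall x, 0 <= phi x) -> (forall j x, is_derive x 'e_j phi (dphi j x)) ->
    0 <= \sum_j rint (fun x => flux p (fun i => dv i x) j * dphi j x).

Lemma flux_le (p : R) (a : 'I_n -> R) j : 2 <= p -> `|flux p a j| <= vnorm a `^ (p - 1).
Proof.
move=> p2; rewrite normrM ger0_norm ?powR_ge0//.
have aj : `|a j| <= vnorm a.
  rewrite /vnorm -sqrtr_sqr; apply: ler_wsqrtr.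
  by rewrite (bigD1 j)//= lerDl sumr_ge0// => i _; exact: sqr_ge0.
apply: (@le_trans _ _ (vnorm a `^ (p - 2) * vnorm a)).
  by apply: ler_wpM2l => //; exact: powR_ge0.
have [->|a0] := eqVneq (vnorm a) 0; first by rewrite mulr0 powR_ge0.
rewrite -[X in _ * X]powRr1 ?vnorm_ge0// -powRD ?a0 ?implybT//.
by rewrite (_ : p - 2 + 1 = p - 1)//; ring.
Qed.

Lemma flux0 (p : R) (a : 'I_n -> R) j : (forall i, a i = 0) -> flux p a j = 0.
Proof. by move=> a0; rewrite /flux a0 mulr0. Qed.

Lemma measurable_flux (p : R) (F : 'I_n -> V -> R) j : (forall i, meas (F i)) ->
  meas (fun x => flux p (fun i => F i x) j).
Proof.
move=> mF; apply: measurable_funM => //.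
apply: (measurableT_comp (measurable_powR _)).
apply: (measurableT_comp (continuous_measurable_fun (@sqrt_continuous R))).
by apply: measurable_sum => i; exact: measurable_funX.
Qed.

Lemma vnorm_le_sum (a : 'I_n -> R) : vnorm a <= \sum_(j <- enum 'I_n) `|a j|.
Proof.
have S0 : 0 <= \sum_(j < n) `|a j| by apply: sumr_ge0.
rewrite big_enum /vnorm -[leRHS]ger0_norm// -sqrtr_sqr; apply: ler_wsqrtr.
rewrite expr2 mulr_suml; apply: ler_sum => j _.
rewrite -real_normK ?num_real// expr2; apply: ler_wpM2l => //.
by rewrite (bigD1 j)//= lerDl sumr_ge0.
Qed.

Lemma is_derive_reflect (f : V -> R) (x z : V) j d : is_derive (x - z) 'e_j f d ->
  is_derive z 'e_j (fun z => f (x - z)) (- d).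
Proof.
move=> /is_derive1P fd; apply/is_derive1P.
have -> : (fun h : R => f (x - (h *: 'e_j + z))) =
    (fun h : R => f (h *: 'e_j + (x - z))) \o (fun h : R => - h).
  by apply/funext => h /=; congr f; rewrite scaleNr opprD addrCA.
have dN : is_derive (0 : R) (1 : R) (fun h : R => - h) (-1).
  exact: is_deriveNid.
have fd' : is_derive (- (0 : R)) (1 : R) (fun h : R => f (h *: 'e_j + (x - z))) d.
  by rewrite oppr0.
have := @is_derive1_comp _ _ _ (0 : R) _ _ fd' dN.
by rewrite mulrN1.
Qed.

Lemma integ_Lp (p : R) (K : set V) (f : V -> R) : 1 <= p -> measurable (K : set MV) ->
  (vol K < +oo)%E -> meas f -> (forall x, ~ K x -> f x = 0) ->
  integ (fun x => `|f x| `^ p) -> integ f.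
Proof.
move=> p1 mK fK mf f0 fi.
apply: (integ_le mf (integD fi (integ_indic mK fK))) => x.
have [Kx|Kx] := pselect (K x); last first.
  by rewrite (f0 x Kx) ?normr0 addr_ge0 ?powR_ge0.
rewrite indicE mem_set//.
have [f1|f1] := leP `|f x| 1; first by rewrite ler_wpDl ?powR_ge0.
by rewrite ler_wpDr// le1r_powR// ltW.
Qed.

(** [S] vanishes almost everywhere, hence so does [T]. This carries the almost everywhere equality
    of the two gradients without naming the exceptional set. *)
Lemma rint_ae0 (S T : V -> R) : integ S -> (forall x, 0 <= S x) -> rint S <= 0 ->
  meas T -> (forall x, S x = 0 -> T x = 0) -> rint T = 0.
Proof.
move=> Si S0 S_le mT ST; have mS := integ_meas Si.
have S_eq : rint S = 0 by apply/eqP; rewrite eq_le S_le rint_ge0.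
have [+ _] := @ae_eq_integral_abs _ MV R vol setT measurableT (EFin \o S)
  (iffRL (measurable_EFinP _ _) mS).
under eq_integral => x _ do rewrite /= ger0_norm//.
rewrite [X in X = _ -> _](_ : _ = (rint S)%:E); last exact: rintE.
rewrite S_eq => /(_ erefl) ae0.
have aeT : ae_eq vol setT (EFin \o T) (cst 0%E).
  by apply: filterS ae0 => x /= + _ => /(_ I) [] /ST ->.
rewrite /rint /Rintegral (ae_eq_integral (cst 0%E) _ _ _ _ aeT)//.
  by rewrite integral0.
exact/measurable_EFinP.
Qed.

(** * Comparison by contradiction: h exceeds v at [x1] *)

Variables (p : R) (D : set V) (h v : V -> R) (dv G : 'I_n -> V -> R) (x1 : V) (j0 : 'I_n).
Hypotheses (p2 : 2 <= p) (oD : open D) (cD : compact (closure D)).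
Hypothesis ch : {within closure D, continuous h}.
Hypothesis cv : continuous v.
Hypothesis cdv : forall j, continuous (dv j).
Hypothesis dvE : forall j x, is_derive x 'e_j v (dv j x).
Hypothesis bd : forall x, closure D x -> ~ D x -> h x < v x.
Hypothesis mG : forall j, meas (G j).
Hypothesis GLp : forall j, Lploc p D (G j).
Hypothesis Gw : forall phi, test_fun D phi -> forall j,
  Defs.sintegral (fun x => h x * pd j phi x) = (- Defs.sintegral (fun x => (G j x * phi x)%R))%E.
Hypothesis Gh : forall phi, test_fun D phi ->
  Defs.sintegral (fun x => powR (Defs.gnorm G x) (p - 2) * \sum_(j < n) G j x * pd j phi x) = 0%E.
Hypothesis wsup : weak_super p dv.
Hypotheses (Dx1 : D x1) (hx1 : v x1 < h x1).

Let g := excess D h v.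
(** Half the excess at [x1], so g(x1) = 2c. Test functions come from values above c of the mollified
    excess; they live on [K2], where g >= c/2, and the mollifier then reaches only [K], where g >=
    c/4. Both steps lose at most c/4, the oscillation of g at a [good] scale. *)
Let c := (h x1 - v x1) / 2.
Let K : set V := [set x | c / 4 <= g x].

Let c0 : 0 < c. Proof. by rewrite divr_gt0// subr_gt0. Qed.
Let c4 : 0 < c / 4. Proof. by rewrite divr_gt0. Qed.

Let cg : continuous g. Proof. exact: continuous_excess. Qed.

Let gD x : K x -> D x /\ g x = h x - v x.
Proof. by move=> Kx; apply: excess_gt0; exact: lt_le_trans c4 Kx. Qed.

Let Kclosed : closed K.
Proof.
apply: (@closed_comp _ _ g [set y | c / 4 <= y]) => [x _|]; first exact: cg.
exact: closed_ge.
Qed.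

Let r_spec : exists r : R, vanish_off r g. Proof. exact: excess_vanish. Qed.
Let r := sval (cid r_spec).
Let gr : vanish_off r g. Proof. exact: svalP (cid r_spec). Qed.

Let Kr x : K x -> `|x| <= r.
Proof.
by move=> Kx; rewrite leNgt; apply/negP => /gr gx; move: Kx; rewrite /K /= gx leNgt c4.
Qed.

Let Kcompact : compact K.
Proof.
have sub : K `<=` [set x : V | `|x| <= r] by move=> x; exact: Kr.
exact: (subclosed_compact Kclosed (@compact_norm_le R n r) sub).
Qed.

Let KD : K `<=` D. Proof. by move=> x /gD[]. Qed.

Let mK : measurable (K : set MV). Proof. exact: measurable_closed. Qed.

Let volK : (vol K < +oo)%E.
Proof.
have r0 : 0 < `|r| + 1 by rewrite ltr_wpDl.
have mB : measurable (ball (0 : V) (`|r| + 1) : set MV).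
  by apply: measurable_open; exact: ball_open.
apply: (@le_lt_trans _ _ (vol (ball (0 : V) (`|r| + 1)))); last by rewrite volume_ball// ltry.
apply: le_measure; rewrite ?inE// => x /Kr xr.
by rewrite -ball_normE /= sub0r normrN (le_lt_trans xr)// (le_lt_trans (ler_norm r))// ltrDl.
Qed.

(** [G] is only locally in L^p of D. Cut off to the compact set [K], it is globally in L^p, and test
    functions supported in [K] do not see the cut. *)
Let G' j x := \1_K x * G j x.
Let d' j x := \1_K x * dv j x.
Let Gam j x := G' j x - d' j x.

Let off0 (f : V -> R) x : ~ K x -> \1_K x * f x = 0.
Proof. by move=> nK; rewrite indicE memNset// mul0r. Qed.

Let on1 (f : V -> R) x : K x -> \1_K x * f x = f x.
Proof. by move=> Kx; rewrite indicE mem_set// mul1r. Qed.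

Let vanishK (f : V -> R) : (forall x, ~ K x -> f x = 0) -> vanish_off r f.
Proof. by move=> f0 x rx; apply: f0 => /Kr; rewrite leNgt rx. Qed.

Let mG' j : meas (G' j).
Proof. by apply: measurable_funM => //; exact: measurable_indic. Qed.

Let md' j : meas (d' j).
Proof. by apply: measurable_funM; [exact: measurable_indic|exact: continuous_borel]. Qed.

Let p0 : 0 < p. Proof. exact: lt_le_trans p2. Qed.
Let p1 : 1 <= p. Proof. by apply: le_trans p2; rewrite ler1n. Qed.

Let G'p j : integ (fun x => `|G' j x| `^ p).
Proof.
have E x : `|G' j x| `^ p = \1_K x * `|G j x| `^ p.
  have [Kx|Kx] := pselect (K x); first by rewrite /G' (on1 (G j)) ?(on1 (fun x => `|G j x| `^ p)).
  by rewrite /G' (off0 (G j)) ?(off0 (fun x => `|G j x| `^ p))// normr0 powR0 ?gt_eqF.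
apply: integ_fin.
- by apply: (measurableT_comp (measurable_powR _)); exact: measurableT_comp.
- by move=> x; exact: powR_ge0.
have := GLp j Kcompact KD; rewrite nnintegralE; first by under eq_integral do rewrite E.
- by move=> x; rewrite lee_fin mulr_ge0 ?powR_ge0.
- apply/measurable_EFinP; apply: measurable_funM; first exact: measurable_indic.
  by apply: (measurableT_comp (measurable_powR _)); exact: measurableT_comp.
Qed.

Let d'bdd j : exists C : R, 0 <= C /\ forall x, `|d' j x| <= C.
Proof.
have cn : continuous (fun x => `|dv j x|).
  by move=> x; apply: continuous_comp; [exact: cdv|exact: norm_continuous].
have [K0|/set0P K0] := eqVneq K set0.
  by exists 0; split => // x; rewrite /d' off0 ?normr0// K0.
have [y /= _ ymax] := EVT_max_rV K0 Kcompact (continuous_subspaceT cn).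
exists `|dv j y|; split => // x.
have [Kx|Kx] := pselect (K x); last by rewrite /d' off0// normr0.
by rewrite /d' on1//; apply: ymax; rewrite inE.
Qed.

Let d'p j : integ (fun x => `|d' j x| `^ p).
Proof.
have [C [C0 dC]] := d'bdd j.
apply: (@integ_bdd _ _ _ (C `^ p) r).
- by apply: (measurableT_comp (measurable_powR _)); exact: measurableT_comp.
- move=> x; rewrite ger0_norm ?powR_ge0//.
  by apply: ge0_ler_powR; rewrite ?nnegrE ?(ltW p0).
- by apply: vanishK => x nK; rewrite /d' off0// normr0 powR0// gt_eqF.
Qed.

Let iG' j : integ (G' j).
Proof. exact: (integ_Lp p1 mK volK (@mG' j) (@off0 (G j)) (@G'p j)). Qed.

Let id' j : integ (d' j).
Proof. exact: (integ_Lp p1 mK volK (@md' j) (@off0 (dv j)) (@d'p j)). Qed.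

Let iGam j : integ (Gam j). Proof. exact: integB. Qed.

Let Gam_off j x : ~ K x -> Gam j x = 0.
Proof. by move=> nK; rewrite /Gam /G' /d' !off0// subrr. Qed.

Let Gamp j : integ (fun x => `|Gam j x| `^ p).
Proof.
apply: (integ_le _ (integZ (2 `^ p) (integD (G'p j) (d'p j)))) => [|x].
  by apply: (measurableT_comp (measurable_powR _)); apply: measurableT_comp => //; exact: integ_meas (iGam j).
by rewrite ger0_norm ?powR_ge0//; exact: powR_norm_sub.
Qed.

Let b j x := flux p (fun i => G' i x) j - flux p (fun i => d' i x) j.
(** A common majorant of the two gradients. The factor 2 lets a^(p-1) bound the sum of both flux
    sizes: 2 S^(p-1) <= (2 S)^(p-1) because p - 1 >= 1. *)
Let a x : R := \sum_(j <- enum 'I_n) `|2 * (`|G' j x| + `|d' j x|)|.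

Let a0 x : 0 <= a x. Proof. exact: sumr_ge0. Qed.

Let maj j : meas (fun x => 2 * (`|G' j x| + `|d' j x|)).
Proof. by apply: measurable_funM => //; apply: measurable_funD; exact: measurableT_comp. Qed.

Let ma : meas a.
Proof. by apply: measurable_sum => j; apply: measurableT_comp => //; exact: maj. Qed.

Let ai : integ (fun x => a x `^ p).
Proof.
apply: integ_powR_sum => // j.
apply: (integ_le _ (integZ (2 `^ p) (integZ (2 `^ p) (integD (G'p j) (d'p j))))) => [|x].
  by apply: (measurableT_comp (measurable_powR _)); apply: measurableT_comp.
rewrite ger0_norm ?powR_ge0// normrM (@ger0_norm _ 2)// powRM//.
apply: ler_wpM2l; first exact: powR_ge0.
have := powR_norm_sub p2 `|G' j x| (- `|d' j x|).
by rewrite opprK normrN !normr_id.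
Qed.

Let a_ge x : vnorm (fun i => G' i x) `^ (p - 1) + vnorm (fun i => d' i x) `^ (p - 1) <=
  a x `^ (p - 1).
Proof.
pose S := \sum_(j <- enum 'I_n) (`|G' j x| + `|d' j x|).
have S0 : 0 <= S by apply: sumr_ge0 => i _; exact: addr_ge0.
have aS : a x = 2 * S.
  rewrite /a /S mulr_sumr; apply: eq_bigr => i _.
  by rewrite normrM (@ger0_norm _ 2)// ger0_norm// addr_ge0.
have q1 : 1 <= p - 1 by move: p2; lra.
have q0 : 0 <= p - 1 by apply: le_trans q1.
have le1 : vnorm (fun i => G' i x) <= S.
  by apply: le_trans (vnorm_le_sum _) _; apply: ler_sum => i _; rewrite lerDl.
have le2 : vnorm (fun i => d' i x) <= S.
  by apply: le_trans (vnorm_le_sum _) _; apply: ler_sum => i _; rewrite lerDr.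
have pw t : 0 <= t -> t <= S -> t `^ (p - 1) <= S `^ (p - 1).
  by move=> t0 tS; apply: ge0_ler_powR; rewrite ?nnegrE.
apply: le_trans (lerD (pw _ (vnorm_ge0 _) le1) (pw _ (vnorm_ge0 _) le2)) _.
rewrite aS powRM// -mulr2n -[leLHS]mulr_natl; apply: ler_wpM2r; first exact: powR_ge0.
by rewrite le1r_powR// ler1n.
Qed.

Let a_off x : ~ K x -> a x = 0.
Proof.
move=> nK; rewrite /a big1// => j _.
by rewrite /G' /d' !off0// normr0 addr0 mulr0 normr0.
Qed.

Let integ_a (f : V -> R) : meas f -> (forall x, `|f x| <= a x `^ (p - 1)) -> integ f.
Proof.
move=> mf fa; apply: (integ_le mf (integD ai (integ_indic mK volK))) => x.
apply: le_trans (fa x) _.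
have [Kx|Kx] := pselect (K x).
  rewrite indicE mem_set//.
  (* Young with t = kappa = 1 reads a^(p-1) <= a^p + 1. *)
  have := young_powR p2 (a0 x) ler01 (lexx 1).
  by rewrite mulr1 mul1r invr1 mul1r powR1.
rewrite a_off// powR0 ?addr_ge0 ?powR_ge0//.
by rewrite gt_eqF//; move: p2; lra.
Qed.

Let flux_aG j x : `|flux p (fun i => G' i x) j| <= a x `^ (p - 1).
Proof.
apply: le_trans (a_ge x); apply: le_trans (flux_le _ _ p2) _.
by rewrite lerDl powR_ge0.
Qed.

Let flux_ad j x : `|flux p (fun i => d' i x) j| <= a x `^ (p - 1).
Proof.
apply: le_trans (a_ge x); apply: le_trans (flux_le _ _ p2) _.
by rewrite lerDr powR_ge0.
Qed.

Let iflG j : integ (fun x => flux p (fun i => G' i x) j).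
Proof. exact: (integ_a (measurable_flux p j mG') (flux_aG j)). Qed.

Let ifld j : integ (fun x => flux p (fun i => d' i x) j).
Proof. exact: (integ_a (measurable_flux p j md') (flux_ad j)). Qed.

Let ib j : integ (b j). Proof. exact: integB. Qed.

Let ba j x : `|b j x| <= a x `^ (p - 1).
Proof.
apply: le_trans (a_ge x); apply: le_trans (ler_normB _ _) _.
by apply: lerD; exact: flux_le.
Qed.

Let integ_bGam (f : V -> R) (A : V -> R) j : meas f -> (forall x, 0 <= A x) ->
  integ (fun x => A x `^ p) ->
  (forall x, `|f x| <= A x `^ (p - 1)) -> integ (fun x => f x * Gam j x).
Proof.
move=> mf A0 Ai fA; apply: (integ_le _ (integD Ai (Gamp j))) => [|x].
  by apply: measurable_funM => //; exact: (integ_meas (iGam j)).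
rewrite normrM; apply: (@le_trans _ _ (A x `^ (p - 1) * `|Gam j x|)).
  exact: ler_wpM2r.
by have := young_powR p2 (A0 x) (normr_ge0 (Gam j x)) (lexx 1); rewrite invr1 !mul1r.
Qed.

Let Gam_vanish j : vanish_off r (Gam j). Proof. by apply: vanishK => x; exact: Gam_off. Qed.

(** Used twice: with [f] the flux difference, for monotonicity, and with [f] a cut-off coordinate,
    for the final contradiction. *)
Let gam_limit (f A : V -> R) j (chi : nat -> V -> R) (chi0 : V -> R) (C : R) :
  meas f -> meas A -> (forall x, 0 <= A x) -> integ (fun x => A x `^ p) -> integ f ->
  (forall x, `|f x| <= A x `^ (p - 1)) ->
  (forall k, meas (chi k)) -> (forall k x, `|chi k x| <= C) ->
  (forall x, chi k x @[k --> \oo] --> chi0 x) ->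
  rint (fun x => chi k x * (f x * convol (mollifier (radk k)) (Gam j) x)) @[k --> \oo] -->
  rint (fun x => chi0 x * (f x * Gam j x)).
Proof.
move=> mf mA A0 Ai fi fA mchi chiC chi_cvg.
apply: (convol_pairing mf fi (iGam j) (integ_bGam j mf A0 Ai fA) _ mchi chiC chi_cvg).
exact: (small_wdiff2 p2 mA A0 Ai (iGam j) (@Gam_vanish j) (@Gamp j) mf fA).
Qed.

Let g_bdd : exists C : R, 0 <= C /\ forall x, `|g x| <= C.
Proof. exact: cont_vanish_bdd cg gr. Qed.

Let igg : integ g.
Proof.
have [C [_ gC]] := g_bdd.
exact: integ_bdd (continuous_borel cg) gC gr.
Qed.

Let gk k := convol (mollifier (radk k)) g.
Let phi k x := flat 1 (gk k x + - c).
(** With F = [flat 1], this is F'(g_k - c); it is positive exactly where g_k > c. *)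
Let chi k x := flat 'X^2 (gk k x - c).
Let chi0 x := flat 'X^2 (g x - c).

Let rk0 k : 0 < radk k :> R. Proof. exact: radk_gt0. Qed.

Let nice_gk k : nice (gk k).
Proof. exact: nice_convol (nice_mollifier _) (mollifier_vanish (rk0 k)) igg. Qed.

Let nice_phi k : nice (phi k).
Proof. by apply: nice_flat; apply: nice_add; [exact: nice_gk|exact: nice_cst]. Qed.

Let cgk k : continuous (gk k). Proof. by have [] := nice_step (nice_gk k). Qed.

Let cchi k : continuous (chi k).
Proof.
move=> x; apply: (@continuous_comp _ _ _ (fun x => gk k x - c) (flat 'X^2)).
  by apply: continuousB; [exact: cgk|exact: cst_continuous].
exact: continuous_flat.
Qed.

Let d_spec : exists d : R, 0 < d /\ forall x y, `|x - y| <= d -> `|g x - g y| < c / 4.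
Proof. exact: vanish_unif_cont cg gr c4. Qed.

Let good k : Prop := forall x y : V, `|x - y| <= radk k -> `|g x - g y| < c / 4.

Let near_good : \forall k \near \oo, good k.
Proof.
have [d [d0 gd]] := d_spec.
near=> k => x y xy; apply: gd; apply: le_trans xy _; apply: ltW.
by near: k; exact: radk_lt.
Unshelve. all: end_near. Qed.

Let gk_close k x : good k -> `|gk k x - g x| <= c / 4.
Proof. by move=> gdk; apply: convol_close (rk0 k) igg _ => z xz; apply: ltW; exact: gdk. Qed.

Let K2 : set V := [set x | c / 2 <= g x].

Let K2K x : K2 x -> K x. Proof. by rewrite /K2 /K /= => ?; move: c0; lra. Qed.

Let K2closed : closed K2.
Proof.
apply: (@closed_comp _ _ g [set y | c / 2 <= y]) => [x _|]; first exact: cg.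
exact: closed_ge.
Qed.

Let K2_gk k x : good k -> ~ K2 x -> gk k x - c <= 0.
Proof.
move=> gdk nK; have := gk_close x gdk; rewrite ler_norml => /andP[_ +].
by move: nK; rewrite /K2 /= => /negP; rewrite -ltNge; move: c0; lra.
Qed.

Let phi_off k x : good k -> ~ K2 x -> phi k x = 0.
Proof. by move=> gdk nK; rewrite /phi flat_le0//; exact: K2_gk. Qed.

Let chi_off k x : good k -> ~ K2 x -> chi k x = 0.
Proof. by move=> gdk nK; rewrite /chi flat_le0//; exact: K2_gk. Qed.

Let test_of (f : V -> R) (S : set V) : nice f -> closed S -> S `<=` K ->
  (forall x, ~ S x -> f x = 0) -> test_fun D f.
Proof.
move=> nf cS SK f0; split; first exact: nice_smooth.
have sub : closure (Defs.supp f) `<=` S.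
  rewrite [X in _ `<=` X](_ : _ = closure S); last by apply/closure_id.
  apply: closure_subset => x; rewrite /Defs.supp /= => fx.
  by apply: contrapT => nS; move: fx; rewrite f0// eqxx.
have sub' : closure (Defs.supp f) `<=` K by move=> x /sub/SK.
split; last by move=> x /sub'/KD.
by apply: (subclosed_compact _ Kcompact sub'); exact: closed_closure.
Qed.

Let test_phi k : good k -> test_fun D (phi k).
Proof.
move=> gdk; apply: (test_of (nice_phi k) K2closed) => x; first exact: K2K.
exact: phi_off.
Qed.

(** [nice] has no rule for precomposition with z |-> x - z, so the reflected mollifier is rebuilt
    from coordinates. *)
Let nice_mollifier_sub d (x : V) : nice (fun z => mollifier d (x - z)).
Proof.
apply: nice_mul; first exact: nice_cst.
apply: nice_flat; apply: nice_add; first exact: nice_cst.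
have -> : (fun z : V => - (\sum_(j < n) (x - z) 0 j ^+ 2)) =
    (fun z : V => -1 * (\sum_(j < n) (x 0 j + -1 * z 0 j) * (x 0 j + -1 * z 0 j))).
  apply/funext => z; rewrite mulN1r; congr (- _); apply: eq_bigr => j _.
  by rewrite !mxE mulN1r.
have nl j : nice (fun z : V => x 0 j + -1 * z 0 j).
  apply: nice_add; first exact: nice_cst.
  by apply: nice_mul; [exact: nice_cst|exact: nice_coord].
apply: nice_mul; first exact: nice_cst.
by apply: nice_sum => j; apply: nice_mul; exact: nl.
Qed.

(* The weak gradient of [h] and the classical gradient of [v] are both moved
   onto the mollifier; only points of [K], where [g = h - v], contribute. *)
Let key k j (rho' : V -> R) x : good k -> K2 x -> continuous rho' ->
  (forall y, is_derive y 'e_j (mollifier (radk k)) (rho' y)) ->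
  convol rho' g x = convol (mollifier (radk k)) (Gam j) x.
Proof.
move=> gdk K2x cr' r'E; set rho := mollifier (radk k).
have rv : vanish_off (radk k) rho by exact: mollifier_vanish.
have r'v := vanish_is_derive rv r'E.
(* Between [K2] and the complement of [K] the value of g drops by more than c/4, which cannot happen
   within distance [radk k] at a good scale. *)
have inK z : ~ K z -> radk k < `|x - z|.
  move=> nK; rewrite ltNge; apply/negP => /gdk; rewrite ltr_norml => /andP[_ +].
  by move: K2x nK; rewrite /K2 /K /= => ? /negP; rewrite -ltNge; move: c0; lra.
pose psi z := rho (x - z).
have npsi : nice psi by exact: nice_mollifier_sub.
have psi_off z : ~ K z -> psi z = 0 by move=> /inK; exact: rv.
have tpsi : test_fun D psi by exact: (test_of npsi Kclosed (fun _ => id) psi_off).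
have psiE z : is_derive z 'e_j psi (- rho' (x - z)) by exact: is_derive_reflect.
have pdE z : pd j psi z = - rho' (x - z) by rewrite /pd; case: (psiE z).
have cpsi : continuous psi by have [] := nice_step npsi.
have crho : continuous rho by exact: mollifier_continuous.
have cr'x : continuous (fun z : V => rho' (x - z)).
  move=> z; apply: (@continuous_comp _ _ _ (fun z : V => x - z) rho'); last exact: cr'.
  by apply: continuousB => [|y]; [exact: cst_continuous|exact: cvg_id].
have [C' [_ r'C]] := cont_vanish_bdd cr' r'v.
have [C [_ rC]] := cont_vanish_bdd crho rv.
have iv : integ (fun z => rho' (x - z) * v z).
  have cf : continuous (fun z : V => rho' (x - z) * v z).
    by move=> z; apply: continuousM; [exact: cr'x|exact: cv].
  have fv : vanish_off r (fun z : V => rho' (x - z) * v z).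
    by apply: vanishK => z /inK xz; rewrite r'v// mul0r.
  have [Cf [_ fC]] := cont_vanish_bdd cf fv.
  exact: integ_bdd (continuous_borel cf) fC fv.
have ig' : integ (fun z => rho' (x - z) * g z) by exact: integ_convol r'C igg.
have iG'r : integ (fun z => rho (x - z) * G' j z) by exact: integ_convol rC (iG' j).
have id'r : integ (fun z => rho (x - z) * d' j z) by exact: integ_convol rC (id' j).
(* The definition of the weak gradient, tested with [psi]; on [K], h is written as g + v, and
   elsewhere [psi] and its derivative vanish. The two minus signs cancel. *)
have E1 : rint (fun z => rho' (x - z) * g z) + rint (fun z => rho' (x - z) * v z) =
    rint (fun z => rho (x - z) * G' j z).
  have := Gw tpsi j.
  have -> : (fun z => h z * pd j psi z) =
      (fun z => - (rho' (x - z) * g z + rho' (x - z) * v z)).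
    apply/funext => z; rewrite pdE; have [Kz|Kz] := pselect (K z).
      by have [_ ->] := gD Kz; ring.
    by rewrite r'v ?inK//; ring.
  have -> : (fun z => G j z * psi z) = (fun z => rho (x - z) * G' j z).
    apply/funext => z; have [Kz|Kz] := pselect (K z).
      by rewrite /G' on1// mulrC.
    by rewrite psi_off// /G' off0// !mulr0.
  rewrite !sintegral_rint//; last exact/integN/integD.
  rewrite -EFinN => -[]; rewrite rintN; last exact: integD.
  by rewrite rintD// => /oppr_inj.
(* The classical counterpart for v: the integral of the derivative of v psi is zero. *)
have E2 : rint (fun z => rho (x - z) * d' j z) = rint (fun z => rho' (x - z) * v z).
  have : rint (fun z => dv j z * psi z + v z * (- rho' (x - z))) = 0.
    apply: (@rint_pd0 _ _ (fun z => v z * psi z) _ r j).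
    - by move=> z; apply: continuousM; [exact: cv|exact: cpsi].
    - have cN : continuous (fun z : V => - rho' (x - z)).
        by move=> z; exact: (cvgN (cr'x z)).
      by move=> z; exact: (cvgD (cvgM (@cdv j z) (cpsi z)) (cvgM (@cv z) (cN z))).
    - by apply: vanishK => z nK; rewrite psi_off// mulr0.
    - by move=> z; exact: is_derive_mul.
  have -> : (fun z => dv j z * psi z + v z * (- rho' (x - z))) =
      (fun z => rho (x - z) * d' j z - rho' (x - z) * v z).
    apply/funext => z; have [Kz|Kz] := pselect (K z).
      by rewrite /d' on1// /psi; ring.
    by rewrite psi_off// /d' off0//; ring.
  by rewrite rintB// => /subr0_eq.
rewrite /convol -/rho.
have -> : rint (fun z => rho (x - z) * Gam j z) =
    rint (fun z => rho (x - z) * G' j z) - rint (fun z => rho (x - z) * d' j z).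
  by rewrite -rintB//; apply: eq_rint => z; rewrite /Gam mulrBr.
by rewrite -E1 E2 addrK.
Qed.

Let dphi k j x := chi k x * convol (mollifier (radk k)) (Gam j) x.

Let cconv k j : continuous (convol (mollifier (radk k)) (Gam j)).
Proof.
have [C [_ rC]] := cont_vanish_bdd (@mollifier_continuous R n (radk k)) (mollifier_vanish (rk0 k)).
exact: convol_continuous (@mollifier_continuous R n (radk k)) rC (iGam j).
Qed.

Let cdphi k j : continuous (dphi k j).
Proof. by move=> x; exact: (cvgM (@cchi k x) (@cconv k j x)). Qed.

(** On [K2] this is the chain rule together with [key]; off [K2] the factor [chi] vanishes, so it
    does not matter that the derivative of g_k is unidentified there. *)
Let dphiE k j x : good k -> is_derive x 'e_j (phi k) (dphi k j x).
Proof.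
move=> gdk.
have [crho /(_ j)[rho' [_ cr' r'E]]] := nice_step (@nice_mollifier R n (radk k)).
have rv : vanish_off (radk k) (mollifier (radk k) : V -> R) by exact: mollifier_vanish.
have [C [_ rC]] := cont_vanish_bdd crho rv.
have [C' [_ r'C]] := cont_vanish_bdd cr' (vanish_is_derive rv r'E).
have gkE := is_derive_convol crho rC r'E r'C igg x.
have gkE' := is_derive_add gkE (is_derive_cst (- c) x 'e_j).
have := is_derive_chain gkE' (is_derive_flat1 _); rewrite addr0 => dE.
apply: (is_derive_eq dE); rewrite /dphi.
have [K2x|K2x] := pselect (K2 x); first by rewrite (key gdk K2x cr' r'E).
by rewrite -/(gk k x) -/(chi k x) (chi_off gdk K2x) !mul0r.
Qed.

Let dphi_off k j x : good k -> ~ K x -> dphi k j x = 0.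
Proof. by move=> gdk nK; rewrite /dphi chi_off ?mul0r// => /K2K. Qed.

Let dphi_bdd k j : good k -> exists C : R, 0 <= C /\ forall x, `|dphi k j x| <= C.
Proof.
by move=> gdk; apply: (cont_vanish_bdd (@cdphi k j) (r := r)); apply: vanishK => x; exact: dphi_off.
Qed.

Let integ_dphi k j (f : V -> R) : good k -> integ f -> integ (fun x => f x * dphi k j x).
Proof.
move=> gdk fi; have [C [_ dC]] := dphi_bdd j gdk.
rewrite (_ : (fun x => f x * _) = (fun x => dphi k j x * f x)); last first.
  by apply/funext => x; rewrite mulrC.
exact: integM_bdd fi (continuous_borel (@cdphi k j)) dC.
Qed.

Let sumGh k : good k -> \sum_j rint (fun x => flux p (fun i => G' i x) j * dphi k j x) = 0.
Proof.
move=> gdk; have := Gh (test_phi gdk).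
have -> : (fun x => Defs.gnorm G x `^ (p - 2) * \sum_(j < n) G j x * pd j (phi k) x) =
    (fun x => \sum_j flux p (fun i => G' i x) j * dphi k j x).
  apply/funext => x; rewrite mulr_sumr; apply: eq_bigr => j _.
  have -> : pd j (phi k) x = dphi k j x by rewrite /pd; case: (dphiE j x gdk).
  have [Kx|Kx] := pselect (K x); last by rewrite dphi_off// !mulr0.
  have -> : Defs.gnorm G x = vnorm (fun i => G' i x).
    by rewrite /Defs.gnorm /vnorm; under [in RHS]eq_bigr do rewrite /G' on1//.
  by rewrite /flux {3}/G' on1// mulrA.
have ij j := integ_dphi j gdk (iflG j).
rewrite sintegral_rint; last exact: integ_sum.
by rewrite rint_sum// => -[].
Qed.

Let sum_wsup k : good k -> 0 <= \sum_j rint (fun x => flux p (fun i => d' i x) j * dphi k j x).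
Proof.
move=> gdk.

have pv : vanish_off r (phi k).
  by apply: vanishK => x nK; apply: phi_off => // /K2K.
have pge x : 0 <= phi k x.
  rewrite /phi; have [t0|t0] := leP (gk k x + - c) 0; first by rewrite flat_le0.
  exact/ltW/flat1_gt0.
have := wsup (nice_step (nice_phi k)).1 (@cdphi k) pv pge (fun j x => dphiE j x gdk).
congr (_ <= _); apply: eq_bigr => j _; apply: eq_rint => x.
have [Kx|Kx] := pselect (K x); last by rewrite dphi_off// !mulr0.
by have -> : (fun i => d' i x) = (fun i => dv i x) by apply/funext => i; rewrite /d' on1.
Qed.

(** Difference of the p-harmonic equation and the supersolution inequality, both tested with
    [phi k]. *)
Let sum_neg k : good k ->
  \sum_j rint (fun x => chi k x * (b j x * convol (mollifier (radk k)) (Gam j) x)) <= 0.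
Proof.
move=> gdk; have s0 := sum_wsup gdk.
have -> : \sum_j rint (fun x => chi k x * (b j x * convol (mollifier (radk k)) (Gam j) x)) =
    \sum_j rint (fun x => flux p (fun i => G' i x) j * dphi k j x) -
    \sum_j rint (fun x => flux p (fun i => d' i x) j * dphi k j x).
  rewrite -sumrB; apply: eq_bigr => j _; rewrite -rintB; last 2 first.
  - exact: integ_dphi gdk (iflG j).
  - exact: integ_dphi gdk (ifld j).
  by apply: eq_rint => x; rewrite /b /dphi; ring.
by rewrite sumGh// sub0r oppr_le0.
Qed.

Let gk_cvg x : gk k x @[k --> \oo] --> g x.
Proof.
apply/cvgrPdist_le => e e0.
have [d [d0 gd]] := vanish_unif_cont cg gr e0.
near=> k; rewrite distrC; apply: convol_close (rk0 k) igg _ => z xz; apply/ltW/gd.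
by apply: le_trans xz _; apply: ltW; near: k; exact: radk_lt.
Unshelve. all: end_near. Qed.

Let flat_gk_cvg q x : flat q (gk k x - c) @[k --> \oo] --> flat q (g x - c).
Proof.
apply: (@continuous_cvg _ _ _ _ _ _ (flat q) (g x - c)); first exact: continuous_flat.
by apply: cvgB; [exact: gk_cvg|exact: cvg_cst].
Qed.

Let mchi k : meas (chi k). Proof. exact: continuous_borel (@cchi k). Qed.

Let S x := \sum_j chi0 x * (b j x * Gam j x).

Let mchi0 : meas chi0.
Proof.
apply: continuous_borel => x; apply: (@continuous_comp _ _ _ (fun x => g x - c) (flat 'X^2)).
  by apply: continuousB; [exact: cg|exact: cst_continuous].
exact: continuous_flat.
Qed.

Let Sint j : integ (fun x => chi0 x * (b j x * Gam j x)).
Proof.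
have [C [_ fC]] := @flat_bdd R 'X^2.
apply: integM_bdd (integ_bGam j (integ_meas (ib j)) a0 ai (ba j)) mchi0 (fun x => fC _).
Qed.

Let S_ge0 x : 0 <= S x.
Proof.
rewrite /S -mulr_sumr; apply: mulr_ge0.
  rewrite /chi0; have [t0|t0] := leP (g x - c) 0; first by rewrite flat_le0.
  exact/ltW/flatX2_gt0.
apply: le_trans (pflux_monotone (fun i => G' i x) (fun i => d' i x) p2).
by apply: mulr_ge0; [rewrite divr_ge0// addr_ge0 ?powR_ge0|apply: sumr_ge0 => j _; exact: sqr_ge0].
Qed.

Let S_le0 : rint S <= 0.
Proof.
rewrite rint_sum//.
have [C [_ fC]] := @flat_bdd R 'X^2.
pose u k : R := \sum_j rint (fun x => chi k x * (b j x * convol (mollifier (radk k)) (Gam j) x)).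
have u_cvg : u k @[k --> \oo] --> \sum_j rint (fun x => chi0 x * (b j x * Gam j x)).
  have lim x : chi k x @[k --> \oo] --> chi0 x by exact: flat_gk_cvg.
  have chiC k x : `|chi k x| <= C by exact: fC.
  have cj j := @gam_limit _ _ j _ _ _ (integ_meas (ib j)) ma a0 ai (ib j) (ba j) mchi chiC lim.
  exact: (@cvg_big _ _ +%R 0 xpredT (@add_continuous R) nat \oo (index_enum 'I_n) _ _ _ (fun j _ => cj j)).
apply: (cvgr_to_le u_cvg); near=> k; apply: sum_neg; near: k; exact: near_good.
Unshelve. all: end_near. Qed.

(** [S] is [chi0] times the monotonicity pairing; when the pairing is zero, injectivity of the flux
    equates the gradients. *)
Let S_Gam x j : S x = 0 -> chi0 x * Gam j x = 0.
Proof.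
rewrite /S -mulr_sumr => /eqP; rewrite mulf_eq0 => /orP[/eqP->|/eqP s0]; first by rewrite mul0r.
have /(_ j) E := @pflux_inj R n p (fun i => G' i x) (fun i => d' i x) p2 (eq_ind_r (fun t => t <= 0) (lexx 0) s0).
by rewrite /Gam E subrr mulr0.
Qed.

Let f0 x : R := \1_K x * x 0 j0.
(** A constant at least 1 on [K], so that |f0| <= A0 <= A0^(p-1) there and [f0] meets the growth
    condition of [gam_limit]. *)
Let A0 x : R := \1_K x * (`|r| + 1).

Let mf0 : meas f0.
Proof. by apply: measurable_funM; [exact: measurable_indic|exact: measurable_coord]. Qed.

Let A0i : integ (fun x => A0 x `^ p).
Proof.
apply: (@integ_bdd _ _ _ ((`|r| + 1) `^ p) r).
- apply: (measurableT_comp (measurable_powR _)).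
  by apply: measurable_funM => //; exact: measurable_indic.
- move=> x; rewrite ger0_norm ?powR_ge0//; have [Kx|Kx] := pselect (K x).
    by rewrite /A0 on1.
  by rewrite /A0 (off0 (fun=> `|r| + 1))// powR0 ?powR_ge0// gt_eqF.
- by apply: vanishK => x nK; rewrite /A0 (off0 (fun=> `|r| + 1))// powR0// gt_eqF.
Qed.

Let f0_le x : `|f0 x| <= `|r| + 1.
Proof.
have [Kx|Kx] := pselect (K x); last by rewrite /f0 (off0 (fun x => x 0 j0))// normr0 addr_ge0.
rewrite /f0 (on1 (fun x => x 0 j0))//; apply: le_trans (coord_le_norm x j0) _.
by apply: le_trans (Kr Kx) _; apply: le_trans (ler_norm r) _; rewrite lerDl.
Qed.

Let f0i : integ f0.
Proof.
apply: (integ_bdd mf0 f0_le (r := r)); apply: vanishK => x nK.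
by rewrite /f0 (off0 (fun x => x 0 j0)).
Qed.

Let f0A x : `|f0 x| <= A0 x `^ (p - 1).
Proof.
have [Kx|Kx] := pselect (K x); last first.
  by rewrite /f0 (off0 (fun x => x 0 j0))// normr0 powR_ge0.
apply: le_trans (f0_le x) _; rewrite /A0 (on1 (fun=> `|r| + 1))//.
by apply: le1r_powR; [rewrite lerDr|move: p2; lra].
Qed.

(** The limit is the integral of chi0 f0 Gam_j0, whose integrand vanishes wherever [S] does, that is
    almost everywhere. *)
Let lim_grad : rint (fun x => chi k x * (f0 x * convol (mollifier (radk k)) (Gam j0) x))
  @[k --> \oo] --> 0.
Proof.
have [C [_ fC]] := @flat_bdd R 'X^2.
have mA0 : meas A0 by apply: measurable_funM => //; exact: measurable_indic.
have A0_ge x : 0 <= A0 x by rewrite mulr_ge0 ?addr_ge0// indicE.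
have lim x : chi k x @[k --> \oo] --> chi0 x by exact: flat_gk_cvg.
have chiC k x : `|chi k x| <= C by exact: fC.
have := @gam_limit _ _ j0 _ _ _ mf0 mA0 A0_ge A0i f0i f0A mchi chiC lim.
suff -> : rint (fun x => chi0 x * (f0 x * Gam j0 x)) = 0 by [].
apply: (@rint_ae0 S) => //; [exact: integ_sum| |].
  apply: measurable_funM => //; apply: measurable_funM => //; exact: integ_meas (iGam j0).
by move=> x /S_Gam - /(_ j0) E; rewrite mulrCA E mulr0.
Qed.

Let phi_grad k : good k -> rint (phi k) =
  - rint (fun x => chi k x * (f0 x * convol (mollifier (radk k)) (Gam j0) x)).
Proof.
move=> gdk.
have cphi := (nice_step (nice_phi k)).1.
have pv : vanish_off r (phi k).
  by apply: vanishK => x nK; apply: phi_off => // /K2K.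
have [C [_ pC]] := cont_vanish_bdd cphi pv.
have ip : integ (phi k) by exact: integ_bdd (continuous_borel cphi) pC pv.
have cx : continuous (fun x : V => x 0 j0) by exact: coord_continuous.
have E : rint (fun x => 1 * phi k x + x 0 j0 * dphi k j0 x) = 0.
  apply: (@rint_pd0 _ _ (fun x => x 0 j0 * phi k x) _ r j0).
  - by move=> x; exact: (cvgM (cx x) (cphi x)).
  - have c1 : continuous (fun x => 1 * phi k x).
      by under eq_fun do rewrite mul1r.
    by move=> x; exact: (cvgD (c1 x) (cvgM (cx x) (@cdphi k j0 x))).
  - by move=> x rx; rewrite pv// mulr0.
  - move=> x; apply: is_derive_mul; last exact: dphiE.
    by have := @is_derive_coord R n x j0 j0; rewrite eqxx.
have fE : (fun x => 1 * phi k x + x 0 j0 * dphi k j0 x) =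
    (fun x => phi k x + chi k x * (f0 x * convol (mollifier (radk k)) (Gam j0) x)).
  apply/funext => x; have [Kx|Kx] := pselect (K x).
    by rewrite /f0 (on1 (fun x => x 0 j0))// /dphi; ring.
  by rewrite dphi_off// /f0 (off0 (fun x => x 0 j0))//; ring.
apply/eqP; rewrite -addr_eq0 -rintD//; first by rewrite -fE E.
have := integ_dphi j0 gdk f0i.
rewrite (_ : (fun x => f0 x * dphi k j0 x) =
  (fun x => chi k x * (f0 x * convol (mollifier (radk k)) (Gam j0) x)))//.
by apply/funext => x; rewrite /dphi; ring.
Qed.

(** The integral of [phi k] over [K] tends to 0 by [phi_grad] and [lim_grad], but also to the
    integral of F(g - c), which is positive because g(x1) > c. *)
Lemma comparison_contra : False.
Proof.
have [C [C0 fC]] := @flat_bdd R 1.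
have c_pos : 0 < rint (fun x => flat 1 (g x - c)).
  have cf : continuous (fun x => flat 1 (g x - c)).
    move=> x; apply: (@continuous_comp _ _ _ (fun x => g x - c) (flat 1)).
      by apply: continuousB; [exact: cg|exact: cst_continuous].
    exact: continuous_flat.
  have fv : vanish_off r (fun x => flat 1 (g x - c)).
    by move=> x rx; rewrite flat_le0// gr// sub0r oppr_le0 ltW.
  apply: (rint_gt0 (x := x1) cf).
  - move=> x; have [t0|t0] := leP (g x - c) 0; first by rewrite flat_le0.
    exact/ltW/flat1_gt0.
  - exact: integ_bdd (continuous_borel cf) (fun x => fC _) fv.
  apply: flat1_gt0; have -> : g x1 = h x1 - v x1.
    by rewrite /g /excess asboolT// max_l// subr_ge0 ltW.
  by rewrite /c; move: hx1; lra.
(* The indicator supplies a majorant valid for every k; at good scales [phi k] vanishes off [K]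
   anyway. *)
have l1 : rint (fun x => \1_K x * phi k x) @[k --> \oo] -->
    rint (fun x => \1_K x * flat 1 (g x - c)).
  apply: (@rint_dct _ MV R vol (fun k x => \1_K x * phi k x)
    (fun x => \1_K x * flat 1 (g x - c)) (fun x => C * \1_K x)).
  - move=> k; apply: measurable_funM; first exact: measurable_indic.
    exact: continuous_borel (nice_step (nice_phi k)).1.
  - exact: (integZ C (integ_indic mK volK)).
  - move=> x; apply: (@cvgM _ _ _ _ (fun=> \1_K x) (fun k => phi k x)); [exact: cvg_cst|exact: flat_gk_cvg].
  - move=> k x; rewrite normrM mulrC (@ger0_norm _ (\1_K x)); last by rewrite indicE.
    by apply: ler_wpM2r; [rewrite indicE|exact: fC].
have l2 : rint (fun x => \1_K x * phi k x) @[k --> \oo] --> 0.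
  pose w k : R := - rint (fun x => chi k x * (f0 x * convol (mollifier (radk k)) (Gam j0) x)).
  have L : w k @[k --> \oo] --> 0 by rewrite -oppr0; exact: cvgN lim_grad.
  apply: cvg_trans L; apply: near_eq_cvg; near=> k; rewrite /w.
  have gdk : good k by near: k; exact: near_good.
  rewrite -(phi_grad gdk); apply: eq_rint => x.
  have [Kx|Kx] := pselect (K x); first by rewrite (on1 (phi k)).
  by rewrite (off0 (phi k))// phi_off// => /K2K.
have E : rint (fun x => \1_K x * flat 1 (g x - c)) = 0 by exact: (cvg_unique _ l1 l2).
have E' : rint (fun x => flat 1 (g x - c)) = rint (fun x => \1_K x * flat 1 (g x - c)).
  apply: eq_rint => x; have [Kx|Kx] := pselect (K x).
    by rewrite (on1 (fun x => flat 1 (g x - c))).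
  rewrite (off0 (fun x => flat 1 (g x - c)))// flat_le0//.
  by move: Kx; rewrite /K /= => /negP; rewrite -ltNge; move: c0; lra.
by move: c_pos; rewrite E' E ltxx.
Unshelve. all: end_near. Qed.
End Comparison.

(** Strict inequality on the boundary lets the excess extend continuously by zero; the caller pays
    for it with a small constant. *)
Lemma comparison {R : realType} {n : nat} (p : R) (D : set 'rV[R]_n) (h v : 'rV[R]_n -> R)
    (dv : 'I_n -> 'rV[R]_n -> R) : (0 < n)%N -> 2 <= p -> open D -> compact (closure D) ->
  {within closure D, continuous h} -> p_harmonic p D h ->
  continuous v -> (forall j, continuous (dv j)) ->
  (forall j x, is_derive x (delta_mx 0 j) v (dv j x)) -> weak_super p dv ->
  (forall x, closure D x -> ~ D x -> h x < v x) ->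
  forall x, D x -> h x <= v x.
Proof.
move=> n0 p2 oD cD ch [_ [_ [G [GE [Gw Gh]]]]] cv cdv dvE wsup bd x Dx.
rewrite leNgt; apply/negP => hx.
have mG j : measurable_fun setT (G j : borel R n -> R) by apply: meas_borel_fun; case: (GE j).
apply: (@comparison_contra R n p D h v dv G x (Ordinal n0)) => //.
by move=> j; case: (GE j).
Qed.

(** * The dominative inequality *)

Section Dominative.
Context {R : realType} {n : nat}.
Local Notation V := 'rV[R]_n.
Local Notation MV := (borel R n).
Local Notation vol := (@volume R n).
Local Notation integ := (real_integrable vol).
Local Notation rint := (real_integral vol).
Local Notation "''e_' j" := (delta_mx 0 j : V) (at level 8, j at level 2, format "''e_' j").

Lemma cont_mul (f g : V -> R) : continuous f -> continuous g -> continuous (fun x => f x * g x).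
Proof. by move=> cf cg x; exact: (cvgM (cf x) (cg x)). Qed.

Lemma cont_add (f g : V -> R) : continuous f -> continuous g -> continuous (fun x => f x + g x).
Proof. by move=> cf cg x; exact: (cvgD (cf x) (cg x)). Qed.

Lemma cont_cst (c : R) : continuous (fun _ : V => c).
Proof. exact: cst_continuous. Qed.

Lemma cont_mull (c : R) (f : V -> R) : continuous f -> continuous (fun x => c * f x).
Proof. by move=> cf; apply: cont_mul => //; exact: cont_cst. Qed.

Lemma cont_sum (I : Type) (s : seq I) (f : I -> V -> R) : (forall i, continuous (f i)) ->
  continuous (fun x => \sum_(i <- s) f i x).
Proof.
move=> cf; elim: s => [|i s IH].
  by under [X in continuous X]eq_fun do rewrite big_nil; exact: cont_cst.
by under [X in continuous X]eq_fun do rewrite big_cons; exact: cont_add.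
Qed.

Lemma is_derive_bigsum (I : Type) (s : seq I) (f d : I -> V -> R) (x v : V) :
  (forall i, is_derive x v (f i) (d i x)) ->
  is_derive x v (fun x => \sum_(i <- s) f i x) (\sum_(i <- s) d i x).
Proof.
move=> fd; elim: s => [|i s IH].
  under [X in is_derive _ _ X]eq_fun do rewrite big_nil.
  by rewrite big_nil; exact: is_derive_cst.
under [X in is_derive _ _ X]eq_fun do rewrite big_cons.
by rewrite big_cons; exact: is_derive_add.
Qed.

Lemma powR_continuous_gt0 (a t : R) : 0 < t -> {for t, continuous (fun t => t `^ a)}.
Proof.
by move=> t0; apply/differentiable_continuous/derivable1_diffP; case: (is_derive1_powR a t0).
Qed.

Lemma cont_powR (f : V -> R) a : continuous f -> (forall x, 0 < f x) ->
  continuous (fun x => f x `^ a).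
Proof.
move=> cf f0 x; apply: (@continuous_comp _ _ _ f (fun t => t `^ a)); first exact: cf.
exact: powR_continuous_gt0.
Qed.

Lemma is_derive_powR_gt0 (f : V -> R) x v d a : is_derive x v f d -> 0 < f x ->
  is_derive x v (fun x => f x `^ a) (a * f x `^ (a - 1) * d).
Proof. by move=> fd f0; have := is_derive_chain fd (is_derive1_powR a f0). Qed.

(* The defining inequality of the dominative p-Laplacian: unlike the p-Laplacian
   it is preserved by sums, and it forces the p-Laplacian to be nonpositive
   (take [q] along the gradient). *)
Definition dominative (p : R) (ddv : 'I_n -> 'I_n -> V -> R) :=
  forall x (q : 'I_n -> R), \sum_j q j ^+ 2 <= 1 ->
    \sum_j ddv j j x + (p - 2) * \sum_i \sum_j ddv i j x * (q i * q j) <= 0.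

(** At critical points of v the power |grad v|^(p-2) need not be differentiable. Adding e > 0 to
    |grad v|^2 makes the field C^1, so its divergence can be computed, and is nonpositive,
    everywhere. *)
Lemma dominative_weak_super (p : R) dv ddv : 2 <= p -> (forall j, continuous (dv j)) ->
  (forall i j, continuous (ddv i j)) -> (forall i j x, is_derive x 'e_i (dv j) (ddv i j x)) ->
  dominative p ddv -> weak_super p dv.
Proof.
move=> p2 cdv cddv ddvE dom phi dphi r cphi cdphi phir phi0 dphiE.
have dphir j : vanish_off r (dphi j) := vanish_is_derive phir (dphiE j).
pose N x := \sum_i dv i x * dv i x.
pose S (e : R) x := N x + e.
pose a := (p - 2) / 2.
pose B e j x := S e x `^ a * dv j x.
pose dS j x := \sum_i (ddv j i x * dv i x + dv i x * ddv j i x).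
pose dB e j x := a * S e x `^ (a - 1) * dS j x * dv j x + S e x `^ a * ddv j j x.
have N0 x : 0 <= N x by apply: sumr_ge0 => i _; rewrite -expr2 sqr_ge0.
have S0 e x : 0 < e -> 0 < S e x by move=> e0; rewrite ltr_wpDl.
have cS e : continuous (S e).
  by apply: cont_add; [apply: cont_sum => i; exact: cont_mul|exact: cont_cst].
have cSa e b : 0 < e -> continuous (fun x => S e x `^ b).
  by move=> e0; apply: cont_powR => // x; exact: S0.
have cB e j : 0 < e -> continuous (B e j).
  by move=> e0; apply: cont_mul => //; exact: cSa.
have cdS j : continuous (dS j).
  by apply: cont_sum => i; apply: cont_add; apply: cont_mul.
have cdB e j : 0 < e -> continuous (dB e j).
  move=> e0; apply: cont_add; last by apply: cont_mul => //; exact: cSa.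
  apply: cont_mul => //; apply: cont_mul => //; apply: cont_mul; first exact: cont_cst.
  exact: cSa.
have BE e j x : 0 < e -> is_derive x 'e_j (B e j) (dB e j x).
  move=> e0; apply: is_derive_mul => //; apply: is_derive_powR_gt0; last exact: S0.
  rewrite -[dS j x]addr0; apply: (@is_derive_add _ _ N (fun=> e)).
  by apply: (@is_derive_bigsum _ _ (fun i x => dv i x * dv i x)
    (fun i x => ddv j i x * dv i x + dv i x * ddv j i x)) => i; exact: is_derive_mul.
(* [q] is the gradient divided by the square root of [S e x], so [|q| <= 1]
   and [dominative] applies. *)
have div_le0 e x : 0 < e -> \sum_j dB e j x <= 0.
  move=> e0; have Sx := S0 e x e0.
  pose q j := dv j x / Num.sqrt (S e x).
  have sS : Num.sqrt (S e x) ^+ 2 = S e x by rewrite sqr_sqrtr// ltW.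
  have qq i j : q i * q j = dv i x * dv j x / S e x.
    by rewrite -[in RHS]sS /q; field; rewrite gt_eqF// sqrtr_gt0.
  have q1 : \sum_j q j ^+ 2 <= 1.
    under eq_bigr do rewrite expr2 qq.
    by rewrite -mulr_suml ler_pdivrMr// mul1r /S lerDl ltW.
  have Sa : S e x `^ (a - 1) = S e x `^ a / S e x.
    by rewrite powRB ?powRr1 ?(gt_eqF Sx) ?implybT ?(ltW Sx).
  have -> : \sum_j dB e j x = S e x `^ a *
      (\sum_j ddv j j x + (p - 2) * \sum_i \sum_j ddv i j x * (q i * q j)).
    rewrite mulrDr !mulr_sumr -big_split /=; apply: eq_bigr => j _.
    rewrite /dB Sa addrC; congr (_ + _); rewrite /dS mulr_sumr mulr_suml mulr_sumr.
    rewrite mulr_sumr; apply: eq_bigr => i _; rewrite qq /a; field.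
    by rewrite gt_eqF.
  by rewrite mulr_ge0_le0 ?powR_ge0//; exact: dom.
have iv f : continuous f -> vanish_off r f -> integ f.
  by move=> cf fr; have [C [_ fC]] := cont_vanish_bdd cf fr; exact: integ_bdd (continuous_borel cf) fC fr.
have iBd e j : 0 < e -> integ (fun x => B e j x * dphi j x).
  move=> e0; apply: iv; first by apply: cont_mul => //; exact: cB.
  by move=> x rx; rewrite dphir// mulr0.
have idB e j : 0 < e -> integ (fun x => dB e j x * phi x).
  move=> e0; apply: iv; first by apply: cont_mul => //; exact: cdB.
  by move=> x rx; rewrite phir// mulr0.
(* The divergence of phi B integrates to zero, and its part phi div B is nonpositive, so the part B
   . grad phi has a nonnegative integral. *)
have ge0 e : 0 < e -> 0 <= \sum_j rint (fun x => B e j x * dphi j x).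
  move=> e0.
  have E j : rint (fun x => dB e j x * phi x + B e j x * dphi j x) = 0.
    apply: (@rint_pd0 _ _ (fun x => B e j x * phi x) _ r j).
    - by apply: cont_mul => //; exact: cB.
    - by apply: cont_add; apply: cont_mul => //; [exact: cdB|exact: cB].
    - by move=> x rx; rewrite phir// mulr0.
    - by move=> x; apply: is_derive_mul => //; exact: BE.
  have E0 : 0 = \sum_j rint (fun x => dB e j x * phi x + B e j x * dphi j x) :> R.
    by rewrite big1.
  rewrite [X in X <= _]E0 -!rint_sum; last 2 first.
  - by move=> j; exact: iBd.
  - by move=> j; apply: integD; [exact: idB|exact: iBd].
  apply: le_rint => [||x].
  - by apply: integ_sum => j; apply: integD; [exact: idB|exact: iBd].
  - by apply: integ_sum => j; exact: iBd.
  by rewrite big_split /= gerDr -mulr_suml mulr_le0_ge0// div_le0.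
have B_cvg j x : B (radk k) j x @[k --> \oo] --> flux p (fun i => dv i x) j.
  (* At a critical point both sides vanish through the factor [dv j x]; elsewhere t^a is continuous
     at N x > 0. *)
  have [Nx|Nx] := eqVneq (N x) 0.
    have dv0 i : dv i x = 0.
      move/eqP: Nx; rewrite psumr_eq0 => [/allP/(_ i)|i' _]; last by rewrite -expr2 sqr_ge0.
      by rewrite mem_index_enum mulf_eq0 orbb => /(_ isT)/eqP.
    rewrite flux0//; under eq_fun do rewrite /B dv0 mulr0; exact: cvg_cst.
  have Np : 0 < N x by rewrite lt_neqAle eq_sym Nx N0.
  have -> : flux p (fun i => dv i x) j = N x `^ a * dv j x.
    by rewrite /flux /vnorm /a [(p - 2) / 2]mulrC powRrM powR12_sqrt//.
  apply: (@cvgM _ _ _ _ (fun k => S (radk k) x `^ a) (fun=> dv j x)); last exact: cvg_cst.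
  apply: (@continuous_cvg _ _ _ _ _ (fun k => S (radk k) x) (fun t => t `^ a) (N x)).
    exact: powR_continuous_gt0.
  rewrite -[X in _ --> X]addr0.
  apply: (@cvgD _ _ _ _ _ (fun=> N x) (fun k => radk k)); first exact: cvg_cst.
  exact: cvg_harmonic.
have lim j : rint (fun x => B (radk k) j x * dphi j x) @[k --> \oo] -->
    rint (fun x => flux p (fun i => dv i x) j * dphi j x).
  (* As a >= 0 and [radk k] <= 1, the field with e = 1 dominates all the others. *)
  apply: (@rint_dct _ MV R vol (fun k x => B (radk k) j x * dphi j x) _
    (fun x => `|B 1 j x * dphi j x|)).
  - by move=> k; exact: (continuous_borel (cont_mul (cB (radk k) j (@radk_gt0 R k)) (cdphi j))).
  - exact: (integ_norm (iBd 1 j ltr01)).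
  - move=> x; apply: (@cvgM _ _ _ _ (fun k => B (radk k) j x) (fun=> dphi j x)); last exact: cvg_cst.
    exact: B_cvg.
  move=> k x; rewrite !normrM; apply: ler_wpM2r => //; apply: ler_wpM2r => //.
  have a0 : 0 <= a by rewrite divr_ge0// subr_ge0.
  rewrite !ger0_norm ?powR_ge0//; apply: (ge0_ler_powR a0); rewrite ?nnegrE.
  - exact: (ltW (S0 _ x (@radk_gt0 R k))).
  - exact: (ltW (S0 _ x ltr01)).
  by rewrite lerD2l /radk invf_le1 ?ler1n.
pose u k : R := \sum_j rint (fun x => B (radk k) j x * dphi j x).
have L : u k @[k --> \oo] --> \sum_j rint (fun x => flux p (fun i => dv i x) j * dphi j x).
  exact: (@cvg_big _ _ +%R 0 xpredT (@add_continuous R) nat \oo (index_enum 'I_n) _ _ _ (fun j _ => lim j)).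
apply: (cvgr_to_ge L); near=> k; apply: ge0; exact: radk_gt0.
Unshelve. all: end_near. Qed.

Lemma is_derive_mull (f : V -> R) (x v : V) (c d : R) : is_derive x v f d ->
  is_derive x v (fun x => c * f x) (c * d).
Proof. by move=> fd; have := is_derive_mul (is_derive_cst c x v) fd; rewrite mul0r add0r. Qed.

(** C^2 functions, with first and second derivatives as data, obeying the additive inequality; this
    is the class in which the approximants of W are assembled. *)
Definition dominative_super (p : R) (v : V -> R) : Prop := exists dv ddv,
  [/\ continuous v, forall j, continuous (dv j), forall i j, continuous (ddv i j),
      forall j x, is_derive x 'e_j v (dv j x) &
      (forall i j x, is_derive x 'e_i (dv j) (ddv i j x)) /\ dominative p ddv].

Lemma cont_coord j : continuous (fun x : V => x 0 j).
Proof. exact: coord_continuous. Qed.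

Lemma sum_delta (F : 'I_n -> R) j : \sum_i F i * (i == j)%:R = F j.
Proof.
rewrite (bigD1 j)//= eqxx mulr1 big1 ?addr0// => i /negPf ->.
by rewrite mulr0.
Qed.

Lemma dominative_super_affine (p : R) (m : V) (c : R) :
  dominative_super p (fun x => \sum_j m 0 j * x 0 j + c).
Proof.
exists (fun j _ => m 0 j), (fun _ _ _ => 0); split=> [|j|i j|j x|].
- apply: cont_add; last exact: cont_cst.
  by apply: cont_sum => j; apply: cont_mul; [exact: cont_cst|exact: cont_coord].
- exact: cont_cst.
- exact: cont_cst.
- have dE i : is_derive x 'e_j (fun x => m 0 i * x 0 i) (m 0 i * (i == j)%:R).
    exact: is_derive_mull (is_derive_coord x i j).
  have := is_derive_add (is_derive_bigsum (index_enum 'I_n)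
    (d := fun i _ => m 0 i * (i == j)%:R) dE) (is_derive_cst c x 'e_j).
  by rewrite addr0 sum_delta.
split=> [i j x|x q _]; first exact: is_derive_cst.
rewrite big1// add0r [X in _ * X]big1 ?mulr0// => i _.
by rewrite big1// => j _; rewrite mul0r.
Qed.

Lemma dominative_super_addZ (p c : R) v w : 0 <= c -> dominative_super p v ->
  dominative_super p w -> dominative_super p (fun x => v x + c * w x).
Proof.
move=> c0 [dv [ddv [cv cdv cddv dvE [ddvE dom]]]] [dw [ddw [cw cdw cddw dwE [ddwE dom']]]].
exists (fun j x => dv j x + c * dw j x), (fun i j x => ddv i j x + c * ddw i j x); split.
- by apply: cont_add => //; exact: cont_mull.
- by move=> j; apply: cont_add => //; exact: cont_mull.
- by move=> i j; apply: cont_add => //; exact: cont_mull.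
- by move=> j x; apply: is_derive_add => //; exact: is_derive_mull.
split=> [i j x|x q q1]; first by apply: is_derive_add => //; exact: is_derive_mull.
have := lerD (dom x q q1) (mulr_ge0_le0 c0 (dom' x q q1)); rewrite addr0.
congr (_ <= _); rewrite big_split /= -mulr_sumr.
have -> : \sum_i \sum_j (ddv i j x + c * ddw i j x) * (q i * q j) =
    \sum_i \sum_j ddv i j x * (q i * q j) + c * \sum_i \sum_j ddw i j x * (q i * q j).
  rewrite mulr_sumr -big_split /=; apply: eq_bigr => i _.
  rewrite mulr_sumr -big_split /=; apply: eq_bigr => j _; ring.
ring.
Qed.

(** With s = |z|^2, d = z . q and t = |q|^2, the vector s q - d z has squared length s (s t -
    d^2). *)
Lemma cauchy_schwarz (z q : 'I_n -> R) :
  (\sum_j z j * q j) ^+ 2 <= (\sum_j z j ^+ 2) * \sum_j q j ^+ 2.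
Proof.
set s := \sum_j z j ^+ 2; set d := \sum_j z j * q j; set t := \sum_j q j ^+ 2.
have s0 : 0 <= s by apply: sumr_ge0 => j _; exact: sqr_ge0.
have [s00|sN0] := eqVneq s 0.
  have z0 j : z j = 0.
    move/eqP: s00; rewrite psumr_eq0 => [/allP/(_ j)|i _]; last exact: sqr_ge0.
    by rewrite mem_index_enum sqrf_eq0 => /(_ isT)/eqP.
  by rewrite /d big1 ?expr0n ?s00 ?mul0r// => j _; rewrite z0 mul0r.
have sp : 0 < s by rewrite lt_neqAle eq_sym sN0.
rewrite -(ler_pM2l sp) -subr_ge0.
suff -> : s * (s * t) - s * d ^+ 2 = \sum_j (s * q j - d * z j) ^+ 2.
  by apply: sumr_ge0 => j _; exact: sqr_ge0.
have -> : \sum_j (s * q j - d * z j) ^+ 2 =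
    \sum_j (s ^+ 2 * q j ^+ 2 + (- (2 * s * d)) * (z j * q j) + d ^+ 2 * z j ^+ 2).
  by apply: eq_bigr => j _; ring.
rewrite !big_split /= -!mulr_sumr -/s -/d -/t; ring.
Qed.

Definition reg_kernel (e t : R) (y x : V) : R := (\sum_j (x 0 j - y 0 j) ^+ 2 + t) `^ (- (e / 2)).

(** With z = x - y, Q = |z|^2 + t and P = Q^(-e/2 - 2), the Hessian is e P ((e + 2) z_i z_j - Q
    delta_ij). Using |z|^2 <= Q, (z . q)^2 <= Q |q|^2, |q| <= 1 and p >= 2, the expression is at
    most e P Q ((e + 2) - n + (p - 2)(e + 1)) = e P Q (e (p - 1) - (n - p)) = 0. *)
Lemma dominative_super_kernel (p t : R) (y : V) : 2 <= p -> p < n%:R -> 0 < t ->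
  dominative_super p (reg_kernel ((n%:R - p) / (p - 1)) t y).
Proof.
move=> p2 pn t0; set e := (n%:R - p) / (p - 1).
have p10 : 0 < p - 1 by move: p2; lra.
have e0 : 0 < e by rewrite divr_gt0// subr_gt0.
have eE : e * (p - 1) = n%:R - p by rewrite /e divfK// gt_eqF.
pose z (j : 'I_n) (x : V) : R := x 0 j - y 0 j.
pose Q (x : V) : R := \sum_j z j x * z j x + t.
have Q0 x : 0 < Q x by rewrite ltr_wpDl// sumr_ge0// => j _; rewrite -expr2 sqr_ge0.
pose b := - (e / 2).
have cz j : continuous (z j) by apply: cont_add; [exact: cont_coord|exact: cont_cst].
have cQ : continuous Q.
  by apply: cont_add; [apply: cont_sum => j; exact: cont_mul|exact: cont_cst].
have cQb c : continuous (fun x => Q x `^ c) by exact: cont_powR.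
have zE i j x : is_derive x 'e_j (z i) (i == j)%:R.
  by have := is_derive_add (is_derive_coord x i j) (is_derive_cst (- y 0 i) x 'e_j); rewrite addr0.
have z2E i j x : is_derive x 'e_j (fun x => 2 * z i x) (2 * (i == j)%:R).
  exact: is_derive_mull (zE i j x).
have QE j x : is_derive x 'e_j Q (2 * z j x).
  have dE i : is_derive x 'e_j (fun x => z i x * z i x) (2 * z i x * (i == j)%:R).
    apply: (is_derive_eq (is_derive_mul (zE i j x) (zE i j x))); ring.
  have := is_derive_add (is_derive_bigsum (index_enum 'I_n)
    (d := fun i x => 2 * z i x * (i == j)%:R) dE) (is_derive_cst t x 'e_j).
  by rewrite addr0 sum_delta.
pose dw j (x : V) : R := b * Q x `^ (b - 1) * (2 * z j x).
pose ddw i j (x : V) : R := (b * ((b - 1) * Q x `^ (b - 1 - 1) * (2 * z i x))) * (2 * z j x) +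
  b * Q x `^ (b - 1) * (2 * (j == i)%:R).
exists dw, ddw; split=> [|j|i j|j x|].
- exact: cQb.
- exact: (cont_mul (@cont_mull b _ (cQb _)) (@cont_mull 2 _ (cz j))).
- apply: cont_add; last exact: (cont_mul (@cont_mull b _ (cQb _)) (@cont_cst _)).
  exact: (cont_mul (@cont_mull b _ (cont_mul (@cont_mull (b - 1) _ (cQb _)) (@cont_mull 2 _ (cz i))))
    (@cont_mull 2 _ (cz j))).
- exact: (is_derive_powR_gt0 b (QE j x) (Q0 x)).
split=> [i j x|x q q1].
  apply: is_derive_mul => //.
  exact: is_derive_mull (is_derive_powR_gt0 (b - 1) (QE i x) (Q0 x)).
set P := Q x `^ (b - 1 - 1).
have P0 : 0 <= P by exact: powR_ge0.
have PQ : Q x `^ (b - 1) = P * Q x.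
  rewrite -[X in _ = _ * X]powRr1 ?(ltW (Q0 x))// -powRD ?(gt_eqF (Q0 x)) ?implybT//.
  by congr (_ `^ _); ring.
set s := \sum_j z j x ^+ 2; set d := \sum_j z j x * q j; set l := \sum_j q j ^+ 2.
have sQ : s <= Q x by rewrite /Q lerDl ltW.
have s0 : 0 <= s by apply: sumr_ge0 => j _; exact: sqr_ge0.
have l0 : 0 <= l by apply: sumr_ge0 => j _; exact: sqr_ge0.
have d2 : d ^+ 2 <= s * l by exact: cauchy_schwarz.
have E1 : \sum_j ddw j j x = e * P * ((e + 2) * s - n%:R * Q x).
  rewrite big_split /= mulrBr; congr (_ + _).
    by rewrite /s !mulr_sumr; apply: eq_bigr => j _; rewrite -/P /b; field.
  rewrite (eq_bigr (fun=> - (e * P * Q x))) => [|j _].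
    by rewrite sumr_const card_ord -[LHS]mulr_natr; ring.
  by rewrite eqxx (_ : true%:R = 1)// PQ /b; field.
have E2 : \sum_i \sum_j ddw i j x * (q i * q j) = e * P * ((e + 2) * d ^+ 2 - Q x * l).
  rewrite mulrBr [X in _ - X](_ : _ = \sum_i e * P * Q x * q i ^+ 2); last first.
    by rewrite -mulr_sumr -/l mulrA.
  rewrite expr2 {1}/d mulr_suml !mulr_sumr -sumrB; apply: eq_bigr => i _.
  rewrite [X in _ = X - _](_ : _ = \sum_j e * P * (e + 2) * (z i x * q i) * (z j x * q j)); last first.
    by rewrite -mulr_sumr -/d; ring.
  rewrite -(sum_delta (fun j => e * P * Q x * (q i * q j))) -sumrB.
  by apply: eq_bigr => j _; rewrite /ddw PQ -/P /b; field.
suff : \sum_j ddw j j x + (p - 2) * \sum_i \sum_j ddw i j x * (q i * q j) <= 0 by [].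
rewrite E1 E2.
have -> : e * P * ((e + 2) * s - n%:R * Q x) + (p - 2) * (e * P * ((e + 2) * d ^+ 2 - Q x * l)) =
  e * P * ((e + 2) * s - n%:R * Q x + (p - 2) * ((e + 2) * d ^+ 2 - Q x * l)) by ring.
apply: mulr_ge0_le0; first by rewrite mulr_ge0// ltW.
have Qx := ltW (Q0 x).
have h1 : (e + 2) * s <= (e + 2) * Q x by rewrite ler_wpM2l// addr_ge0// ltW.
have h2 : (e + 2) * d ^+ 2 <= (e + 2) * (Q x * l).
  apply: ler_wpM2l; first by rewrite addr_ge0// ltW.
  by apply: le_trans d2 _; exact: ler_wpM2r.
have h3 : (p - 2) * ((e + 2) * d ^+ 2 - Q x * l) <= (p - 2) * ((e + 1) * Q x).
  apply: ler_wpM2l; first by rewrite subr_ge0.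
  apply: (@le_trans _ _ ((e + 1) * (Q x * l))); first by move: h2; lra.
  by rewrite ler_wpM2l ?addr_ge0 ?(ltW e0)// ler_piMr.
apply: (@le_trans _ _ (((e + 2) - n%:R + (p - 2) * (e + 1)) * Q x)); first by move: h1 h3; lra.
have -> : (e + 2) - n%:R + (p - 2) * (e + 1) = e * (p - 1) - (n%:R - p) by ring.
by rewrite eE subrr mul0r.
Qed.

End Dominative.

(** * Concave functions *)

Section Concave.
Context {R : realType} {n : nat}.
Local Notation V := 'rV[R]_n.
Local Notation "''e_' j" := (delta_mx 0 j : V) (at level 8, j at level 2, format "''e_' j").
Variable K : V -> R.
Hypothesis concK : Defs.concave K.
Variable x0 : V.

Let g (x : V) := K (x0 + x) - K x0.

Let g0 : g 0 = 0. Proof. by rewrite /g addr0 subrr. Qed.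

Let g_conc (x z : V) (t : R) : 0 <= t <= 1 -> t * g x + (1 - t) * g z <= g (t *: x + (1 - t) *: z).
Proof.
move=> t01; have := concK (x0 + x) (x0 + z) t01.
rewrite (_ : t *: (x0 + x) + (1 - t) *: (x0 + z) = x0 + (t *: x + (1 - t) *: z)).
  by rewrite /g; lra.
by rewrite !scalerDr addrACA -scalerDl [t + _]addrC subrK scale1r.
Qed.

Let below (k : nat) (x : V) : Prop := forall j : 'I_n, (k <= j)%N -> x 0 j = 0.

Let dot (m x : V) : R := \sum_j m 0 j * x 0 j.

Let dotD m x z : dot m (x + z) = dot m x + dot m z.
Proof. by rewrite /dot -big_split /=; apply: eq_bigr => j _; rewrite mxE mulrDr. Qed.

Let dotZ m t x : dot m (t *: x) = t * dot m x.
Proof. by rewrite /dot mulr_sumr; apply: eq_bigr => j _; rewrite mxE mulrCA. Qed.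

Let dotDl m m' x : dot (m + m') x = dot m x + dot m' x.
Proof. by rewrite /dot -big_split /=; apply: eq_bigr => j _; rewrite mxE mulrDl. Qed.

Let dot_e t j x : dot (t *: 'e_j) x = t * x 0 j.
Proof.
rewrite /dot (bigD1 j)//= big1 ?addr0 => [|i /negPf ij]; first by rewrite !mxE !eqxx mulr1.
by rewrite !mxE ij andbF mulr0 mul0r.
Qed.

Let split_last (k : nat) (j : 'I_n) (x : V) : k = j -> below k.+1 x ->
  below k (x - x 0 j *: 'e_j).
Proof.
move=> kj bx i ki; rewrite !mxE; have [->|ij] := eqVneq i j; first by rewrite eqxx mulr1 subrr.
by rewrite andbF mulr0 subr0; apply: bx; rewrite ltn_neqAle ki andbT kj eq_sym.
Qed.

Let belowD k x z : below k x -> below k z -> below k (x + z).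
Proof. by move=> bx bz j kj; rewrite mxE bx// bz// addr0. Qed.

Let belowZ k t x : below k x -> below k (t *: x).
Proof. by move=> bx j kj; rewrite mxE bx// mulr0. Qed.

(* One Hahn-Banach extension step per coordinate. *)
Let support_below (k : nat) : (k <= n)%N -> exists m : V, forall x, below k x -> g x <= dot m x.
Proof.
elim: k => [_|k IH kn].
  exists 0 => x bx; have -> : x = 0 by apply/rowP => j; rewrite mxE bx.
  by rewrite g0 /dot big1// => j _; rewrite mxE mul0r.
have [m Hm] := IH (ltnW kn); pose j := Ordinal kn; set e := 'e_j.
(* Every lower bound for the new coefficient, coming from the positive side of [e], lies below every
   upper bound, coming from the negative side; hence the supremum of the former is admissible. *)
have cross (w w' : V) (r s : R) : below k w -> below k w' -> 0 < r -> 0 < s ->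
    (g (w + s *: e) - dot m w) / s <= (dot m w' - g (w' - r *: e)) / r.
  move=> bw bw' r0 s0; have rs : 0 < r + s by rewrite addr_gt0.
  (* The weight for which the components along [e] cancel, so that the convex combination falls into
     the smaller subspace and [Hm] applies. *)
  pose t := r / (r + s).
  have t1 : 1 - t = s / (r + s) by rewrite /t; field; rewrite gt_eqF.
  have t01 : 0 <= t <= 1.
    by rewrite divr_ge0 ?(ltW r0) ?(ltW rs)//= ler_pdivrMr// mul1r lerDl ltW.
  have := g_conc (w + s *: e) (w' - r *: e) t01.
  have -> : t *: (w + s *: e) + (1 - t) *: (w' - r *: e) = t *: w + (1 - t) *: w'.
    rewrite scalerDr scalerBr addrACA !scalerA -scalerBl.
    rewrite (_ : t * s - (1 - t) * r = 0) ?scale0r ?addr0//.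
    by rewrite t1 /t; field; rewrite gt_eqF.
  move=> H; have := le_trans H (Hm _ (belowD (belowZ t bw) (belowZ (1 - t) bw'))).
  rewrite dotD !dotZ t1 /t => H2.
  rewrite ler_pdivrMr// mulrAC ler_pdivlMr//.
  have E (c d : R) : (r / (r + s) * c + s / (r + s) * d) * (r + s) = r * c + s * d.
    by field; rewrite gt_eqF.
  have := ler_wpM2r (ltW rs) H2; rewrite !E; lra.
have b0 : below k 0 by move=> i _; rewrite mxE.
pose S := [set y : R | exists w s, [/\ below k w, 0 < s & y = (g (w + s *: e) - dot m w) / s]].
have Sub w' r : below k w' -> 0 < r -> ubound S ((dot m w' - g (w' - r *: e)) / r).
  by move=> bw' r0 _ [w [s [bw s0 ->]]]; exact: cross.
have supS : has_sup S.
  split; first by exists ((g (0 + 1 *: e) - dot m 0) / 1), 0, 1.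
  by exists ((dot m 0 - g (0 - 1 *: e)) / 1); exact: Sub.
pose t := sup S.
exists (m + (t - m 0 j) *: e) => x bx.
pose w := x - x 0 j *: e.
have bw : below k w by exact: split_last.
have xE : x = w + x 0 j *: e by rewrite subrK.
have dE : dot (m + (t - m 0 j) *: e) x = dot m w + t * x 0 j.
  rewrite dotDl dot_e {1}xE dotD dotZ.
  have -> : dot m e = m 0 j.
    by have := dot_e 1 j m; rewrite scale1r mul1r => <-; apply: eq_bigr => i _; rewrite mulrC.
  by ring.
rewrite dE; have [xj|xj|xj] := ltgtP (x 0 j) 0.
- have := ge_sup supS.1 (Sub w (- x 0 j) bw _); rewrite oppr_gt0 => /(_ xj).
  rewrite scaleNr opprK -xE ler_pdivlMr ?oppr_gt0// -/t; lra.
- have : S ((g (w + x 0 j *: e) - dot m w) / x 0 j) by exists w, (x 0 j).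
  move=> /(ub_le_sup supS.2); rewrite -xE ler_pdivrMr// -/t; lra.
by rewrite {1}xE xj scale0r addr0 mulr0 addr0; exact: Hm.
Qed.

Lemma concave_support : exists m : V, forall x, K x <= K x0 + \sum_j m 0 j * (x 0 j - x0 0 j).
Proof.
have [m Hm] := support_below (leqnn n); exists m => x.
have b : below n (x - x0) by move=> j; rewrite leqNgt ltn_ord.
have := Hm _ b; rewrite /g [x0 + _]addrC subrK /dot lerBlDl.
by under eq_bigr do rewrite !mxE.
Qed.

(** x is the midpoint of 2w, with w in the smaller subspace, and of 2 x_j e_j. The first is handled
    by induction, the second by the chord from 0 to e_j or to -e_j; concavity averages the two lower
    bounds. *)
Let lsc_below (k : nat) : (k <= n)%N -> forall e : R, 0 < e -> exists d : R, 0 < d /\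
  forall x, below k x -> `|x| <= d -> - e <= g x.
Proof.
elim: k => [_|k IH kn] e e0.
  exists 1; split => // x bx _; have -> : x = 0 by apply/rowP => j; rewrite mxE bx.
  by rewrite g0 oppr_le0 ltW.
have [d [d0 Hd]] := IH (ltnW kn) e e0; pose j := Ordinal kn.
pose C := 1 + `|g 'e_j| + `|g (- 'e_j)|.
have C0 : 0 < C by rewrite ltr_wpDr ?addr_ge0// ltr_pwDl.
have C1 : `|g 'e_j| <= C by rewrite /C -addrA addrCA lerDl addr_ge0.
have C2 : `|g (- 'e_j)| <= C by rewrite /C lerDr addr_ge0.
(* 1/2 makes 2|x_j| <= 1, a legitimate convex weight; d/4 gives |2w| <= 4 d' <= d; e/(2C) keeps the
   loss 2|x_j| C along the chord below e. *)
pose d' := Num.min (1 / 2) (Num.min (d / 4) (e / (2 * C))).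
have d'0 : 0 < d' by rewrite !lt_min !divr_gt0// mulr_gt0.
exists d'; split => // x bx xd.
have xj : `|x 0 j| <= d' by exact: le_trans (coord_le_norm x j) xd.
have d'1 : d' <= 1 / 2 by rewrite ge_min lexx.
have d'2 : d' <= d / 4 by rewrite !ge_min lexx !orbT.
have d'3 : d' <= e / (2 * C) by rewrite !ge_min lexx !orbT.
pose s := x 0 j; pose w := x - s *: 'e_j.
have bw : below k (2 *: w) by apply: belowZ; exact: split_last.
have nw : `|2 *: w| <= d.
  rewrite normrZ ger0_norm//.
  have ew : `|w| <= `|x| + `|s|.
    apply: le_trans (ler_normB _ _) _; rewrite lerD2l normrZ ler_piMr//; exact: norm_e_le.
  by move: ew xd xj d'2; rewrite -/s; lra.
have one : - e <= g ((2 * s) *: 'e_j).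
  have sC : 2 * `|s| * C <= e.
    have : `|s| * (2 * C) <= e.
      by rewrite -ler_pdivlMr ?mulr_gt0//; exact: le_trans xj d'3.
    lra.
  have s1 : 0 <= 2 * `|s| <= 1 by rewrite mulr_ge0//=; move: xj d'1; rewrite -/s; lra.
  have [s0|s0] := leP 0 s.
    have := g_conc 'e_j 0 s1; rewrite g0 mulr0 addr0 scaler0 addr0 ger0_norm//.
    apply: le_trans; move: sC; rewrite (ger0_norm s0) => sC.
    have : - C <= g 'e_j by rewrite lerNl; apply: le_trans C1; rewrite ler_normr lexx orbT.
    move=> /(ler_wpM2l (_ : 0 <= 2 * s)); rewrite mulr_ge0// => /(_ isT).
    by move: sC; lra.
  have := g_conc (- 'e_j) 0 s1; rewrite g0 mulr0 addr0 scaler0 addr0 ltr0_norm//.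
  rewrite scalerN mulrN scaleNr opprK.
  apply: le_trans; move: sC; rewrite (ltr0_norm s0) => sC.
  have : - C <= g (- 'e_j) by rewrite lerNl; apply: le_trans C2; rewrite ler_normr lexx orbT.
  move=> /(ler_wpM2l (_ : 0 <= 2 * - s)); rewrite mulr_ge0 ?oppr_ge0 ?(ltW s0)// => /(_ isT).
  by move: sC; lra.
have h01 : (0 <= 2^-1 :> R) && (2^-1 <= 1 :> R) by rewrite invr_ge0 ler0n invf_le1// ler1n.
have := g_conc (2 *: w) ((2 * s) *: 'e_j) h01.
have -> : 2^-1 *: (2 *: w) + (1 - 2^-1) *: ((2 * s) *: 'e_j) = x.
  have -> : 1 - 2^-1 = 2^-1 :> R by field.
  by rewrite !scalerA mulrA mulVf// scale1r mul1r subrK.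
apply: le_trans; have := Hd _ bw nw; lra.
Qed.

Lemma concave_lsc (e : R) : 0 < e -> \forall x \near x0, K x0 - e < K x.
Proof.
move=> e0; have e2 : 0 < e / 2 by rewrite divr_gt0.
have [d [d0 Hd]] := lsc_below (leqnn n) e2.
near=> x.
have b : below n (x - x0) by move=> j; rewrite leqNgt ltn_ord.
have xd : `|x - x0| <= d.
  by rewrite distrC; near: x; exact: (@cvgr_dist_le _ _ _ (nbhs x0) _ id x0).
have := Hd _ b xd; rewrite /g [x0 + _]addrC subrK; move: e0; lra.
Unshelve. all: end_near. Qed.

End Concave.

(** * The potential *)

Section Series.
Context {R : realType} {n : nat}.
Local Notation V := 'rV[R]_n.
Variables (e : R) (e0 : 0 < e).

Let e2 : 0 < e / 2. Proof. by rewrite divr_gt0. Qed.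

Lemma kernel_ge0 t (y x : V) : 0 <= reg_kernel e t y x. Proof. exact: powR_ge0. Qed.

Let dist2 (y x : V) := \sum_j (x 0 j - y 0 j) ^+ 2.

Let dist2_ge0 y x : 0 <= dist2 y x.
Proof. by apply: sumr_ge0 => j _; exact: sqr_ge0. Qed.

Let kernelE t (y x : V) : reg_kernel e t y x = ((dist2 y x + t) `^ (e / 2))^-1.
Proof. by rewrite /reg_kernel powRN. Qed.

Let dist2_gt0 y x : x != y -> 0 < dist2 y x.
Proof.
move=> xy; rewrite lt_neqAle dist2_ge0 andbT eq_sym; apply: contraNneq xy => d0.
apply/eqP/rowP => j; apply/eqP; rewrite -subr_eq0 -sqrf_eq0.
move/eqP: d0; rewrite psumr_eq0 => [/allP/(_ j)|i _]; last exact: sqr_ge0.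
by rewrite mem_index_enum; exact.
Qed.

Let ktermE a (y x : V) : a != 0 -> x != y -> kterm e a y x = (a * reg_kernel e 0 y x)%:E.
Proof.
move=> /negPf a0 xy; rewrite /kterm a0 (negPf xy) kernelE addr0; congr (_ / _)%:E.
rewrite /enorm -powR12_sqrt; last by apply: sumr_ge0 => j _; exact: sqr_ge0.
rewrite -powRrM mulrC; congr (_ `^ _); apply: eq_bigr => j _; by rewrite !mxE.
Qed.

Lemma kernel_anti t t' (y x : V) : 0 <= t -> t <= t' -> 0 < dist2 y x + t ->
  reg_kernel e t' y x <= reg_kernel e t y x.
Proof.
move=> t0 tt' d0; rewrite !kernelE lef_pV2 ?posrE ?powR_gt0//.
  by apply: ge0_ler_powR; rewrite ?nnegrE ?(ltW e2)// ?lerD2l// (le_trans (ltW d0))// lerD2l.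
by apply: lt_le_trans d0 _; rewrite lerD2l.
Qed.

Lemma kterm_ge0 a (y x : V) : 0 <= a -> (0 <= kterm e a y x)%E.
Proof.
move=> a0; rewrite /kterm; case: ifP => // _; case: ifP => // _.
by rewrite lee_fin divr_ge0// powR_ge0.
Qed.

Lemma kernel_le_kterm a t (y x : V) : 0 <= a -> 0 < t ->
  ((a * reg_kernel e t y x)%:E <= kterm e a y x)%E.
Proof.
move=> a0 t0; have [->|aN0] := eqVneq a 0; first by rewrite mul0r /kterm eqxx.
have [->|xy] := eqVneq x y; first by rewrite /kterm (negPf aN0) eqxx leey.
rewrite ktermE// lee_fin; apply: ler_wpM2l => //; apply: kernel_anti => //; first exact: ltW.
by rewrite addr0 dist2_gt0.
Qed.

Lemma kernel_cvg a (y x : V) : 0 <= a ->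
  (a * reg_kernel e (radk k) y x)%:E @[k --> \oo] --> kterm e a y x.
Proof.
move=> a0; have [->|aN0] := eqVneq a 0.
  by under eq_fun do rewrite mul0r; rewrite /kterm eqxx; exact: cvg_cst.
have ap : 0 < a by rewrite lt_neqAle eq_sym aN0.
have [->|xy] := eqVneq x y.
  rewrite /kterm (negPf aN0) eqxx; apply/cvgeyPge => A.
  pose M := Num.max A 1; have M0 : 0 < M by rewrite lt_max ltr01 orbT.
  (* The radius at which a s^(-e/2) = M; at the pole the smoothed kernel is the power -e/2 of its
     parameter. *)
  pose s := (M / a) `^ (- (e / 2)^-1).
  have s0 : 0 < s by rewrite powR_gt0// divr_gt0.
  near=> k; rewrite lee_fin.
  have kd : reg_kernel e (radk k) y y = radk k `^ (- (e / 2)).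
    by rewrite /reg_kernel big1 ?add0r// => j _; rewrite subrr expr0n.
  have ks : radk k < s by near: k; exact: radk_lt.
  rewrite kd; apply: (@le_trans _ _ M); first by rewrite le_max lexx.
  rewrite -ler_pdivrMl// mulrC.
  have -> : M / a = s `^ (- (e / 2)).
    by rewrite /s -powRrM mulrNN mulVf ?gt_eqF// powRr1// divr_ge0// ltW.
  rewrite !powRN lef_pV2 ?posrE ?powR_gt0 ?radk_gt0 ?divr_gt0//.
  by apply: ge0_ler_powR; rewrite ?nnegrE ?ltW ?radk_gt0.
rewrite ktermE//; apply: cvg_EFin; first exact: nearW.
apply: (@cvgM _ _ _ _ (fun=> a) (fun k => reg_kernel e (radk k) y x)); first exact: cvg_cst.
apply: (@continuous_cvg _ _ _ _ _ (fun k => dist2 y x + radk k) (fun t => t `^ (- (e / 2)))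
  (dist2 y x + 0)).
  by apply: powR_continuous_gt0; rewrite addr0 dist2_gt0.
apply: (@cvgD _ _ _ _ _ (fun=> dist2 y x) (fun k => radk k)); first exact: cvg_cst.
exact: cvg_harmonic.
Unshelve. all: end_near. Qed.

Variables (a : nat -> R) (y : nat -> V).
Hypothesis a0 : forall i, 0 <= a i.

(** One index governs both truncation and smoothing, so the approximants form a single nondecreasing
    sequence, as Dini's argument requires. *)
Definition truncated (k : nat) (x : V) : R :=
  \sum_(0 <= i < k) a i * reg_kernel e (radk k) (y i) x.

Let total (x : V) : \bar R := (\sum_(0 <= i <oo) kterm e (a i) (y i) x)%E.

Lemma truncated_le_series k x : ((truncated k x)%:E <= total x)%E.
Proof.
apply: (@le_trans _ _ (\sum_(0 <= i < k) kterm e (a i) (y i) x)%E).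
  by rewrite /truncated -sumEFin; apply: lee_sum => i _; exact: (kernel_le_kterm _ _ (a0 i) (@radk_gt0 R k)).
by apply: nneseries_lim_ge => i _ _; exact: kterm_ge0.
Qed.

Lemma truncated_nondecreasing x k m : (k <= m)%N -> truncated k x <= truncated m x.
Proof.
move=> km; rewrite /truncated (big_cat_nat (n := k) (p := m))//=.
apply: (@le_trans _ _ (\sum_(0 <= i < k) a i * reg_kernel e (radk m) (y i) x)).
  apply: ler_sum => i _; apply: ler_wpM2l => //; apply: kernel_anti; first exact/ltW/radk_gt0.
    by rewrite /radk lef_pV2 ?posrE// ler_nat.
  by apply: ltr_wpDl => //; exact: radk_gt0.
by rewrite lerDl; apply: sumr_ge0 => i _; apply: mulr_ge0 => //; exact: kernel_ge0.
Qed.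

(** First fix a partial sum of length m above c, then smooth its finitely many terms finely enough,
    from index N on. The index max(N, m) does both; the additional terms are nonnegative. *)
Lemma truncated_exhausts x (c : R) : (c%:E < total x)%E -> exists k, c < truncated k x.
Proof.
move=> cx.
have [m cm] : exists m, (c%:E < \sum_(0 <= i < m) kterm e (a i) (y i) x)%E.
  apply: contrapT => /forallNP H; move: cx; rewrite ltNge => /negP; apply.
  apply: lime_le; first by apply: is_cvg_nneseries => i _ _; exact: kterm_ge0.
  by apply: nearW => m; rewrite leNgt; exact/negP.
have lim : (\sum_(0 <= i < m) (a i * reg_kernel e (radk k) (y i) x)%:E)%E @[k --> \oo] -->
    (\sum_(0 <= i < m) kterm e (a i) (y i) x)%E.
  apply: cvg_nnesum => i _; last exact: kernel_cvg.
  by apply: nearW => k; rewrite lee_fin mulr_ge0// kernel_ge0.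
have : \forall k \near \oo, (c%:E < \sum_(0 <= i < m) (a i * reg_kernel e (radk k) (y i) x)%:E)%E.
  apply: (lim [set z | (c%:E < z)%E]); apply: open_nbhs_nbhs; split; last exact: cm.
  exact: open_ereal_gt_ereal.
move=> [N _ HN]; exists (maxn N m); have := HN (maxn N m) (leq_maxl _ _).
rewrite /= sumEFin lte_fin => /lt_le_trans; apply.
rewrite /truncated (big_cat_nat (n := m) (p := maxn N m))//= ?leq_maxr//.
by rewrite lerDl; apply: sumr_ge0 => i _; apply: mulr_ge0 => //; exact: kernel_ge0.
Qed.

End Series.

Section Superharmonic.
Context {R : realType} {n : nat}.
Local Notation V := 'rV[R]_n.
Variables (p : R) (K : V -> R) (y : nat -> V) (a : nat -> R).
Hypotheses (n0 : (0 < n)%N) (p2 : 2 <= p) (pn : p < n%:R).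
Hypotheses (concK : Defs.concave K) (a0 : forall i, 0 <= a i).

Let e := (n%:R - p) / (p - 1).
Let e0 : 0 < e.
Proof. by rewrite divr_gt0// ?subr_gt0//; move: p2; lra. Qed.

Let v := truncated e a y.
Let W (x : V) : \bar R := (Wseries p a y x + (K x)%:E)%E.

Lemma dominative_super_truncated (u : V -> R) k : dominative_super p u ->
  dominative_super p (fun x => u x + v k x).
Proof.
move=> du; suff H s : dominative_super p
    (fun x => u x + \sum_(i <- s) a i * reg_kernel e (radk k) (y i) x) by exact: H.
elim: s => [|i s IH].
  by under [X in dominative_super _ X]eq_fun do rewrite big_nil addr0.
under [X in dominative_super _ X]eq_fun do rewrite big_cons addrCA addrC /=.
exact: dominative_super_addZ (a0 i) IH (dominative_super_kernel (y i) p2 pn (@radk_gt0 R k)).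
Qed.

Let v_continuous k : continuous (v k).
Proof.
apply: cont_sum => i; apply: cont_mull; apply: cont_powR => [|x].
  apply: cont_add; last exact: cont_cst.
  apply: cont_sum => j; have cz : continuous (fun x : V => x 0 j - y i 0 j).
    by apply: cont_add; [exact: cont_coord|exact: cont_cst].
  exact: (cont_mul cz cz).
by rewrite ltr_wpDl ?radk_gt0// sumr_ge0// => j _; exact: sqr_ge0.
Qed.

Let vK_le_W k x : ((v k x + K x)%:E <= W x)%E.
Proof. by rewrite EFinD leeD2r//; exact: truncated_le_series. Qed.

Let lt_W x (c : R) : (c%:E < W x)%E -> exists k, c < v k x + K x.
Proof.
move=> cW; have [|k ck] := @truncated_exhausts _ _ e e0 a y a0 x (c - K x).
  by rewrite EFinB lteBlDr.
by exists k; rewrite -ltrBlDr.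
Qed.

(** W is the pointwise supremum of the lower semicontinuous functions v_k + K. *)
Lemma potential_lsc x (c : R) : (c%:E < W x)%E -> \forall z \near x, (c%:E < W z)%E.
Proof.
move=> /lt_W[k ck]; pose d := (v k x + K x - c) / 2.
have d0 : 0 < d by rewrite divr_gt0// subr_gt0.
near=> z; apply: (@lt_le_trans _ _ (v k z + K z)%:E); last exact: vK_le_W.
have vz : `|v k x - v k z| < d by near: z; have /cvgrPdist_lt/(_ _ d0) := @v_continuous k x.
have Kz : K x - d < K z by near: z; exact: concave_lsc.
rewrite lte_fin; move: vz; rewrite ltr_norml => /andP[_]; rewrite /d in Kz *; move: Kz; lra.
Unshelve. all: end_near. Qed.

Lemma potential_comparison (D : set V) (h : V -> R) : open D -> compact (closure D) ->
  {within closure D, continuous h} -> p_harmonic p D h ->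
  (forall x, closure D x -> ~ D x -> ((h x)%:E <= W x)%E) ->
  forall x, D x -> ((h x)%:E <= W x)%E.
Proof.
move=> oD cD ch harm bd x Dx; apply/lee_addgt0Pr => c c0.
have [m Km] := concave_support concK x.
(* The slack c is built into [l]: K + c <= l everywhere, with equality at x. *)
pose l (z : V) : R := \sum_j m 0 j * z 0 j + (K x - \sum_j m 0 j * x 0 j + c).
have lE z : l z = K x + \sum_j m 0 j * (z 0 j - x 0 j) + c.
  by under eq_bigr do rewrite mulrBr; rewrite sumrB /l; ring.
have lx : l x = K x + c by rewrite /l; ring.
have Kl z : K z + c <= l z by rewrite lE lerD2r.
have dl : dominative_super p l by exact: dominative_super_affine.
have cl : continuous l by case: dl => ? [? []].
have cB : compact (closure D `&` ~` D).
  apply: (subclosed_compact _ cD) => [|z []//].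
  by apply: closedI; [exact: closed_closure|exact: open_closedC].
have /compact_near_coveringP cov := cB.
have [N _ HN] : \forall k \near \oo, (closure D `&` ~` D) `<=`
    [set z | closure D z -> h z < l z + v k z].
  (* The covering statement is local in z and eventual in k at once: one index k found at z serves
     all larger k' by monotonicity, and [l] and [v k] are continuous although W is not. *)
  apply: cov => z [Dz nDz]; have hW := bd z Dz nDz.
  have [k hk] : exists k, h z - c < v k z + K z.
    apply: lt_W; apply: lt_le_trans hW; by rewrite lte_fin ltrBlDr ltrDl.
  (* A third of the gap, as h, [l] and [v k] may each move by less than [d]. *)
  pose d := (l z + v k z - h z) / 3.
  have d0 : 0 < d by rewrite divr_gt0// subr_gt0; move: hk (Kl z); lra.
  have near_h : \forall z' \near z, closure D z' -> `|h z - h z'| < d.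
    by have /subspace_continuousP/(_ z Dz)/cvgrPdist_lt/(_ _ d0) := ch.
  have near_l : \forall z' \near z, `|l z - l z'| < d.
    by have /cvgrPdist_lt/(_ _ d0) := @cl z.
  have near_v : \forall z' \near z, `|v k z - v k z'| < d.
    by have /cvgrPdist_lt/(_ _ d0) := @v_continuous k z.
  near=> z' k' => /= Dz'.
  have vk : v k z' <= v k' z'.
    by apply: truncated_nondecreasing => //; near: k'; exact: nbhs_infty_ge.
  have h1 : `|h z - h z'| < d by move: Dz'; near: z'.
  have h2 : `|l z - l z'| < d by near: z'.
  have h3 : `|v k z - v k z'| < d by near: z'.
  move: h1 h2 h3 vk; rewrite !ltr_norml /d => /andP[+ _] /andP[_ +] /andP[_ +]; lra.
have du := dominative_super_truncated N dl.
have [dv [ddv [cv cdv cddv dvE [ddvE dom]]]] := du.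
have bdN z : closure D z -> ~ D z -> h z < l z + v N z.
  by move=> Dz nDz; exact: (HN N (leqnn N) z (conj Dz nDz) Dz).
have := comparison n0 p2 oD cD ch harm cv cdv dvE
  (dominative_weak_super p2 cdv cddv ddvE dom) bdN Dx.
rewrite lx => hx; apply: (@le_trans _ _ ((v N x + K x)%:E + c%:E)%E).
  by rewrite -EFinD lee_fin; move: hx; lra.
by rewrite leeD2r.
Unshelve. all: end_near. Qed.

End Superharmonic.

Theorem theorem1p1 (R : realType) (n : nat) (p : R)
  (K : 'rV[R]_n -> R) (y : nat -> 'rV[R]_n) (a : nat -> R) :
  (0 < n)%N -> 2 <= p -> p < n%:R ->
  concave K -> (forall i, 0 <= a i) ->
  (exists x0 : 'rV[R]_n, (Wseries p a y x0 < +oo)%E) ->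
  p_superharmonic p [set: 'rV[R]_n]
    (fun x => (Wseries p a y x + (K x)%:E)%E).
Proof.
move=> n0 p2 pn concK a0 [x0 Wx0].
have e0 : 0 < (n%:R - p) / (p - 1) by rewrite divr_gt0// ?subr_gt0//; move: p2; lra.
have W0 x : (0 <= Wseries p a y x)%E by apply: nneseries_ge0 => i _ _; exact: kterm_ge0.
split; [|split; [|split]].
- by move=> x _; rewrite gt_eqF// (lt_le_trans (ltNyr (K x)))// leeDr.
- by exists x0; split => //; rewrite lt_eqF// lte_add_pinfty// ltry.
- by move=> x _ c; exact: potential_lsc.
- by move=> D h oD cD _ ch harm; exact: potential_comparison.
Qed.
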